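(* Let $\phi,\psi$ satisfy the wavelet condition (with constants $0<a'<a$) described in the context. Assume the error law $\varphi$ satisfies $|F[\varphi](t)|\ge Ce^{-c_0|t|^\alpha}$ for every $t\in\mathbb{R}$ and some $C,c_0,\alpha>0$. Let $f_n(\cdot,j_n)$ be the wavelet deconvolution estimator with $j_n=\frac1\alpha\log_2(\nu\log n)$ for some $\nu>0$ satisfying $c_0a^\alpha\nu<1/2$. Then for every $s,L>0$ there exists a constant $L'''$, depending only on $s,L,\phi,\psi,c_0,C,\alpha,\nu$, such that for every $n\ge2$, $$\sup_{f\in B(s,L)}E\sup_{x\in\mathbb{R}}|f_n(x,j_n)-f(x)|\le L'''\left(\frac{1}{\log n}\right)^{s/\alpha}.$$
   Context: Fourier transform: $F[h](t)=\int h(x)e^{-itx}\,dx$ (extended to $L^2(\mathbb{R})$), $F^{-1}$ its inverse, and $F[\varphi](t)=\int e^{-itx}\,d\varphi(x)$. Model: $Y=X+\epsilon$, with $X$ having density $f$ and $\epsilon$ independent of $X$ with law $\varphi$ (a probability measure on $\mathbb{R}$); $Y_1,\dots,Y_n$ are i.i.d. copies of $Y$. Wavelet condition: $\phi$ and $\psi$ are the (real-valued) scaling function and associated wavelet of an orthonormal multiresolution analysis of $L^2(\mathbb{R})$; $\phi,\psi\in L^p(\mathbb{R})$ for every $1\le p\le\infty$; for some $0<a'<a$, $\operatorname{supp}(F[\phi])\subset[-a,a]$ and $\operatorname{supp}(F[\psi])\subset[-a,a]\setminus[-a',a']$; and $\sup_{x}\sum_{k\in\mathbb{Z}}|\phi(x-k)|<\infty$,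 $\sup_{x}\sum_{k\in\mathbb{Z}}|\psi(x-k)|<\infty$. Estimator: with $\phi_{0k}(x)=\phi(x-k)$ and $j$ real, $$\tilde\phi_{jk}=F^{-1}\left[\frac{F[\phi_{0k}](2^{-j}\cdot)}{2^j\,\overline{F[\varphi]}}\right],\quad K_j^*(x,y)=2^j\sum_{k\in\mathbb{Z}}\phi(2^jx-k)\tilde\phi_{jk}(y),\quad f_n(x,j)=\frac1n\sum_{m=1}^nK_j^*(x,Y_m).$$ Hölder class: let $\phi^M,\psi^M$ be the Meyer scaling function and Meyer wavelet (real-valued, generating an orthonormal wavelet basis, with $C^\infty$ Fourier transforms; $F[\phi^M]$ is supported in $[-4\pi/3,4\pi/3]$ and $F[\psi^M]$ in $\{2\pi/3\le|t|\le 8\pi/3\}$). With $\alpha_{0k}(f)=\int f(x)\phi^M(x-k)\,dx$ and $\beta_{lk}(f)=\int f(x)2^{l/2}\psi^M(2^lx-k)\,dx$, put $\|f\|_{s,\infty,\infty}=\sup_{k}|\alpha_{0k}(f)|+\sup_{l\ge0}2^{l(s+1/2)}\sup_{k}|\beta_{lk}(f)|$. Then $B(s,L)=\{f\in L^\infty(\mathbb{R}): f\ge0,\ \int f=1,\ \|f\|_{s,\infty,\infty}\le L\}$, whose elements are identified with their continuous versions. *)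

(* Defs.v *)
From HB Require Import structures.
From mathcomp Require Import all_boot all_order all_algebra.
From mathcomp Require Import all_classical all_reals all_analysis.
From mathcomp Require Import complex.

Set Implicit Arguments.
Unset Strict Implicit.
Unset Printing Implicit Defensive.

Import Order.TTheory GRing.Theory Num.Theory.
Import numFieldNormedType.Exports.

Local Open Scope classical_set_scope.
Local Open Scope ring_scope.
Local Open Scope complex_scope.

Notation normc := ComplexField.Normc.normc.

Section Fourier.
Context {R : realType}.
Implicit Types (h : R -> R) (g : R -> R[i]).

Definition leb : {measure set (measurableTypeR R) -> \bar R} :=
  lebesgue_measure.

(* e^{i x} *)
Definition expi (x : R) : R[i] := cos x +i* sin x.

(* Bochner integral of a complex-valued function, by components; each
   component is 0 by convention when it is not integrable. *)
Definition cintegral d (T : measurableType d) (m : {measure set T -> \bar R})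
    (h : T -> R[i]) : R[i] :=
  (\int[m]_x complex.Re (h x)) +i* (\int[m]_x complex.Im (h x)).

(* The integral formula agrees with the L^2 transform on integrable
   square-integrable functions, the only ones it is applied to below. *)
Definition fourier h (t : R) : R[i] :=
  cintegral leb (fun x => (h x)%:C * expi (- (t * x))).

Definition fourier_law (law : probability (measurableTypeR R) R) (t : R)
    : R[i] :=
  cintegral law (fun x => expi (- (t * x))).

Definition inv_fourier g (y : R) : R[i] :=
  ((2 * pi)^-1)%:C * cintegral leb (fun t => g t * expi (t * y)).

Definition supp g : set R := closure [set t | g t != 0].

Definition smooth h := forall (m : nat) (t : R), derivable (derive1n m h) t 1.

End Fourier.

Section Wavelets.
Context {R : realType}.
Implicit Types (f g phi psi : R -> R) (e : int -> R -> R) (V : set (R -> R)).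

(* Elements of the real space L^2(R) are represented by functions, and the
   sets V below are saturated for a.e. equality because they are closed. *)
Definition L2 : set (R -> R) := [set f | f \in Lfun leb 2%:E].

Definition dist2 f g : \bar R := 'N[leb]_2%:E[EFin \o (f \- g)].

Definition inner2 f g : R := \int[leb]_x (f x * g x).

Definition closed_subspace2 V :=
  [/\ V `<=` L2,
      V (cst 0),
      forall (c : R) f g, V f -> V g -> V (fun x => c * f x + g x) &
      forall g, L2 g ->
        (forall eps : R, 0 < eps -> exists2 f, V f & (dist2 g f < eps%:E)%E) ->
        V g].

Definition orthonormal_basis e V :=
  [/\ forall k, V (e k),
      forall k l, inner2 (e k) (e l) = (k == l)%:R &
      forall f, V f -> forall eps : R, 0 < eps ->
        exists (ks : seq int) (c : int -> R),
          (dist2 f (fun x => \sum_(k <- ks) c k * e k x)%R < eps%:E)%E].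

Definition translates f (k : int) (x : R) : R := f (x - k%:~R).

Definition multiresolution (V : int -> set (R -> R)) phi :=
  [/\ forall j, closed_subspace2 (V j),
      forall j, V j `<=` V (j + 1),
      forall j f, V j f <-> V (j + 1) (fun x => f (2 * x)) &
      [/\ forall f, (forall j, V j f) -> {ae leb, forall x, f x = 0},
          forall g, L2 g -> forall eps : R, 0 < eps ->
            exists j, exists2 f, V j f & (dist2 g f < eps%:E)%E &
          orthonormal_basis (translates phi) (V 0)]].

Definition scaling_wavelet_pair phi psi :=
  exists V : int -> set (R -> R),
    multiresolution V phi /\
    orthonormal_basis (translates psi)
      [set g | V 1 g /\ forall f, V 0 f -> inner2 f g = 0].

Definition bounded_periodization phi :=
  (ereal_sup [set \esum_(k in [set: int]) (`|phi (x - k%:~R)|)%:E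
             | x in [set: R]] < +oo)%E.

(* phi is band-limited, hence a.e. equal to a unique continuous function; since
   the kernel below evaluates phi pointwise, phi has to be that version. *)
Definition wavelet_condition phi psi (a' a : R) :=
  [/\ scaling_wavelet_pair phi psi,
      continuous phi,
      forall p : \bar R, (1 <= p)%E ->
        phi \in Lfun leb p /\ psi \in Lfun leb p,
      [/\ 0 < a' < a,
          supp (fourier phi) `<=` `[- a, a] &
          supp (fourier psi) `<=` `[- a, a] `\` `[- a', a']] &
      bounded_periodization phi /\ bounded_periodization psi].

(* Integrability is implied by the smoothness and compact support of the
   transforms; it makes the integral formula for the transforms meaningful. *)
Definition meyer_pair phiM psiM :=
  [/\ scaling_wavelet_pair phiM psiM,
      phiM \in Lfun leb 1%:E /\ psiM \in Lfun leb 1%:E,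
      forall h, h = phiM \/ h = psiM ->
        smooth (fun t => complex.Re (fourier h t)) /\
        smooth (fun t => complex.Im (fourier h t)),
      supp (fourier phiM) `<=` `[- (4 * pi / 3), 4 * pi / 3] &
      supp (fourier psiM) `<=` [set t | 2 * pi / 3 <= `|t| <= 8 * pi / 3]].

Definition meyer_alpha phiM f (k : int) : R :=
  \int[leb]_x (f x * phiM (x - k%:~R)).

Definition meyer_beta psiM f (l : nat) (k : int) : R :=
  \int[leb]_x (f x * (2 `^ (l%:R / 2) * psiM (2 ^+ l * x - k%:~R))).

Definition holder_norm phiM psiM (s : R) f : \bar R :=
  (ereal_sup [set (`|meyer_alpha phiM f k|)%:E | k in [set: int]] +
   ereal_sup [set (2 `^ (l%:R * (s + 2^-1)))%:E *
                  ereal_sup [set (`|meyer_beta psiM f l k|)%:E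
                            | k in [set: int]]
             | l in [set: nat]])%E.

Definition holder_class phiM psiM (s L : R) : set (R -> R) :=
  [set f | [/\ continuous f,
               f \in Lfun leb +oo%E,
               forall x, 0 <= f x,
               (\int[leb]_x (f x)%:E = 1)%E &
               (holder_norm phiM psiM s f <= L%:E)%E]].

End Wavelets.

Section Estimator.
Context {R : realType}.
Variables (phi : R -> R) (law : probability (measurableTypeR R) R).

(* Sum over Z as limit of symmetric partial sums, the term of index i being
   u (i - N) for i = 0, ..., 2N; the series summed below converges absolutely. *)
Definition zsum (u : int -> R) : R :=
  limn (fun N : nat => \sum_(i < N.*2.+1) u (i%:Z - N%:Z)).

Definition czsum (u : int -> R[i]) : R[i] :=
  zsum (fun k => complex.Re (u k)) +i* zsum (fun k => complex.Im (u k)).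

Definition phi_tilde (j : R) (k : int) : R -> R[i] :=
  inv_fourier (fun t =>
    fourier (translates phi k) (2 `^ (- j) * t) /
    ((2 `^ j)%:C * (fourier_law law t)^*)).

Definition kernel_star (j x y : R) : R[i] :=
  (2 `^ j)%:C *
  czsum (fun k : int => (phi (2 `^ j * x - k%:~R))%:C * phi_tilde j k y).

Definition estimator (n : nat) (y : 'I_n -> R) (x j : R) : R[i] :=
  n%:R^-1 * \sum_(m < n) kernel_star j x (y m).

End Estimator.

Definition resolution {R : realType} (alpha nu : R) (n : nat) : R :=
  alpha^-1 * (ln (nu * ln n%:R) / ln 2).

Section Model.
Context {R : realType}.

Definition has_law d (T : measurableType d) (P : probability T R)
    (X : T -> R) (m : set R -> \bar R) :=
  forall A : set (measurableTypeR R), measurable A -> P (X @^-1` A) = m A.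

Definition has_density d (T : measurableType d) (P : probability T R)
    (X : T -> R) (f : R -> R) :=
  has_law P X (fun A => \int[leb]_(x in A) (f x)%:E)%E.

Definition independent2 d (T : measurableType d) (P : probability T R)
    (X Z : T -> R) :=
  forall A B : set (measurableTypeR R), measurable A -> measurable B ->
    P (X @^-1` A `&` Z @^-1` B) = (P (X @^-1` A) * P (Z @^-1` B))%E.

(* Taking some of the A m to be setT gives the product rule for subfamilies. *)
Definition mutually_independent d (T : measurableType d) (P : probability T R)
    (n : nat) (Y : 'I_n -> T -> R) :=
  forall A : 'I_n -> set (measurableTypeR R), (forall m, measurable (A m)) ->
    P (\bigcap_(m in [set: 'I_n]) (Y m @^-1` A m)) =
    (\prod_(m < n) P (Y m @^-1` A m))%E.

End Model.

(* Main.v *)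
Require Import Defs.
From HB Require Import structures.
From mathcomp Require Import all_boot all_order all_algebra.
From mathcomp Require Import all_classical all_reals all_analysis.
From mathcomp Require Import complex measurable_realfun ess_sup_inf.
From mathcomp Require Import ring lra zify.

(** Write r = 2^j for the resolution, f for the density of X and p + iq for the
    characteristic function of the error law. The estimator is compared with K f
    (x) = r sum_k phi(r x - k) c_k, where c_k is the integral of phi(r y - k)
    f(y); this K f is wproj phi r f.

    Stochastic part. The estimator has the same form as K f, with c_k replaced
    by an empirical mean of phi_tilde_k(Y_m). In the frequency domain both are
    the integral of one symbol M_k(t), the transform of phi(. - k) at t / r
    divided by r(p + iq), against the empirical, respectively the true,
    characteristic function of Y (phi_tildeE, pairing_mean). Since phi is
    band-limited, M_k vanishes for |t| > ra, and its modulus is at most an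
    envelope that does not depend on k. Hence the errors on all coefficients are
    simultaneously at most one random variable, the noise: the envelope
    integrated against the deviation of the empirical characteristic function.
    As the periodization of |phi| is bounded, the error at every x is at most a
    constant times r times the noise (stochastic_error). The suprema over k and
    x have thus been taken before any expectation; by independence the deviation
    at each frequency has expectation at most n^(-1/2) (mean_deviation), and
    Fubini bounds the mean of the noise (noise_expectation).

    Bias. K f - f is tested against the normalized indicator eta of a small
    interval around x. The residual rho of eta after projection on the
    translates of phi at scale r is orthogonal, up to a small error, to every
    band-limited function of band at most r a', because the wavelets psi at
    scales at least r have no frequency below r a' (band_orthogonal). Expanding
    f in the Meyer basis, only the Meyer levels with 2^l above a multiple of r
    contribute (and the scaling functions, when r is small). There the Hoelder
    norm bounds the coefficients of f by L 2^(-l(s + 1/2)), while the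
    coefficients of rho on level l sum to at most a constant times 2^(l/2) and
    the L1 norm of rho, since Meyer functions decay quadratically and so have
    bounded periodizations. The geometric series gives a bound of order r^(-s)
    (bias_core), uniformly in eta; letting the interval shrink and using
    continuity gives the bound at x (bias_pointwise).

    What this consumes: a wavelet pair generates an orthonormal basis
    (dilated_family_orthonormal, dilated_family_spanned), which rests on the
    orthogonal projection on a closed subspace and on the Riesz-Fischer theorem;
    band-limited functions satisfy Fourier inversion almost everywhere
    (inversion_ae), from which the quadratic decay and Parseval's identity are
    read off.

    Rate. With r = (nu ln n)^(1/alpha) the lower bound on the characteristic
    function on [- r a, r a] is C n^(- kappa) with kappa = c0 a^alpha nu < 1/2,
    so the stochastic part is of order r n^(kappa - 1/2), which is smaller than
    any negative power of ln n, and the bias r^(-s) is of the order claimed. The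
    constant must not depend on a; neither does the estimator, so one admissible
    pair (a', a) is chosen once and for all, and if there is none the assertion
    is empty. *)

Set Implicit Arguments.
Unset Strict Implicit.
Unset Printing Implicit Defensive.

Import Order.TTheory GRing.Theory Num.Theory.
Import numFieldNormedType.Exports.

Local Open Scope classical_set_scope.
Local Open Scope ring_scope.
Local Open Scope complex_scope.

(** * Summable functions and their integrals *)

Notation summable_fun mu f := (integrable mu setT (EFin \o f)).

Section RealIntegral.
Context d (T : measurableType d) (R : realType)
  (mu : {measure set T -> \bar R}).
Implicit Types f g h : T -> R.

Lemma summable_measurable f : summable_fun mu f -> measurable_fun setT f.
Proof. by move/measurable_int/measurable_EFinP. Qed.

Lemma summable_le f g : measurable_fun setT g -> summable_fun mu f ->
  (forall x, `|g x| <= f x) -> summable_fun mu g.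
Proof.
move=> mg sf gf; apply: (le_integrable measurableT _ _ sf).
  exact/measurable_EFinP.
by move=> x _ /=; rewrite lee_fin (le_trans (gf x))// ler_norm.
Qed.

Lemma summableD f g : summable_fun mu f -> summable_fun mu g ->
  summable_fun mu (fun x => f x + g x).
Proof.
move=> sf sg; rewrite (_ : EFin \o _ = (EFin \o f) \+ (EFin \o g))%E//.
exact: integrableD.
Qed.

Lemma summableB f g : summable_fun mu f -> summable_fun mu g ->
  summable_fun mu (fun x => f x - g x).
Proof.
move=> sf sg; rewrite (_ : EFin \o _ = (EFin \o f) \- (EFin \o g))%E//.
exact: integrableB.
Qed.

Lemma summableZ c f : summable_fun mu f -> summable_fun mu (fun x => c * f x).
Proof.
move=> sf; rewrite (_ : EFin \o _ = (fun x => c%:E * (EFin \o f) x))%E//.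
exact: integrableZl.
Qed.

Lemma summable0 : summable_fun mu (fun=> 0 : R).
Proof. exact: integrable0. Qed.

Lemma summable_norm f : summable_fun mu f -> summable_fun mu (fun x => `|f x|).
Proof.
move=> sf; apply: (le_integrable measurableT _ _ sf).
  by apply/measurable_EFinP/measurableT_comp => //; exact: summable_measurable.
by move=> x _ /=; rewrite normr_id.
Qed.

Lemma summable_sum (I : Type) (s : seq I) (F : I -> T -> R) :
  (forall i, summable_fun mu (F i)) ->
  summable_fun mu (fun x => \sum_(i <- s) F i x).
Proof.
move=> sF; elim: s => [|i s ih].
  by under [X in EFin \o X]eq_fun do rewrite big_nil; exact: summable0.
by under [X in EFin \o X]eq_fun do rewrite big_cons; apply: summableD.
Qed.

Lemma RintD f g : summable_fun mu f -> summable_fun mu g ->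
  \int[mu]_x (f x + g x) = \int[mu]_x f x + \int[mu]_x g x.
Proof. exact: RintegralD. Qed.

Lemma RintB f g : summable_fun mu f -> summable_fun mu g ->
  \int[mu]_x (f x - g x) = \int[mu]_x f x - \int[mu]_x g x.
Proof. exact: RintegralB. Qed.

Lemma RintZ c f : summable_fun mu f ->
  \int[mu]_x (c * f x) = c * \int[mu]_x f x.
Proof. exact: RintegralZl. Qed.

Lemma Rint0 : \int[mu]_x (0 : R) = 0.
Proof. by rewrite /Rintegral integral0. Qed.

Lemma Rintsum (I : Type) (s : seq I) (F : I -> T -> R) :
  (forall i, summable_fun mu (F i)) ->
  \int[mu]_x (\sum_(i <- s) F i x) = \sum_(i <- s) \int[mu]_x F i x.
Proof.
move=> sF; elim: s => [|i s ih].
  by rewrite big_nil; under eq_Rintegral do rewrite big_nil; exact: Rint0.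
rewrite big_cons -ih -RintD//; last exact: summable_sum.
by under eq_Rintegral do rewrite big_cons.
Qed.

Lemma Rintle f g : summable_fun mu f -> summable_fun mu g ->
  (forall x, f x <= g x) -> \int[mu]_x f x <= \int[mu]_x g x.
Proof. by move=> sf sg fg; apply: le_Rintegral. Qed.

Lemma Rint_norm f : summable_fun mu f ->
  `|\int[mu]_x f x| <= \int[mu]_x `|f x|.
Proof. exact: le_normr_Rintegral. Qed.

Lemma Rint_norm_le f g : summable_fun mu f -> summable_fun mu g ->
  (forall x, `|f x| <= g x) -> `|\int[mu]_x f x| <= \int[mu]_x g x.
Proof.
by move=> sf sg fg; rewrite (le_trans (Rint_norm sf))// Rintle//; exact: summable_norm.
Qed.

Lemma Rint_EFin f : summable_fun mu f ->
  (\int[mu]_x (f x)%:E = (\int[mu]_x f x)%:E)%E.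
Proof. by move=> sf; rewrite /Rintegral fineK//; exact: integrable_fin_num. Qed.

Lemma Rint_ae f g : measurable_fun setT f -> measurable_fun setT g ->
  {ae mu, forall x, f x = g x} -> \int[mu]_x f x = \int[mu]_x g x.
Proof.
move=> mf mg fg; rewrite /Rintegral; congr fine; apply: ae_eq_integral => //.
- exact/measurable_EFinP.
- exact/measurable_EFinP.
- by apply: filterS fg => x + _ => ->.
Qed.

Lemma summable_ge0 f : measurable_fun setT f -> (forall x, 0 <= f x) ->
  (\int[mu]_x (f x)%:E < +oo)%E -> summable_fun mu f.
Proof.
move=> mf f0 foo; apply/integrableP; split; first exact/measurable_EFinP.
by under eq_integral do rewrite /= ger0_norm//.
Qed.

Lemma summable_le_ae f g : measurable_fun setT g -> summable_fun mu f ->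
  {ae mu, forall x, `|g x| <= f x} -> summable_fun mu g.
Proof.
move=> mg sf gf; apply/integrableP; split; first exact/measurable_EFinP.
have /integrableP[_] := sf; apply: le_lt_trans.
apply: ae_ge0_le_integral => //.
- by apply: measurableT_comp => //; exact/measurable_EFinP.
- by apply: measurableT_comp => //; exact: measurable_int sf.
- by apply: filterS gf => x /= h _; rewrite lee_fin (le_trans h)// ler_norm.
Qed.

Lemma Rint_dct (f_ : nat -> T -> R) f g :
  (forall n, measurable_fun setT (f_ n)) -> measurable_fun setT f ->
  {ae mu, forall x, f_ ^~ x @ \oo --> f x} -> summable_fun mu g ->
  (forall n x, `|f_ n x| <= g x) ->
  (fun n => \int[mu]_x f_ n x) @ \oo --> \int[mu]_x f x.
Proof.
move=> mf_ mf cf sg fg.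
have [] := @dominated_convergence _ _ _ mu setT measurableT
  (fun n => EFin \o f_ n) (EFin \o f) (EFin \o g).
- by move=> n; exact/measurable_EFinP.
- exact/measurable_EFinP.
- by apply: filterS cf => x h _; apply: cvg_EFin => //; exact: nearW.
- by [].
- by apply: aeW => x n _ /=; rewrite lee_fin.
move=> sf _ h; apply: fine_cvg; rewrite /Rintegral.
rewrite fineK//; exact: integrable_fin_num.
Qed.

Lemma ae_imply (P Q : T -> Prop) : {ae mu, forall x, P x} ->
  (forall x, P x -> Q x) -> {ae mu, forall x, Q x}.
Proof. by move=> h PQ; apply: filterS h. Qed.

Lemma ae_and (P Q : T -> Prop) : {ae mu, forall x, P x} ->
  {ae mu, forall x, Q x} -> {ae mu, forall x, P x /\ Q x}.
Proof. by move=> hP hQ; apply: filterS2 hP hQ. Qed.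

(** The integral of a nonnegative function is a supremum over simple functions
    below it, so it is monotone without any measurability. The risk integrates a
    supremum over an uncountable set of x, whose measurability is thereby
    avoided. *)
Lemma integral_le_any (f g : T -> \bar R) :
  (forall x, 0 <= f x)%E -> (forall x, f x <= g x)%E ->
  (\int[mu]_x f x <= \int[mu]_x g x)%E.
Proof.
move=> f0 fg; have g0 x : (0 <= g x)%E by rewrite (le_trans (f0 x)).
rewrite !ge0_integralTE//; apply: le_ereal_sup => _ [h hf <-].
by exists h => // x; rewrite (le_trans (hf x)).
Qed.

End RealIntegral.

Section Fubini.
Context d1 d2 (T1 : measurableType d1) (T2 : measurableType d2) (R : realType)
  (m1 : {sigma_finite_measure set T1 -> \bar R})
  (m2 : {sigma_finite_measure set T2 -> \bar R}).
Variables (F : T1 * T2 -> R) (u : T1 -> R) (v : T2 -> R).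
Hypotheses (mF : measurable_fun setT F) (su : summable_fun m1 u)
  (sv : summable_fun m2 v) (Fuv : forall x y, `|F (x, y)| <= u x * v y).

(** Every use of Fubini below has an integrand dominated by a product u(x) v(y)
    of summable functions; the section derives all the forms needed from this
    single domination. *)
Lemma summable_prod : (m1 \x m2)%E.-integrable setT (EFin \o F).
Proof.
apply/integrable12ltyP; first exact/measurable_EFinP.
apply: (@le_lt_trans _ _ (\int[m1]_x ((fine (\int[m2]_y `|v y|%:E)) * `|u x|)%:E)%E).
  apply: ge0_le_integral => //.
  - by move=> x _; exact: integral_ge0.
  - apply: (measurable_fun_fubini_tonelli_F (fun z => `|(EFin \o F) z|%E)) => //.
    by apply: measurableT_comp => //; exact/measurable_EFinP.
  - apply/measurable_EFinP/measurable_funM => //.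
    by apply: measurableT_comp => //; exact: summable_measurable su.
  - move=> x _; rewrite mulrC EFinM fineK; last first.
      by apply: integrable_fin_num => //; exact: summable_norm.
    rewrite -ge0_integralZl_EFin//; last first.
      by apply/measurable_EFinP/measurableT_comp => //; exact: summable_measurable sv.
    apply: ge0_le_integral => //.
    + apply: measurableT_comp => //; apply/measurable_EFinP.
      exact: measurableT_comp mF _.
    + apply/measurable_EFinP/measurable_funM => //.
      by apply: measurableT_comp => //; exact: summable_measurable sv.
    + by move=> y _ /=; rewrite lee_fin -normrM (le_trans (Fuv x y))// ler_norm.
have := @summableZ _ _ _ m1 (fine (\int[m2]_y `|v y|%:E)) _ (summable_norm su).
move/integrable_fin_num => /(_ measurableT); rewrite ge0_fin_numE//.
by apply: integral_ge0 => x _; rewrite lee_fin mulr_ge0// fine_ge0// integral_ge0.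
Qed.

Lemma summable_slice1 x : summable_fun m2 (fun y => F (x, y)).
Proof.
apply: (@summable_le _ _ _ m2 (fun y => u x * v y)).
- exact: measurableT_comp mF _.
- exact: summableZ.
- exact: Fuv.
Qed.

Lemma summable_slice2 y : summable_fun m1 (fun x => F (x, y)).
Proof.
apply: (@summable_le _ _ _ m1 (fun x => v y * u x)).
- exact: measurableT_comp mF _.
- exact: summableZ.
- by move=> x; rewrite mulrC.
Qed.

Lemma summable_marginal1 : summable_fun m1 (fun x => \int[m2]_y F (x, y)).
Proof.
have := integrable_fubini_F summable_prod; apply: eq_integrable => // x _.
by rewrite /fubini_F /= Rint_EFin//; exact: summable_slice1.
Qed.

Lemma summable_marginal2 : summable_fun m2 (fun y => \int[m1]_x F (x, y)).
Proof.
apply/integrableP; split.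
  have := measurable_fubini_G summable_prod; congr (measurable_fun _ _).
  by apply/funext => y; rewrite /fubini_G /= Rint_EFin//; exact: summable_slice2.
have sr := @summableZ _ _ _ m2 (\int[m1]_x u x) _ sv.
have /integrableP[_] := summable_norm sr; apply: le_lt_trans; apply: ge0_le_integral => //.
- have := measurable_fubini_G summable_prod => h; apply: measurableT_comp => //.
  move: h; congr (measurable_fun _ _).
  by apply/funext => y; rewrite /fubini_G /= Rint_EFin//; exact: summable_slice2.
- apply: measurableT_comp => //; exact: measurable_int (summable_norm sr).
- move=> y _ /=; rewrite lee_fin normr_id.
  rewrite (le_trans _ (ler_norm _))//.
  rewrite mulrC -RintZ//; apply: Rint_norm_le.
  + exact: summable_slice2.
  + exact: summableZ.
  + by move=> x; rewrite mulrC.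
Qed.

Lemma Rint_fubini :
  \int[m1]_x (\int[m2]_y F (x, y)) = \int[m2]_y (\int[m1]_x F (x, y)).
Proof.
have := Fubini summable_prod; rewrite {1 4}/Rintegral => h; congr fine.
transitivity (\int[m1]_x \int[m2]_y (EFin \o F) (x, y))%E.
  by apply: eq_integral => x _; rewrite Rint_EFin//; exact: summable_slice1.
rewrite h; apply: eq_integral => y _; rewrite Rint_EFin//.
exact: summable_slice2.
Qed.

End Fubini.

(** * Affine changes of variables *)

Section Affine.
Context {R : realType}.
Notation mu := (@lebesgue_measure R).
Implicit Types (f g : R -> R) (r b : R).

Lemma measurable_affine r b :
  measurable_fun setT (fun x : measurableTypeR R => r * x + b : measurableTypeR R).
Proof.
apply: measurable_funD => //; apply: measurable_funM => //.
Qed.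

(** Scaling the pushforward by r gives a measure that agrees with Lebesgue
    measure on half-open intervals. *)
Lemma lebesgue_affine r b (A : set (measurableTypeR R)) : 0 < r ->
  measurable A ->
  (mu A = r%:E *
   pushforward mu (fun x : measurableTypeR R => (r * x + b)%R : measurableTypeR R) A)%E.
Proof.
move=> r0 mA.
pose aff := fun x : measurableTypeR R => r * x + b : measurableTypeR R.
pose mixin := isMeasurableFun.Build _ _ _ _ aff (measurable_affine r b).
pose F : {mfun _ >-> _} := HB.pack aff mixin.
pose k : {nonneg R} := NngNum (ltW r0).
apply: (@lebesgue_measure_unique _ (mscale k (pushforward mu F))) => //.
move=> _ [[u v]] _ <-;
change (mu `]u, v]%classic = (r%:E * mu (aff @^-1` `]u, v]%classic))%E).
rewrite (_ : aff @^-1` _ = `](u - b) / r, (v - b) / r]%classic); last first.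
  apply/seteqP; split=> x /=; rewrite !in_itv /= ltr_pdivrMr// ler_pdivlMr//;
    rewrite ltrBlDr lerBrDr [x * r]mulrC; exact.
rewrite !lebesgue_measure_itv/= !lte_fin ltr_pM2r ?invr_gt0// ltrBDr subrK.
case: ifP => uv; last by rewrite mule0.
by rewrite -EFinD -EFinM -mulrBl opprB addrA subrK mulrC divfK ?gt_eqF.
Qed.

Lemma ge0_integral_affine r b (f : R -> \bar R) : 0 < r ->
  measurable_fun setT f -> (forall x, 0 <= f x)%E ->
  (\int[mu]_x f (r * x + b)%R = (r^-1)%:E * \int[mu]_x f x)%E.
Proof.
move=> r0 mf f0.
pose aff := fun x : measurableTypeR R => r * x + b : measurableTypeR R.
pose mixin := isMeasurableFun.Build _ _ _ _ aff (measurable_affine r b).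
pose F : {mfun _ >-> _} := HB.pack aff mixin.
pose k : {nonneg R} := NngNum (ltW r0).
have -> : (\int[mu]_x f x = r%:E * \int[pushforward mu F]_x f x)%E.
  rewrite -(ge0_integral_mscale (pushforward mu F) measurableT k)//.
  by apply: eq_measure_integral => A mA _; exact: (lebesgue_affine b r0 mA).
rewrite muleA -EFinM mulVf ?gt_eqF// mul1e ge0_integral_pushforward//.
Qed.

Lemma summable_affine r b f : 0 < r -> summable_fun mu f ->
  summable_fun mu (fun x => f (r * x + b)).
Proof.
move=> r0 sf; have mf := summable_measurable sf; apply/integrableP; split.
  apply/measurable_EFinP.
  exact: (measurableT_comp mf (measurable_affine r b)).
rewrite (@ge0_integral_affine r b (fun x => `|(f x)%:E|)%E)//.
- have := integrable_fin_num measurableT (summable_norm sf).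
  rewrite /comp ge0_fin_numE; last exact: integral_ge0.
  by move=> h; rewrite lte_mul_pinfty// ?lee_fin ?invr_ge0 1?ltW.
- by apply: measurableT_comp => //; exact/measurable_EFinP.
Qed.

(** Splitting f into its positive and negative parts reduces to nonnegative
    functions. *)
Lemma Rint_affine r b f : 0 < r -> summable_fun mu f ->
  \int[mu]_x f (r * x + b) = r^-1 * \int[mu]_x f x.
Proof.
move=> r0 sf; have mf := summable_measurable sf.
have ge0 g : measurable_fun setT g -> (forall x, 0 <= g x) ->
    \int[mu]_x g (r * x + b) = r^-1 * \int[mu]_x g x.
  move=> mg g0; rewrite /Rintegral.
  rewrite (@ge0_integral_affine r b (EFin \o g))//; last exact/measurable_EFinP.
    have [h|h] := ltP (\int[mu]_x (g x)%:E)%E +oo%E.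
      by rewrite fineM// ge0_fin_numE// integral_ge0// => x _; rewrite lee_fin.
    move: h; rewrite leye_eq => /eqP h; rewrite /comp h gt0_muley/= ?mulr0//.
    by rewrite lte_fin invr_gt0.
have spos g : summable_fun mu g -> summable_fun mu (fun x => Num.max (g x) 0).
  move=> sg; apply: (summable_le _ (summable_norm sg)).
    exact: measurable_maxr (summable_measurable sg) _.
  by move=> x; rewrite ger0_norm ?le_max ?lexx ?orbT// ge_max ler_norm normr_ge0.
have sN : summable_fun mu (fun x => - f x).
  by under [X in EFin \o X]eq_fun do rewrite -mulN1r; exact: summableZ.
have fE x : f x = Num.max (f x) 0 - Num.max (- f x) 0.
  have [h|h] := leP 0 (f x).
    by rewrite max_r ?subr0// lerNl oppr0.
  by rewrite max_l ?sub0r ?opprK// lerNr oppr0 ltW.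
under eq_Rintegral do rewrite fE.
under [in RHS]eq_Rintegral do rewrite fE.
rewrite RintB ?RintB; [|exact: spos|exact: spos| |].
- rewrite (@ge0 (fun x => Num.max (f x) 0)) ?(@ge0 (fun x => Num.max (- f x) 0)) ?mulrBr//.
  + exact: measurable_maxr (summable_measurable sN) _.
  + by move=> x; rewrite le_max lexx orbT.
  + exact: measurable_maxr mf _.
  + by move=> x; rewrite le_max lexx orbT.
- exact: (@summable_affine r b (fun x => Num.max (f x) 0) r0 (spos _ sf)).
- exact: (@summable_affine r b (fun x => Num.max (- f x) 0) r0 (spos _ sN)).
Qed.

End Affine.

(** * The space L2 *)

Section L2space.
Context {R : realType}.
Notation mu := (@lebesgue_measure R).
Implicit Types (f g h : R -> R) (c : R).

Lemma L2P f : L2 f <->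
  measurable_fun setT f /\ summable_fun mu (fun x => f x * f x).
Proof.
have e2 : (fun x => `|(f x)%:E| `^ 2)%E = (fun x => (f x * f x)%:E).
  apply/funext => x /=; congr EFin.
  by rewrite powR_mulrn// -normrX ger0_norm// sqr_ge0.
have r2 : (2%:R : R) != 0 by rewrite pnatr_eq0.
split=> [/andP[/[!inE] mf]|[mf sf]].
  rewrite /finite_norm => fn; split => //.
  have ff : forall x, 0 <= f x * f x by move=> x; rewrite -expr2 sqr_ge0.
  apply: summable_ge0 => //; first exact: measurable_funM.
  have := @poweR_Lnorm _ _ _ leb (EFin \o f) 2%:R r2.
  rewrite /comp e2 /leb => <-; rewrite poweR_lty//.
rewrite /L2 /= /Lfun inE; apply/andP; split; first by rewrite inE.
rewrite /finLfun inE /= /finite_norm.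
rewrite unlock /Lnorm /comp e2 poweR_lty//.
by rewrite /leb Rint_EFin// ltry.
Qed.

Lemma L2_measurable f : L2 f -> measurable_fun setT f.
Proof. by move/L2P => []. Qed.

Lemma L2_sqr_summable f : L2 f -> summable_fun mu (fun x => f x * f x).
Proof. by move/L2P => []. Qed.

Lemma L2_mul_summable f g : L2 f -> L2 g -> summable_fun mu (fun x => f x * g x).
Proof.
move=> /L2P[mf sf] /L2P[mg sg].
apply: (summable_le _ (summableD sf sg)); first exact: measurable_funM.
move=> x; rewrite normrM.
have e a : a * a = `|a| * `|a| :> R by rewrite -normrM ger0_norm// -expr2 sqr_ge0.
rewrite (e (f x)) (e (g x)).
have := sqr_ge0 (`|f x| - `|g x|); have := normr_ge0 (f x); have := normr_ge0 (g x).
by move: `|f x| `|g x| => u v; nra.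
Qed.

Lemma L2D f g : L2 f -> L2 g -> L2 (fun x => f x + g x).
Proof.
move=> Lf Lg; apply/L2P; split; first exact: measurable_funD (L2_measurable Lf) (L2_measurable Lg).
under [X in EFin \o X]eq_fun do rewrite mulrDl !mulrDr.
by apply: summableD; apply: summableD; apply: L2_mul_summable.
Qed.

Lemma L2Z c f : L2 f -> L2 (fun x => c * f x).
Proof.
move=> Lf; apply/L2P; split; first by apply: measurable_funM => //; exact: L2_measurable.
under [X in EFin \o X]eq_fun do rewrite mulrACA.
exact/summableZ/L2_sqr_summable.
Qed.

Lemma L2_0 : L2 (fun=> 0 : R).
Proof.
apply/L2P; split => //; under [X in EFin \o X]eq_fun do rewrite mulr0; exact: summable0.
Qed.

Lemma L2B f g : L2 f -> L2 g -> L2 (fun x => f x - g x).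
Proof.
move=> Lf Lg; under eq_fun do rewrite -mulN1r.
exact: (L2D Lf (L2Z _ Lg)).
Qed.

Lemma L2sum (I : Type) (s : seq I) (F : I -> R -> R) :
  (forall i, L2 (F i)) -> L2 (fun x => \sum_(i <- s) F i x).
Proof.
move=> LF; elim: s => [|i s ih].
  by under eq_fun do rewrite big_nil; exact: L2_0.
by under eq_fun do rewrite big_cons; exact: L2D.
Qed.

Lemma innerC f g : inner2 f g = inner2 g f.
Proof. by rewrite /inner2; under eq_Rintegral do rewrite mulrC. Qed.

Lemma innerDl f g h : L2 f -> L2 g -> L2 h ->
  inner2 (fun x => f x + g x) h = inner2 f h + inner2 g h.
Proof.
move=> Lf Lg Lh; rewrite /inner2 -RintD; [|exact: L2_mul_summable..].
by under eq_Rintegral do rewrite mulrDl.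
Qed.

Lemma innerZl c f g : L2 f -> L2 g ->
  inner2 (fun x => c * f x) g = c * inner2 f g.
Proof.
move=> Lf Lg; rewrite /inner2 -RintZ; last exact: L2_mul_summable.
by under eq_Rintegral do rewrite -mulrA.
Qed.

Lemma innerBl f g h : L2 f -> L2 g -> L2 h ->
  inner2 (fun x => f x - g x) h = inner2 f h - inner2 g h.
Proof.
move=> Lf Lg Lh; rewrite /inner2 -RintB; [|exact: L2_mul_summable..].
by under eq_Rintegral do rewrite mulrBl.
Qed.

Lemma inner_suml (I : Type) (s : seq I) (F : I -> R -> R) g :
  (forall i, L2 (F i)) -> L2 g ->
  inner2 (fun x => \sum_(i <- s) F i x) g = \sum_(i <- s) inner2 (F i) g.
Proof.
move=> LF Lg; rewrite /inner2 -Rintsum; last by move=> i; exact: L2_mul_summable.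
by under eq_Rintegral do rewrite mulr_suml.
Qed.

Lemma innerDr f g h : L2 f -> L2 g -> L2 h ->
  inner2 f (fun x => g x + h x) = inner2 f g + inner2 f h.
Proof. by move=> Lf Lg Lh; rewrite innerC innerDl// !(innerC f). Qed.

Lemma innerBr f g h : L2 f -> L2 g -> L2 h ->
  inner2 f (fun x => g x - h x) = inner2 f g - inner2 f h.
Proof. by move=> Lf Lg Lh; rewrite innerC innerBl// !(innerC f). Qed.

Lemma innerZr c f g : L2 f -> L2 g ->
  inner2 f (fun x => c * g x) = c * inner2 f g.
Proof. by move=> Lf Lg; rewrite innerC innerZl// innerC. Qed.

Lemma inner_sumr (I : Type) (s : seq I) (F : I -> R -> R) g :
  (forall i, L2 (F i)) -> L2 g ->
  inner2 g (fun x => \sum_(i <- s) F i x) = \sum_(i <- s) inner2 g (F i).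
Proof.
move=> LF Lg; rewrite innerC inner_suml//.
by apply: eq_bigr => i _; rewrite innerC.
Qed.

Definition sqnorm f : R := inner2 f f.

Lemma sqn_ge0 f : 0 <= sqnorm f.
Proof. by apply: Rintegral_ge0 => x _; rewrite -expr2 sqr_ge0. Qed.

Lemma sqnB f g : L2 f -> L2 g ->
  sqnorm (fun x => f x - g x) = sqnorm f - 2 * inner2 f g + sqnorm g.
Proof.
move=> Lf Lg; have Lfg := L2B Lf Lg.
by rewrite /sqnorm innerBl// !innerBr// (innerC g f); ring.
Qed.

Lemma sqnZ c f : L2 f -> sqnorm (fun x => c * f x) = c ^+ 2 * sqnorm f.
Proof.
by move=> Lf; rewrite /sqnorm innerZl ?innerZr//; [ring|exact: L2Z].
Qed.

Lemma cauchy_schwarz f g : L2 f -> L2 g ->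
  (inner2 f g) ^+ 2 <= sqnorm f * sqnorm g.
Proof.
move=> Lf Lg.
(* The discriminant argument; the degenerate case sqnorm g = 0 uses a t that makes the affine
   function of t equal to -1. *)
have key t : 0 <= sqnorm f - 2 * t * inner2 f g + t ^+ 2 * sqnorm g.
  have := sqn_ge0 (fun x => f x - t * g x).
  by rewrite sqnB ?sqnZ ?innerZr ?mulrA//; exact: L2Z.
have [g0|g0] := eqVneq (sqnorm g) 0.
  have [->|i0] := eqVneq (inner2 f g) 0; first by rewrite expr0n g0 mulr0.
  have := key ((sqnorm f + 1) / (2 * inner2 f g)); rewrite g0 mulr0 addr0.
  have -> : 2 * ((sqnorm f + 1) / (2 * inner2 f g)) * inner2 f g = sqnorm f + 1.
    by field.
  by rewrite opprD addrA subrr sub0r oppr_ge0 ler10.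
have gp : 0 < sqnorm g by rewrite lt_neqAle eq_sym g0 sqn_ge0.
have := key (inner2 f g / sqnorm g).
have -> : sqnorm f - 2 * (inner2 f g / sqnorm g) * inner2 f g +
    (inner2 f g / sqnorm g) ^+ 2 * sqnorm g = (sqnorm f * sqnorm g - inner2 f g ^+ 2) / sqnorm g.
  by field.
by rewrite pmulr_lge0 ?invr_gt0// subr_ge0.
Qed.

Lemma inner_norm f g : L2 f -> L2 g ->
  `|inner2 f g| <= Num.sqrt (sqnorm f) * Num.sqrt (sqnorm g).
Proof.
move=> Lf Lg; rewrite -sqrtrM ?sqn_ge0// -sqrtr_sqr ler_sqrt.
  exact: cauchy_schwarz.
by rewrite mulr_ge0 ?sqn_ge0.
Qed.

Lemma sqnD_le f g : L2 f -> L2 g ->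
  sqnorm (fun x => f x + g x) <= 2 * sqnorm f + 2 * sqnorm g.
Proof.
move=> Lf Lg; have := sqn_ge0 (fun x => f x - g x); rewrite sqnB//.
have -> : sqnorm (fun x => f x + g x) = sqnorm f + 2 * inner2 f g + sqnorm g.
  have Lfg := L2D Lf Lg.
  by rewrite /sqnorm innerDl// !innerDr// (innerC g f); ring.
by move: (inner2 f g) (sqnorm f) (sqnorm g) => ? ? ?; lra.
Qed.

Lemma sqn_tri f g h : L2 f -> L2 g -> L2 h ->
  sqnorm (fun x => f x - h x) <=
    2 * sqnorm (fun x => f x - g x) + 2 * sqnorm (fun x => g x - h x).
Proof.
move=> Lf Lg Lh; have := sqnD_le (L2B Lf Lg) (L2B Lg Lh).
by rewrite (_ : (fun x => _) = (fun x => f x - h x))//; apply/funext => x; ring.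
Qed.

(** Turns the extended-real L2 distance into a comparison of squared norms, so
    that everything after it happens in the reals. *)
Lemma dist2_lt f g eps : 0 < eps -> L2 f -> L2 g ->
  ((dist2 f g < eps%:E)%E <-> sqnorm (fun x => f x - g x) < eps ^+ 2).
Proof.
move=> e0 Lf Lg; have LB := L2B Lf Lg; have sLB := L2_sqr_summable LB.
have -> : dist2 f g = (Num.sqrt (sqnorm (fun x => f x - g x)))%:E.
  rewrite /dist2 unlock /Lnorm.
  have e2 : (fun x => `|(EFin \o (f \- g)%R) x| `^ 2)%E =
      (fun x => ((f x - g x) * (f x - g x))%R%:E).
    apply/funext => x /=; congr EFin.
    by rewrite powR_mulrn// -normrX ger0_norm// sqr_ge0.
  rewrite e2 /leb Rint_EFin// poweR_EFin powR12_sqrt//.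
  exact: sqn_ge0.
rewrite lte_fin -{1}(gtr0_norm e0) -sqrtr_sqr ltr_sqrt//.
by rewrite exprn_gt0.
Qed.

Lemma L2_affine r b f : 0 < r -> L2 f -> L2 (fun x => f (r * x + b)).
Proof.
move=> r0 Lf; apply/L2P; split.
  exact: (measurableT_comp (L2_measurable Lf) (measurable_affine r b)).
exact: (summable_affine _ r0 (L2_sqr_summable Lf)).
Qed.

Lemma inner_affine r b f g : 0 < r -> L2 f -> L2 g ->
  inner2 (fun x => f (r * x + b)) (fun x => g (r * x + b)) = r^-1 * inner2 f g.
Proof.
by move=> r0 Lf Lg; rewrite /inner2 -(Rint_affine b r0 (L2_mul_summable Lf Lg)).
Qed.

End L2space.

(** * Completeness of L2 *)

Section RieszFischer.
Context {R : realType}.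
Notation mu := (@lebesgue_measure R).
Implicit Types (f g h : R -> R) (c : R).

(** The weighted Cauchy-Schwarz inequality behind the almost sure convergence in
    the Riesz-Fischer theorem: the weights 2^n pay for the number of terms. Its
    induction uses (x + y)^2 <= 2 x^2 + 2 y^2. *)
Lemma telescope_sq (u : nat -> R) (N k : nat) :
  (u (N + k)%N - u N) ^+ 2 <=
  2 * 2^-1 ^+ N * \sum_(n < k) 2 ^+ (N + n) * (u (N + n).+1 - u (N + n)%N) ^+ 2.
Proof.
elim: k N => [|k IH] N.
  by rewrite addn0 subrr expr0n big_ord0 mulr0.
have := IH N.+1; rewrite big_ord_recl /= addn0 addSnnS.
under eq_bigr do rewrite addSnnS.
set A := \sum_(_ < _) _; set x := u N.+1 - u N => h.
have -> : u (N + k.+1)%N - u N = x + (u (N + k.+1)%N - u N.+1) by rewrite /x; ring.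
move: h; set y := u (N + k.+1)%N - u N.+1; rewrite (exprS 2^-1 N) mulrA mulfV ?pnatr_eq0// mul1r.
have -> : 2 * 2^-1 ^+ N * (2 ^+ N * x ^+ 2 + A) = 2 * x ^+ 2 + 2 * (2^-1 ^+ N * A).
  have e : 2^-1 ^+ N * 2 ^+ N = 1 :> R by rewrite -exprMn mulVf ?pnatr_eq0// expr1n.
  transitivity (2 * (2^-1 ^+ N * 2 ^+ N) * x ^+ 2 + 2 * (2^-1 ^+ N * A)); first by ring.
  by rewrite e mulr1.
by have := sqr_ge0 (x - y); nra.
Qed.

(** With increments of squared norm at most 4^(-n), the weighted sum Q of their
    squares is integrable, hence finite almost everywhere; telescope_sq then
    makes the sequence pointwise Cauchy where Q is finite, and dominates its
    distance to the limit by Q. *)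
Lemma riesz_fischer (S : nat -> R -> R) : (forall n, L2 (S n)) ->
  (forall n, sqnorm (fun x => S n.+1 x - S n x) <= 4^-1 ^+ n) ->
  exists p, L2 p /\ exists K, forall N, sqnorm (fun x => S N x - p x) <= K * 2^-1 ^+ N.
Proof.
move=> LS hS.
pose D n x : R := 2 ^+ n * (S n.+1 x - S n x) ^+ 2.
have D0 n x : 0 <= D n x by rewrite mulr_ge0 ?sqr_ge0 ?exprn_ge0.
have sD_ n : summable_fun mu (D n).
  have := summableZ (2 ^+ n) (L2_sqr_summable (L2B (LS n.+1) (LS n))).
  by congr (integrable _ _ _); apply/funext => x /=; rewrite -expr2.
have mD n : measurable_fun setT (EFin \o D n) by exact: measurable_int (sD_ n).
(* Finiteness of Q at x is what makes S n x a Cauchy sequence. *)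
pose Q x := (\sum_(n <oo) (D n x)%:E)%E.
have Q0 x : (0 <= Q x)%E by apply: nneseries_ge0 => n _ _; rewrite lee_fin.
have mQ : measurable_fun setT Q.
  by apply: ge0_emeasurable_sum; [move=> n x _ _; rewrite lee_fin|move=> n _; exact: mD].
have iQ : (\int[mu]_x Q x < +oo)%E.
  rewrite integral_nneseries//; last by move=> n x _; rewrite lee_fin.
  have le1 n : (\int[mu]_x (D n x)%:E <= (2^-1 ^+ n)%:E)%E.
    rewrite Rint_EFin// lee_fin /D RintZ; last first.
      have := L2_sqr_summable (L2B (LS n.+1) (LS n)).
      by congr (integrable _ _ _); apply/funext => x /=; rewrite -expr2.
    have := hS n; rewrite /sqnorm /inner2 /leb.
    under eq_Rintegral do rewrite -expr2.
    move=> h; rewrite (le_trans (ler_wpM2l _ h)) ?exprn_ge0//.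
    rewrite -exprMn (_ : 2 * 4^-1 = 2^-1 :> R)//; by field.
  apply: (@le_lt_trans _ _ (\sum_(n <oo) (2^-1 ^+ n)%:E)%E).
    apply: lee_nneseries => [n _|n _]; last exact: le1.
    by move=> *; apply: integral_ge0 => x _; rewrite lee_fin.
  apply: (@le_lt_trans _ _ 2%:E); last by rewrite ltry.
  apply: lime_le; first by apply: is_cvg_nneseries => n _ _; rewrite lee_fin exprn_ge0.
  apply: nearW => n; rewrite sumEFin lee_fin big_mkord.
  have -> : \sum_(i < n) 2^-1 ^+ i = 2 - 2 * 2^-1 ^+ n :> R.
    elim: n => [|n IH]; first by rewrite big_ord0 expr0 mulr1 subrr.
    by rewrite big_ord_recr /= IH exprS; field.
  by rewrite lerBlDr lerDl mulr_ge0 ?exprn_ge0.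
have sQ : mu.-integrable setT Q.
  apply/integrableP; split => //.
  by under eq_integral do rewrite gee0_abs//.
pose A := [set x | (Q x < +oo)%E].
have mA : measurable A.
  rewrite (_ : A = setT `&` [set x | (Q x < (fun=> +oo) x)%E]); last by rewrite setTI.
  by apply: measurable_lte.
have aeA : {ae mu, forall x, A x}.
  have := integrable_ae measurableT sQ; apply: filterS => x /= /(_ I).
  by rewrite ge0_fin_numE.
pose q x := fine (Q x).
have mq : measurable_fun setT q.
  exact: measurableT_comp (fine_measurable measurableT) mQ.
have sq : summable_fun mu q.
  apply/integrableP; split; first exact/measurable_EFinP.
  apply: le_lt_trans iQ; apply: ge0_le_integral => //.
  - by apply: measurableT_comp => //; apply/measurable_EFinP.
  - move=> x _; rewrite /q /= ger0_norm ?fine_ge0//.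
    by case: (Q x) (Q0 x) => //= _; rewrite leey.
have Sq x N k : A x -> (S (N + k)%N x - S N x) ^+ 2 <= 2 * 2^-1 ^+ N * q x.
  move=> Ax; apply: (le_trans (telescope_sq (fun n => S n x) N k)).
  apply: ler_wpM2l; first by rewrite mulr_ge0 ?exprn_ge0.
  rewrite -lee_fin fineK ?ge0_fin_numE// -sumEFin.
  apply: (@le_trans _ _ (\sum_(0 <= n < N + k) (D n x)%:E)%E); last first.
    by apply: nneseries_lim_ge => n _ _; rewrite lee_fin.
  rewrite [in leRHS](big_cat_nat (n := N))//= ?leq_addr// addrC.
  have -> : (\sum_(N <= n < N + k) (D n x)%:E = \sum_(n < k) (D (N + n)%N x)%:E)%E.
    rewrite -{1}[N]add0n big_addn addKn big_mkord.
    by apply: eq_bigr => i _; rewrite addnC.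
  by rewrite leeDl// sume_ge0// => n _; rewrite lee_fin.
(* Cut off outside A, so that the limit exists everywhere and is measurable. *)
pose S' n x := S n x * \1_A x.
have cvgS x : cvgn (S' ^~ x).
  rewrite /S' indicE; have [/set_mem Ax|Ax] := boolP (x \in A); last first.
    by under eq_fun do rewrite mulr0; exact: is_cvg_cst.
  under eq_fun do rewrite mulr1.
  apply: cauchy_cvg; apply: cauchy_exP => e e0.
  have c0 : (fun N : nat => 2 * 2^-1 ^+ N * q x) @ \oo --> (0 : R).
    rewrite -[X in _ --> X](mul0r (q x)); apply: cvgMl.
    rewrite -[X in _ --> X](mulr0 2); apply: cvgMr.
    by apply: cvg_expr; rewrite gtr0_norm ?invr_gt0// invf_lt1// ltr1n.
  have e2 : 0 < (e / 2) ^+ 2 by rewrite exprn_gt0// divr_gt0.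
  have /cvgr_lt/(_ _ e2) [N _ /(_ N (leqnn N)) hN] := c0.
  have hd n : (N <= n)%N -> `|S n x - S N x| < e / 2.
    move=> Nn; rewrite -(ltr_pXn2r (ltn0Sn 1)) ?nnegrE//; last by rewrite divr_ge0// ltW.
    by rewrite real_normK ?num_real// -(subnKC Nn) (le_lt_trans (Sq _ _ _ Ax)).
  exists (S N x); exists N => // n /= Nn.
  by rewrite /ball /= distrC (lt_le_trans (hd _ Nn))// ler_pdivrMr// ler_peMr ?ler1n// ltW.
pose p x := limn (S' ^~ x).
have mS' n : measurable_fun setT (S' n).
  by apply: measurable_funM; [exact: L2_measurable|exact: measurable_indic].
have mp : measurable_fun setT p.
  by apply: (@measurable_fun_cvg _ _ _ _ S') => // x _; exact: cvgS.
have pq N x : A x -> (S N x - p x) ^+ 2 <= 2 * 2^-1 ^+ N * q x.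
  move=> Ax.
  have cS : (fun n => S n x) @ \oo --> p x.
    have := cvgS x; rewrite /p /S' indicE (mem_set Ax).
    by under eq_fun do rewrite mulr1.
  have cc : (fun n => (S n x - S N x) ^+ 2) @ \oo --> (p x - S N x) ^+ 2.
    rewrite expr2; under eq_fun do rewrite expr2.
    by apply: cvgM; apply: cvgB => //; exact: cvg_cst.
  rewrite -sqrrN opprB -(cvg_lim (@Rhausdorff R) cc).
  apply: limr_le; first by apply/cvg_ex; eexists; exact: cc.
  by exists N => // n /= Nn; rewrite -(subnKC Nn); exact: Sq.
have sSp N : summable_fun mu (fun x => (S N x - p x) * (S N x - p x)).
  have mB : measurable_fun setT (fun x => S N x - p x) by apply: measurable_funB => //; exact: L2_measurable.
  apply: (@summable_le_ae _ _ _ mu _ _ _ (summableZ (2 * 2^-1 ^+ N) sq)); first exact: measurable_funM.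
  apply: (ae_imply aeA) => x Ax; rewrite -expr2 ger0_norm ?sqr_ge0//; exact: pq.
have LB N : L2 (fun x => S N x - p x).
  by apply/L2P; split => //; apply: measurable_funB => //; exact: L2_measurable.
exists p; split.
  have := L2B (LS 0%N) (LB 0%N).
  by under eq_fun do rewrite opprB addrC subrK.
exists (2 * \int[mu]_x q x) => N.
rewrite -mulrA [_ * 2^-1 ^+ N]mulrC mulrA -RintZ// /sqnorm /inner2.
have sqq := summableZ (2 * 2^-1 ^+ N) sq.
rewrite -lee_fin -!Rint_EFin//.
apply: ae_ge0_le_integral => //.
- by move=> x _; rewrite lee_fin -expr2 sqr_ge0.
- exact: measurable_int (sSp N).
- by move=> x _; rewrite lee_fin mulr_ge0 ?fine_ge0// mulr_ge0 ?exprn_ge0.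
- exact: measurable_int sqq.
- apply: (ae_imply aeA) => x Ax _; rewrite lee_fin -expr2; exact: pq.
Qed.

End RieszFischer.

(** * Orthonormal families and orthogonal projections *)

Section Orthonormal.
Context {R : realType} {I : eqType}.
Notation mu := (@lebesgue_measure R).
Implicit Types (f g h : R -> R) (e : I -> R -> R) (s : seq I).

Definition orthonormal e := (forall i, L2 (e i)) /\
  forall i j, inner2 (e i) (e j) = (i == j)%:R.

(** Finite linear combinations are lists of coefficient-index pairs, in which an
    index may be repeated: concatenating lists then adds combinations. *)
Definition lin_comb e (cs : seq (R * I)) (x : R) : R := \sum_(p <- cs) p.1 * e p.2 x.

Definition proj e h s := lin_comb e [seq (inner2 h (e i), i) | i <- s].

Definition spanned e h := forall eps : R, 0 < eps ->
  exists cs, sqnorm (fun x => h x - lin_comb e cs x) < eps.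

Lemma lcombL2 e cs : (forall i, L2 (e i)) -> L2 (lin_comb e cs).
Proof. by move=> Le; apply: L2sum => p; exact: L2Z. Qed.

Lemma inner_lcomb e h cs : (forall i, L2 (e i)) -> L2 h ->
  inner2 h (lin_comb e cs) = \sum_(p <- cs) p.1 * inner2 h (e p.2).
Proof.
move=> Le Lh; rewrite /lin_comb inner_sumr//; last by move=> p; exact: L2Z.
by apply: eq_bigr => p _; rewrite innerZr.
Qed.

Lemma projL2 e h s : (forall i, L2 (e i)) -> L2 (proj e h s).
Proof. exact: lcombL2. Qed.

Lemma inner_proj e h g s : (forall i, L2 (e i)) -> L2 g ->
  inner2 g (proj e h s) = \sum_(i <- s) inner2 h (e i) * inner2 g (e i).
Proof. by move=> Le Lg; rewrite /proj inner_lcomb// big_map. Qed.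

Lemma inner_proj_basis e h s i : orthonormal e -> L2 h -> uniq s -> i \in s ->
  inner2 (proj e h s) (e i) = inner2 h (e i).
Proof.
move=> [Le oe] Lh us si; rewrite innerC inner_proj//.
rewrite (bigD1_seq i)//= oe eqxx mulr1 big1 ?addr0// => j ji.
by rewrite oe eq_sym (negbTE ji) mulr0.
Qed.

Lemma resid_orth e h s cs : orthonormal e -> L2 h -> uniq s ->
  {subset [seq p.2 | p <- cs] <= s} ->
  inner2 (fun x => h x - proj e h s x) (lin_comb e cs) = 0.
Proof.
move=> oe Lh us sub; have [Le _] := oe; have Lp := projL2 h s Le.
rewrite inner_lcomb//; last exact: L2B.
apply: big1_seq => p /= pcs; rewrite innerBl// inner_proj_basis ?subrr ?mulr0//.
by apply: sub; apply: map_f.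
Qed.

Lemma sqn_pyth f g : L2 f -> L2 g -> inner2 f g = 0 ->
  sqnorm (fun x => f x + g x) = sqnorm f + sqnorm g.
Proof.
move=> Lf Lg fg; have Lfg := L2D Lf Lg.
by rewrite /sqnorm innerDl// !innerDr// (innerC g f) fg; ring.
Qed.

(** The residual of the projection is orthogonal to every combination of the
    e_i, i in s, so Pythagoras applies. *)
Lemma best_approx e h s cs : orthonormal e -> L2 h -> uniq s ->
  {subset [seq p.2 | p <- cs] <= s} ->
  sqnorm (fun x => h x - proj e h s x) <= sqnorm (fun x => h x - lin_comb e cs x).
Proof.
move=> oe Lh us sub; have [Le _] := oe.
have Lp := projL2 h s Le; have Lc := lcombL2 cs Le.
pose g x := proj e h s x - lin_comb e cs x.
have Lg : L2 g by exact: L2B.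
rewrite (_ : (fun x => h x - lin_comb e cs x) =
    (fun x => (h x - proj e h s x) + g x)); last first.
  by apply/funext => x; rewrite /g; ring.
have LhP := L2B Lh Lp.
have og : inner2 (fun x => h x - proj e h s x) g = 0.
  rewrite /g innerBr// !resid_orth ?subrr// => i.
  by rewrite -map_comp => /mapP[j js ->].
by rewrite (sqn_pyth LhP Lg og) lerDl sqn_ge0.
Qed.

Lemma sqn_resid e h s : orthonormal e -> L2 h -> uniq s ->
  sqnorm (fun x => h x - proj e h s x) = sqnorm h - \sum_(i <- s) inner2 h (e i) ^+ 2.
Proof.
move=> oe Lh us; have [Le _] := oe; have Lp := projL2 h s Le.
have LhP := L2B Lh Lp; rewrite {1}/sqnorm (innerBr LhP Lh Lp).
rewrite resid_orth//; last by move=> i; rewrite -map_comp => /mapP[j js ->].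
rewrite subr0 (innerBl Lh Lp Lh) [inner2 (proj _ _ _) _]innerC inner_proj//.
Qed.

Lemma bessel e h s : orthonormal e -> L2 h -> uniq s ->
  \sum_(i <- s) inner2 h (e i) ^+ 2 <= sqnorm h.
Proof.
by move=> oe Lh us; rewrite -subr_ge0 -sqn_resid// sqn_ge0.
Qed.

(** Density in the wavelet definitions gives some finite combination;
    best_approx replaces it by the canonical expansion along any sufficiently
    large finite box of indices. *)
Lemma box_approx e h (box : nat -> seq I) : orthonormal e -> L2 h ->
  spanned e h -> (forall N, uniq (box N)) ->
  (forall i, exists N0, forall N, (N0 <= N)%N -> i \in box N) ->
  forall eps, 0 < eps -> exists N0, forall N, (N0 <= N)%N ->
    sqnorm (fun x => h x - proj e h (box N) x) < eps.
Proof.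
move=> oe Lh sph ub eb eps e0; have [cs hcs] := sph _ e0.
have [N0 hN0] : exists N0, forall N, (N0 <= N)%N ->
    {subset [seq p.2 | p <- cs] <= box N}.
  elim: {hcs} cs => [|p cs [N0 IH]]; first by exists 0%N.
  have [N1 h1] := eb p.2; exists (maxn N0 N1) => N.
  rewrite geq_max => /andP[n0 n1] i /=; rewrite inE => /orP[/eqP ->|]; first exact: h1.
  exact: IH.
exists N0 => N /hN0 sub; apply: le_lt_trans hcs; exact: best_approx.
Qed.

End Orthonormal.

Section Boxes.

Definition ints (N : nat) : seq int := [seq i%:Z - N%:Z | i <- iota 0 N.*2.+1].

Lemma mem_ints N k : (k \in ints N) = (absz k <= N)%N.
Proof.
apply/mapP/idP => [ [i + ->] | kN]; first by rewrite mem_iota; lia.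
exists (absz (k + N%:Z)); last by lia.
by rewrite mem_iota; lia.
Qed.

Lemma uniq_ints N : uniq (ints N).
Proof. by rewrite map_inj_uniq ?iota_uniq// => i j; lia. Qed.

(** Finite boxes exhausting the indices of a wavelet family: inl k is the k-th
    translate of the scaling function, inr (l, k) the wavelet of level l and
    position k. *)
Definition boxes (N : nat) : seq (int + nat * int) :=
  [seq inl k | k <- ints N] ++ [seq inr (l, k) | l <- iota 0 N, k <- ints N].

Lemma mem_boxes_inr N l k : (inr (l, k) \in boxes N) = (l < N)%N && (absz k <= N)%N.
Proof.
rewrite mem_cat (_ : (_ \in map _ _) = false) ?orFb; last by apply/negP => /mapP[].
apply/allpairsP/andP => [[[l' k'] [ll kk [-> ->]]]|[ll kk]].
  by split; [move: ll; rewrite mem_iota|move: kk; rewrite mem_ints].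
by exists (l, k); rewrite /= mem_ints mem_iota.
Qed.

Lemma mem_boxes_inl N k : (inl k \in boxes N) = (absz k <= N)%N.
Proof.
rewrite mem_cat -mem_ints [X in _ || X](_ : _ = false) ?orbF.
  by rewrite mem_map// => ? ? [->].
by apply/negP => /allpairsP[[a b] [_ _]].
Qed.

Lemma uniq_boxes N : uniq (boxes N).
Proof.
rewrite cat_uniq map_inj_uniq; last by move=> ? ? [->].
rewrite uniq_ints andTb; apply/andP; split.
  by apply/hasPn => x /allpairsPdep[l [k [_ _ ->]]]; apply/negP => /mapP[].
apply: allpairs_uniq; rewrite ?iota_uniq ?uniq_ints//.
by move=> [? ?] [? ?] /= _ _ [-> ->].
Qed.

Lemma boxes_exhaust i : exists N0, forall N, (N0 <= N)%N -> i \in boxes N.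
Proof.
case: i => [k|[l k]].
  by exists (absz k) => N; rewrite mem_boxes_inl.
by exists (maxn l.+1 (absz k)) => N; rewrite geq_max mem_boxes_inr.
Qed.

End Boxes.
Arguments ints : simpl never.
Arguments boxes : simpl never.

Section Projection.
Context {R : realType}.
Notation mu := (@lebesgue_measure R).
Implicit Types (f g h : R -> R) (V : set (R -> R)) (e : int -> R -> R).

Lemma basis_orthonormal e V : closed_subspace2 V -> orthonormal_basis e V ->
  orthonormal e.
Proof. by move=> [VL _ _ _] [Ve oe _]; split => // i; exact/VL. Qed.

Lemma subspace_lcomb e V cs : closed_subspace2 V -> (forall k, V (e k)) ->
  V (lin_comb e cs).
Proof.
move=> [_ V0 VD _] Ve; rewrite /lin_comb; elim: cs => [|q cs IH].
  by rewrite (_ : (fun x => _) = cst 0)//; apply/funext => x; rewrite big_nil.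
rewrite (_ : (fun x => _) = (fun x => q.1 * e q.2 x + \sum_(p <- cs) p.1 * e p.2 x)).
  exact: VD.
by apply/funext => x; rewrite big_cons.
Qed.

Lemma subspaceB V f g : closed_subspace2 V -> V f -> V g -> V (fun x => f x - g x).
Proof.
move=> [_ V0 VD _] Vf Vg.
rewrite (_ : (fun x => _) = (fun x => -1 * g x + f x)); first exact: VD.
by apply/funext => x; ring.
Qed.

Lemma subspaceZ V c f : closed_subspace2 V -> V f -> V (fun x => c * f x).
Proof.
move=> [_ V0 VD _] Vf.
rewrite (_ : (fun x => _) = (fun x => c * f x + cst 0 x)); first exact: VD.
by apply/funext => x; rewrite /cst addr0.
Qed.

Lemma basis_spanned e V h : closed_subspace2 V -> orthonormal_basis e V ->
  V h -> spanned e h.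
Proof.
move=> cV bV Vh eps e0; have [VL _ _ _] := cV; have [Ve _ dV] := bV.
have se : 0 < Num.sqrt eps by rewrite sqrtr_gt0.
have [ks [c]] := dV h Vh _ se; exists [seq (c k, k) | k <- ks].
rewrite (_ : (fun x => _) =
    (fun x => h x - (\sum_(k <- ks) c k * e k x))); last first.
  by apply/funext => x; rewrite /lin_comb big_map.
rewrite -[eps]sqr_sqrtr ?(ltW e0)//; apply/dist2_lt => //; first exact: VL.
by apply: L2sum => k; apply: L2Z; exact: VL.
Qed.

Lemma sqn_resid_sub e h s t : orthonormal e -> L2 h -> uniq s -> uniq t ->
  {subset s <= t} ->
  sqnorm (fun x => proj e h t x - proj e h s x) =
  sqnorm (fun x => h x - proj e h s x) - sqnorm (fun x => h x - proj e h t x).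
Proof.
move=> oe Lh us ut st; have [Le _] := oe.
have Ls := projL2 h s Le; have Lt := projL2 h t Le.
rewrite [X in _ = sqnorm X - _](_ : _ =
    (fun x => (h x - proj e h t x) + (proj e h t x - proj e h s x))); last first.
  by apply/funext => x; ring.
have Lht := L2B Lh Lt; have Lts := L2B Lt Ls.
have og : inner2 (fun x => h x - proj e h t x)
    (fun x => proj e h t x - proj e h s x) = 0.
  rewrite (innerBr Lht Lt Ls) !resid_orth ?subrr// => i; rewrite -map_comp => /mapP[j js ->] //.
  exact: st.
by rewrite (sqn_pyth Lht Lts og) [X in _ = X - _]addrC addrK.
Qed.

(** The squared residuals of the expansions along growing integer windows
    decrease to their infimum r0. A subsequence along which they approach r0 at
    rate 4^(-m) satisfies the hypotheses of riesz_fischer, and its limit stays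
    in the closed subspace. *)
Lemma orth_projection e V h : closed_subspace2 V -> orthonormal_basis e V ->
  L2 h -> exists p, V p /\ forall f, V f -> inner2 f (fun x => h x - p x) = 0.
Proof.
move=> cV bV Lh; have oe := basis_orthonormal cV bV.
have [VL _ _ cl] := cV; have [Ve _ _] := bV; have [Le _] := oe.
pose rho N := sqnorm (fun x => h x - proj e h (ints N) x).
have LP N : L2 (proj e h (ints N)) by exact: projL2.
have sub m n : (m <= n)%N -> {subset ints m <= ints n}.
  by move=> mn k; rewrite !mem_ints => /leq_trans; exact.
have diff m n : (m <= n)%N ->
    sqnorm (fun x => proj e h (ints n) x - proj e h (ints m) x) = rho m - rho n.
  by move=> mn; rewrite sqn_resid_sub ?uniq_ints//; exact: sub.
have rhodec m n : (m <= n)%N -> rho n <= rho m.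
  by move=> mn; rewrite -subr_ge0 -diff// sqn_ge0.
pose r0 := inf (range rho).
have hasr : has_inf (range rho).
  by split; [exists (rho 0%N), 0%N|exists 0 => _ [n _ <-]; exact: sqn_ge0].
have r0le n : r0 <= rho n by apply: ge_inf; [case: hasr|exists n].
have [nn hnn] : exists nn : nat -> nat, forall m, (m <= nn m)%N /\
    rho (nn m) <= r0 + 4^-1 ^+ m.
  have : forall m, exists n, (m <= n)%N /\ rho n <= r0 + 4^-1 ^+ m.
    move=> m; have [|_ [n _ <-] hn] := @inf_adherent _ (range rho) (4^-1 ^+ m) _ hasr.
      by rewrite exprn_gt0// invr_gt0.
    exists (maxn m n); rewrite leq_maxl; split => //.
    by rewrite (le_trans (rhodec _ _ (leq_maxr m n)))// ltW.
  by move=> /choice[nn hnn]; exists nn.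
pose S m := proj e h (ints (nn m)).
have hS m : sqnorm (fun x => S m.+1 x - S m x) <= 4^-1 ^+ m.
  have [_ hm] := hnn m; have [_ hm1] := hnn m.+1.
  have hm2 : rho (nn m.+1) <= r0 + 4^-1 ^+ m.
    rewrite (le_trans hm1)// lerD2l exprS ler_piMl ?exprn_ge0// invf_le1// ler1n//.
  have [le|/ltnW le] := leqP (nn m) (nn m.+1).
    by rewrite diff// lerBlDr (le_trans hm)// addrC lerD2l.
  have -> : sqnorm (fun x => S m.+1 x - S m x) = sqnorm (fun x => S m x - S m.+1 x).
    by rewrite /sqnorm /inner2; apply: eq_Rintegral => x _; ring.
  by rewrite diff// lerBlDr (le_trans hm2)// addrC lerD2l.
have [p [Lp [K hK]]] := riesz_fischer (fun m => LP (nn m)) hS.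
have K2 eps : 0 < eps -> exists N0, forall N, (N0 <= N)%N -> K * 2^-1 ^+ N < eps.
  move=> e0; have : (fun N : nat => K * 2^-1 ^+ N) @ \oo --> (0 : R).
    rewrite -[X in _ --> X](mulr0 K); apply: cvgMr.
    by apply: cvg_expr; rewrite gtr0_norm ?invr_gt0// invf_lt1// ltr1n.
  by move=> /cvgr_lt/(_ _ e0) [N0 _ hN]; exists N0 => N; exact: hN.
have Vp : V p.
  apply: cl => // eps e0; have e2 : 0 < eps ^+ 2 by rewrite exprn_gt0.
  have [N0 hN] := K2 _ e2; exists (S N0).
    by apply: subspace_lcomb.
  apply/dist2_lt => //; first exact: LP.
  have -> : sqnorm (fun x => p x - S N0 x) = sqnorm (fun x => S N0 x - p x).
    by rewrite /sqnorm /inner2; apply: eq_Rintegral => x _; ring.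
  exact: le_lt_trans (hK _) (hN _ _).
(* So h - p is orthogonal to each e i, hence to V, in which the e i span. *)
have pe i : inner2 p (e i) = inner2 h (e i).
  apply/eqP; rewrite -subr_eq0 -sqrf_eq0 eq_le sqr_ge0 andbT.
  apply/ler_addgt0Pl => eps e0; rewrite addr0.
  have [N0 hN] := K2 _ e0; pose N := maxn N0 (absz i).
  have -> : inner2 h (e i) = inner2 (S N) (e i).
    rewrite inner_proj_basis ?uniq_ints// mem_ints.
    by have [h1 _] := hnn N; rewrite (leq_trans _ h1)// leq_maxr.
  rewrite -innerBl//; last exact: LP.
  have LB : L2 (fun x => p x - S N x) by apply: L2B => //; exact: LP.
  rewrite (le_trans (cauchy_schwarz LB (Le i)))//.
  have [_ oi] := oe; rewrite [sqnorm (e i)]oi eqxx mulr1.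
  have -> : sqnorm (fun x => p x - S N x) = sqnorm (fun x => S N x - p x).
    by rewrite /sqnorm /inner2; apply: eq_Rintegral => x _; ring.
  by rewrite (le_trans (hK _))// ltW// hN// leq_maxl.
exists p; split => // f Vf; have Lf := VL _ Vf; have Lhp := L2B Lh Lp.
apply/eqP; rewrite -sqrf_eq0 eq_le sqr_ge0 andbT.
apply/ler_addgt0Pl => eps e0; rewrite addr0.
have s1 : 0 < sqnorm (fun x => h x - p x) + 1 by rewrite ltr_wpDl ?sqn_ge0.
have [cs hcs] := basis_spanned cV bV Vf (divr_gt0 e0 s1).
have Lc := lcombL2 cs Le.
have -> : inner2 f (fun x => h x - p x) =
    inner2 (fun x => f x - lin_comb e cs x) (fun x => h x - p x).
  rewrite innerBl// [inner2 (lin_comb _ _) _]innerC inner_lcomb//.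
  by rewrite big1 ?subr0// => q _; rewrite innerBl// pe subrr mulr0.
rewrite (le_trans (cauchy_schwarz (L2B Lf Lc) Lhp))//.
rewrite -(divfK (lt0r_neq0 s1) eps) ler_pM ?sqn_ge0 ?ltW//.
by rewrite ltrDl.
Qed.

End Projection.

(** * The orthonormal basis generated by a wavelet pair *)

Section WaveletFamily.
Context {R : realType}.
Notation mu := (@lebesgue_measure R).
Implicit Types (f g h phi psi : R -> R) (r : R).

Definition wavelet_family phi psi (i : int + nat * int) (x : R) : R :=
  match i with
  | inl k => phi (x - k%:~R)
  | inr (l, k) => 2 `^ (l%:R / 2) * psi (2 ^+ l * x - k%:~R)
  end.

(** Dilation by a positive real r, not only by powers of two: the resolution 2^j
    of the estimator has a real exponent. *)
Definition dilated_family r phi psi i (x : R) : R := Num.sqrt r * wavelet_family phi psi i (r * x).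

Lemma pow2_gt0 l : 0 < 2 ^+ l :> R.
Proof. by rewrite exprn_gt0. Qed.

Lemma powR_half l : (2 `^ (l%:R / 2)) ^+ 2 = 2 ^+ l :> R.
Proof.
by rewrite -powR_mulrn ?powR_ge0// -powRrM divfK ?pnatr_eq0// powR_mulrn.
Qed.

Lemma L2_dil r f : 0 < r -> L2 f -> L2 (fun x => f (r * x)).
Proof. by move=> r0 /(L2_affine 0 r0); under eq_fun do rewrite addr0. Qed.

Lemma inner_dil r f g : 0 < r -> L2 f -> L2 g ->
  inner2 (fun x => f (r * x)) (fun x => g (r * x)) = r^-1 * inner2 f g.
Proof.
move=> r0 Lf Lg; rewrite -(inner_affine 0 r0 Lf Lg) /inner2.
by under [in RHS]eq_Rintegral do rewrite addr0.
Qed.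

Lemma sqn_dil r f : 0 < r -> L2 f -> sqnorm (fun x => f (r * x)) = r^-1 * sqnorm f.
Proof. by move=> r0 Lf; rewrite /sqnorm inner_dil. Qed.

Section Pair.
Variables (phi psi : R -> R) (V : int -> set (R -> R)).
Hypothesis mra : multiresolution V phi.
Let W := [set g | V 1 g /\ forall f, V 0 f -> inner2 f g = 0].
Hypothesis psiW : orthonormal_basis (translates psi) W.

Let cV j : closed_subspace2 (V j). Proof. by have [] := mra. Qed.
Let VS j : V j `<=` V (j + 1). Proof. by have [] := mra. Qed.
Let Vdil j f : V j f <-> V (j + 1) (fun x => f (2 * x)).
Proof. by have [] := mra. Qed.
Let phiB : orthonormal_basis (translates phi) (V 0).
Proof. by have [_ _ _ []] := mra. Qed.
Let VL j f : V j f -> L2 f. Proof. by have [+ _ _ _] := cV j; exact. Qed.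

Let VD j (n : nat) : V j `<=` V (j + n%:Z).
Proof.
elim: n => [|n IH]; first by rewrite addr0.
by move=> f /IH /VS; rewrite -addrA -PoszD addn1.
Qed.

Let Vle (m n : nat) : (m <= n)%N -> V m%:Z `<=` V n%:Z.
Proof. by move=> mn; rewrite -(subnKC mn) PoszD; exact: VD. Qed.

Let Vdiln (l : nat) j f : V j f <-> V (j + l%:Z) (fun x => f (2 ^+ l * x)).
Proof.
elim: l f => [|l IH] f.
  by rewrite addr0 (_ : (fun x => f (2 ^+ 0 * x)) = f)//; apply/funext => x; rewrite mul1r.
rewrite (IH f) (Vdil _ (fun x => f (2 ^+ l * x))) -addrA -PoszD addn1.
rewrite (_ : (fun x => f (2 ^+ l * (2 * x))) = (fun x => f (2 ^+ l.+1 * x)))//.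
by apply/funext => x; rewrite exprSr mulrA.
Qed.

Let Vundil (l : nat) j h : V (j + l%:Z) h <-> V j (fun x => h ((2 ^+ l)^-1 * x)).
Proof.
rewrite (Vdiln l j) (_ : (fun x => h ((2 ^+ l)^-1 * _)) = h)//.
by apply/funext => x; rewrite mulrA mulVf ?mul1r// gt_eqF// pow2_gt0.
Qed.

Let psik k : V 1 (translates psi k) /\ forall f, V 0 f -> inner2 f (translates psi k) = 0.
Proof. by have [+ _ _] := psiW; move=> /(_ k). Qed.

Let W_dil l k : wavelet_family phi psi (inr (l, k)) =
  (fun x => 2 `^ (l%:R / 2) * translates psi k (2 ^+ l * x)).
Proof. by []. Qed.

Let fam_V l k : V (l.+1)%:Z (wavelet_family phi psi (inr (l, k))).
Proof.
rewrite W_dil; apply: (subspaceZ _ (cV _)).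
by rewrite -add1n PoszD -Vdiln; case: (psik k).
Qed.

Let fam_orth l k f : V l%:Z f -> inner2 f (wavelet_family phi psi (inr (l, k))) = 0.
Proof.
move=> Vf; have Lf := VL Vf; have [V1 o1] := psik k; have L1 := VL V1.
have := Vf; rewrite -[l%:Z]add0r Vundil => V0.
rewrite W_dil innerZr//; last exact: L2_dil (pow2_gt0 l) L1.
have := inner_dil (pow2_gt0 l) (VL V0) L1; rewrite o1// mulr0.
rewrite (_ : (fun x => f _) = f) => [->|]; first by rewrite mulr0.
by apply/funext => x; rewrite mulrA mulVf ?mul1r// gt_eqF// pow2_gt0.
Qed.

Lemma pair_orthonormal : orthonormal (wavelet_family phi psi).
Proof.
have phi0 k : V 0 (wavelet_family phi psi (inl k)) by have [+ _ _] := phiB; exact.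
have Lw i : L2 (wavelet_family phi psi i).
  case: i => [k|[l k]]; first exact: VL (phi0 k).
  exact: VL (fam_V l k).
split => // -[k|[l k]] [k'|[l' k']].
- by have [_ o _] := phiB; rewrite [LHS]o.
- by rewrite fam_orth//; apply: (@Vle 0) => //.
- by rewrite innerC fam_orth//; apply: (@Vle 0) => //.
- have [ll|ll|<-] := ltngtP l l'.
  + rewrite fam_orth; last exact: Vle (fam_V l k).
    by rewrite (_ : _ == _ = false)//; apply/eqP => -[e]; rewrite e ltnn in ll.
  + rewrite innerC fam_orth; last exact: Vle (fam_V l' k').
    by rewrite (_ : _ == _ = false)//; apply/eqP => -[e]; rewrite e ltnn in ll.
  + have [V1 _] := psik k; have [V2 _] := psik k'.
    have L1 := L2_dil (pow2_gt0 l) (VL V1); have L2' := L2_dil (pow2_gt0 l) (VL V2).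
    rewrite !W_dil innerZl ?innerZr//; last exact: L2Z.
    rewrite (inner_dil (pow2_gt0 l) (VL V1) (VL V2)).
    have [_ o _] := psiW; rewrite o mulrA -expr2 powR_half.
    rewrite mulrA mulfV ?mul1r; last by rewrite gt_eqF// pow2_gt0.
    have [->|kk] := eqVneq k k'; first by rewrite !eqxx.
    by rewrite (_ : _ == _ = false)//; apply/eqP => -[e]; rewrite e eqxx in kk.
Qed.

Let span_level (l : nat) h : V l%:Z h -> spanned (wavelet_family phi psi) h.
Proof.
have [Lw _] := pair_orthonormal.
elim: l h => [|l IH] h Vh eps e0.
  have [cs hcs] := basis_spanned (cV 0) phiB Vh e0.
  exists [seq (p.1, inl p.2) | p <- cs].
  rewrite (_ : (fun x => _) = (fun x => h x - lin_comb (translates phi) cs x))//.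
  by apply/funext => x; rewrite /lin_comb big_map.
have Lh := VL Vh; have p2 := pow2_gt0 l.
(* g is h rescaled by 2^l, an element of V 1; p is its part in V 0. *)
have := Vh; rewrite -add1n PoszD Vundil; set g := (fun x => h _) => V1g.
have Lg := VL V1g.
have [p [V0p op]] := orth_projection (cV 0) phiB Lg.
have Lp := VL V0p; have Lgp := L2B Lg Lp.
have Wq : W (fun x => g x - p x).
  split; last exact: op.
  by have := VS V0p; rewrite add0r; exact: (subspaceB (cV 1)).
have [_ _ dW] := psiW.
have e4 : 0 < eps / 4 by rewrite divr_gt0.
have s4 : 0 < Num.sqrt (eps / 4) by rewrite sqrtr_gt0.
have [ks [c]] := dW _ Wq _ s4.
pose w x := \sum_(k <- ks) c k * translates psi k x.
have Lpsi k : L2 (translates psi k) by have [V1 _] := psik k; exact: VL V1.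
have Lw' : L2 w by apply: L2sum => k; apply: L2Z.
rewrite (dist2_lt s4 Lgp Lw') sqr_sqrtr ?(ltW e4)// => hw.
have Vpl : V l%:Z (fun x => p (2 ^+ l * x)) by rewrite -[l%:Z]add0r -Vdiln.
have [cs hcs] := IH _ Vpl _ e4.
exists (cs ++ [seq (c k / 2 `^ (l%:R / 2), inr (l, k)) | k <- ks]).
have Lcs := lcombL2 cs Lw.
pose u x := g x - p x - w x.
have Lu : L2 u by apply: L2B.
rewrite (_ : (fun x => _) = (fun x => (p (2 ^+ l * x) - lin_comb (wavelet_family phi psi) cs x) +
    u (2 ^+ l * x))); last first.
  apply/funext => x; rewrite /lin_comb big_cat big_map /= /u /w /g /translates.
  rewrite mulrA mulVf ?gt_eqF// mul1r.
  under [X in _ - (_ + X)]eq_bigr => k _.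
    rewrite mulrA divfK; last by rewrite gt_eqF// powR_gt0.
    over.
  by rewrite /=; ring.
have Lpl := L2_dil p2 Lp; have Lul := L2_dil p2 Lu.
apply: (le_lt_trans (sqnD_le (L2B Lpl Lcs) Lul)).
rewrite (sqn_dil p2 Lu).
have : (2 ^+ l)^-1 * sqnorm u < eps / 4.
  by rewrite (le_lt_trans _ hw)// ler_piMl ?sqn_ge0// invf_le1// exprn_ege1// ler1n.
by move: hcs; set A := sqnorm _; set B := _ * sqnorm u => hA hB; lra.
Qed.

(** V 0 is spanned by the translates of phi. Passing from V l to V (l+1)
    amounts, after rescaling to V 0 and V 1, to splitting off the orthogonal
    projection on V 0; the remainder lies in the wavelet space. The union of the
    V l is dense. *)
Lemma pair_spanned h : L2 h -> spanned (wavelet_family phi psi) h.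
Proof.
move=> Lh eps e0; have [_ _ _ [_ dV _]] := mra.
have [Lw _] := pair_orthonormal.
have e4 : 0 < eps / 4 by rewrite divr_gt0.
have s4 : 0 < Num.sqrt (eps / 4) by rewrite sqrtr_gt0.
have [j [f Vf]] := dV _ Lh _ s4; have Lf := VL Vf.
rewrite (dist2_lt s4 Lh Lf) sqr_sqrtr ?(ltW e4)// => hf.
have Vf' : V (absz j)%:Z f.
  have -> : (absz j)%:Z = j + (absz ((absz j)%:Z - j))%:Z by lia.
  exact: VD.
have [cs hcs] := span_level Vf' e4; exists cs.
apply: (le_lt_trans (sqn_tri Lh Lf (lcombL2 cs Lw))).
by move: hf hcs; set A := sqnorm _; set B := sqnorm _ => hA hB; lra.
Qed.

End Pair.

Lemma dilated_family_orthonormal r phi psi : 0 < r -> scaling_wavelet_pair phi psi ->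
  orthonormal (dilated_family r phi psi).
Proof.
move=> r0 [V [mra psiW]]; have [Lw ow] := pair_orthonormal mra psiW.
split => [i|i j]; first by apply: L2Z; exact: L2_dil.
have Li := L2_dil r0 (Lw i); have Lj := L2_dil r0 (Lw j).
rewrite /dilated_family innerZl ?innerZr//; last exact: L2Z.
rewrite inner_dil// ow mulrA -expr2 sqr_sqrtr ?(ltW r0)//.
by rewrite mulrA mulfV ?mul1r//; rewrite gt_eqF.
Qed.

(** Dilation multiplies all squared norms by the same constant. *)
Lemma dilated_family_spanned r phi psi h : 0 < r -> scaling_wavelet_pair phi psi ->
  L2 h -> spanned (dilated_family r phi psi) h.
Proof.
move=> r0 [V [mra psiW]] Lh eps e0; have [Lw ow] := pair_orthonormal mra psiW.
have ri : 0 < r^-1 by rewrite invr_gt0.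
have [cs hcs] := pair_spanned mra psiW (L2_dil ri Lh) (mulr_gt0 r0 e0).
exists [seq (p.1 / Num.sqrt r, p.2) | p <- cs].
pose u x := h (r^-1 * x) - lin_comb (wavelet_family phi psi) cs x.
have Lu : L2 u by apply: L2B; [exact: L2_dil|exact: lcombL2].
rewrite (_ : (fun x => _) = (fun x => u (r * x))); last first.
  apply/funext => x; rewrite /lin_comb big_map /u mulrA mulVf ?gt_eqF// mul1r.
  congr (_ - _); apply: eq_bigr => p _; rewrite /dilated_family /= mulrA divfK//.
  by rewrite gt_eqF// sqrtr_gt0.
by rewrite sqn_dil// mulrC ltr_pdivrMr// mulrC.
Qed.

End WaveletFamily.

(** * Fourier transform of the two-sided exponential *)

Section LebesgueTools.
Context {R : realType}.
Notation mu := (@lebesgue_measure R).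
Implicit Types (f g h : R -> R) (r a b c : R).

Lemma ae_neq a : {ae mu, forall x, x != a}.
Proof.
exists [set a]; split; [exact: measurable_set1|exact: lebesgue_measure_set1|].
by move=> x /= /negP; rewrite negbK => /eqP ->.
Qed.

Lemma summable_indic a b : summable_fun mu (\1_(`[a, b]%classic : set R)).
Proof.
exact: (@integrable_indic_itv R a b true false).
Qed.

Lemma measurable_cont f : continuous f -> measurable_fun setT f.
Proof. exact: continuous_measurable_fun. Qed.

Lemma Rint_indic (D : set R) f :
  \int[mu]_x (\1_D x * f x) = \int[mu]_(x in D) f x.
Proof.
rewrite [RHS]Rintegral_mkcond; apply: eq_Rintegral => x _.
by rewrite patchE indicE; case: ifP; rewrite ?mul1r ?mul0r.
Qed.

Lemma summable_indic_mul a b c f : measurable_fun setT f ->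
  (forall x, a <= x <= b -> `|f x| <= c) ->
  summable_fun mu (fun x => \1_(`[a, b]%classic : set R) x * f x).
Proof.
move=> mf fc; apply: (summable_le _ (summableZ `|c| (summable_indic a b))).
  by apply: measurable_funM => //; exact: measurable_indic.
move=> x; rewrite normrM mulrC indicE.
have [|_] := boolP (x \in _); last by rewrite normr0 !mulr0.
rewrite inE /= in_itv /= normr1 !mulr1 => /fc h.
by rewrite (le_trans h)// ler_norm.
Qed.

Lemma ftc_indic F f a b : a <= b -> (forall x, is_derive x (1 : R) F (f x)) ->
  continuous f -> \int[mu]_x (\1_(`[a, b]%classic : set R) x * f x) = F b - F a.
Proof.
rewrite le_eqVlt => /predU1P[->|ab] dF cf.
  by rewrite Rint_indic set_itv1 Rintegral_set1 subrr.
rewrite Rint_indic /Rintegral (@continuous_FTC2 _ f F)//.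
- exact: continuous_subspaceT.
- have cF x : {for x, continuous F}.
    by apply: differentiable_continuous; apply/derivable1_diffP; apply: ex_derive.
  split; first by move=> x _; apply: ex_derive.
    exact: (cvg_at_right_filter (cF a)).
  exact: (cvg_at_left_filter (cF b)).
- by move=> x _; rewrite derive1E derive_val.
Qed.

Lemma ge0_integral_reflect (f : R -> \bar R) : measurable_fun setT f ->
  (forall x, 0 <= f x)%E -> (\int[mu]_x f (- x)%R = \int[mu]_x f x)%E.
Proof.
move=> mf f0; pose N := -%R : measurableTypeR R -> measurableTypeR R.
have mN : measurable_fun setT N by exact: oppr_measurable.
have := @ge0_integral_pushforward _ _ _ _ R N mN mu setT f measurableT mf
  (fun x _ => f0 x).
rewrite preimage_setT => <-.
by apply: eq_measure_integral => A mA _; exact: lebesgue_measureN.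
Qed.

Lemma summable_reflect f : summable_fun mu f -> summable_fun mu (fun x => f (- x)).
Proof.
move=> sf; have mf := summable_measurable sf; apply/integrableP; split.
  apply/measurable_EFinP; apply: (measurableT_comp mf); exact: oppr_measurable.
have /integrableP[_] := sf.
rewrite -(ge0_integral_reflect (f := fun x => `|(f x)%:E|%E))//.
by apply: measurableT_comp => //; exact/measurable_EFinP.
Qed.

Lemma Rint_reflect f : summable_fun mu f -> \int[mu]_x f (- x) = \int[mu]_x f x.
Proof.
move=> sf; have mf := summable_measurable sf; have sN := summable_reflect sf.
pose N := -%R : measurableTypeR R -> measurableTypeR R.
have mN : measurable_fun setT N by exact: oppr_measurable.
have := @integral_pushforward _ _ _ _ R N mN mu setT (EFin \o f) _ sN measurableT.
rewrite preimage_setT /Rintegral => <-; last exact/measurable_EFinP.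
congr fine; apply: eq_measure_integral => A mA _; exact: lebesgue_measureN.
Qed.

Lemma summable_cauchy : summable_fun mu (fun x => (1 + x ^+ 2)^-1).
Proof.
have c1 : continuous (fun x : R => (1 + x ^+ 2)^-1).
  exact: (@continuous_oneDsqrV R).
apply: summable_ge0; first exact: measurable_cont.
  by move=> x; rewrite invr_ge0 addr_ge0 ?sqr_ge0.
rewrite ge0_symfun_integralT//; last first.
- by move=> x /=; rewrite sqrrN.
- by move=> x; rewrite invr_ge0 addr_ge0 ?sqr_ge0.
have -> : [set x : R | 0 <= x] = `[0, +oo[%classic.
  by apply/seteqP; split => x /=; rewrite in_itv /= andbT.
by rewrite [X in (_ * X)%E]integral0y_oneDsqr -EFinM ltry.
Qed.

Lemma summable_exp_abs e : 0 < e -> summable_fun mu (fun t => expR (- (e * `|t|))).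
Proof.
move=> e0; have ce : continuous (fun t : R => expR (- (e * `|t|))).
  move=> t; apply: continuous_comp; last exact: continuous_expR.
  apply: cvgN; apply: cvgM; first exact: cvg_cst.
  exact: norm_continuous.
apply: (summable_le _ (summableZ (1 + 4 / e ^+ 2) summable_cauchy)); first exact: measurable_cont.
move=> t; rewrite ger0_norm ?expR_ge0// expRN.
have e2 : 0 < e ^+ 2 by rewrite exprn_gt0.
have c0 : 0 < 1 + 4 / e ^+ 2 by rewrite addr_gt0// divr_gt0.
have t0 : 0 < 1 + t ^+ 2 by rewrite ltr_pwDl ?sqr_ge0.
rewrite ler_pdivlMr// mulrC ler_pdivrMr ?expR_gt0// mulrC.
set u := e * `|t|; have u0 : 0 <= u by rewrite mulr_ge0// ltW.
have h1 : 1 + u ^+ 2 / 4 <= expR u.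
  have -> : expR u = expR (u / 2) ^+ 2 by rewrite -expRM_natl; congr expR; field.
  have := expR_ge1Dx (u / 2) => h.
  apply: (@le_trans _ _ ((1 + u / 2) ^+ 2)).
    by rewrite -subr_ge0; set X := (X in 0 <= X); have -> : X = u by rewrite /X; field.
  by rewrite ler_sqr ?nnegrE ?expR_ge0// addr_ge0// divr_ge0.
apply: (le_trans _ (ler_wpM2r (ltW c0) h1)).
have -> : u ^+ 2 = e ^+ 2 * t ^+ 2 by rewrite /u exprMn real_normK ?num_real.
rewrite -subr_ge0; set X := (X in 0 <= X).
have -> : X = e ^+ 2 * t ^+ 2 / 4 + 4 / e ^+ 2 by rewrite /X; field; rewrite gt_eqF.
by apply: addr_ge0; apply: divr_ge0 => //; [apply: mulr_ge0|]; exact: sqr_ge0.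
Qed.

(** An explicit antiderivative on [0, n], followed by n to infinity. The
    exponential is written with |t| so that the two halves of the line glue in
    the next lemma. *)
Lemma integral_exp_cos_half e y : 0 < e ->
  \int[mu]_t (\1_(`[0, +oo[%classic : set R) t * (expR (- (e * `|t|)) * cos (t * y)))
  = e / (e ^+ 2 + y ^+ 2).
Proof.
move=> e0; set D := e ^+ 2 + y ^+ 2.
have D0 : 0 < D by rewrite ltr_pwDl ?exprn_gt0 ?sqr_ge0.
pose g t := expR (- (e * `|t|)) * cos (t * y).
have cg : continuous g.
  move=> t; apply: cvgM.
    apply: continuous_comp; last exact: continuous_expR.
    by apply: cvgN; apply: cvgM; [exact: cvg_cst|exact: norm_continuous].
  apply: continuous_comp; last exact: continuous_cos.
  by apply: cvgM; [exact: cvg_id|exact: cvg_cst].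
have mg := measurable_cont cg.
have gb t : `|g t| <= expR (- (e * `|t|)).
  by rewrite normrM ger0_norm ?expR_ge0// ler_piMr ?expR_ge0// ler_norml cos_geN1 cos_le1.
pose G t := expR (- (e * t)) * (y * sin (t * y) - e * cos (t * y)) / D.
pose g0 t := expR (- (e * t)) * cos (t * y).
have dG t : is_derive t (1 : R) G (g0 t).
  apply: is_derive_eq.
  by rewrite /GRing.scale/= /g0 /D; field; rewrite gt_eqF.
have cg0 : continuous g0.
  move=> t; apply: cvgM.
    apply: continuous_comp; last exact: continuous_expR.
    by apply: cvgN; apply: cvgM; [exact: cvg_cst|exact: cvg_id].
  apply: continuous_comp; last exact: continuous_cos.
  by apply: cvgM; [exact: cvg_id|exact: cvg_cst].
have step (n : nat) : \int[mu]_t (\1_(`[0, n%:R]%classic : set R) t * g t) = G n%:R - G 0.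
  rewrite -(ftc_indic (ler0n _ n) dG cg0); apply: eq_Rintegral => t _.
  rewrite indicE; have [|] := boolP (t \in _); rewrite ?mul0r// ?mul1r inE /= in_itv /=.
  by move=> /andP[t0 _]; rewrite /g /g0 ger0_norm.
have lim1 : (fun n : nat => \int[mu]_t (\1_(`[0, n%:R]%classic : set R) t * g t)) @ \oo -->
    \int[mu]_t (\1_(`[0, +oo[%classic : set R) t * g t).
  apply: (@Rint_dct _ _ _ mu _ _ (fun t => expR (- (e * `|t|)))).
  - by move=> n; apply: measurable_funM => //; exact: measurable_indic.
  - by apply: measurable_funM => //; exact: measurable_indic.
  - apply: aeW => t; apply: cvg_near_cst.
    exists (Num.truncn `|t|).+1 => // n /= tn; congr (_ * _).
    rewrite !indicE; congr (nat_of_bool _)%:R; apply/idP/idP; rewrite !inE /= !in_itv /= andbT.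
      by move=> /andP[].
    move=> t0; rewrite t0 /= (le_trans (ler_norm t))// ltW//.
    by rewrite (lt_le_trans (truncnS_gt _))// ler_nat.
  - exact: summable_exp_abs.
  - move=> n t; rewrite normrM (le_trans _ (gb t))// ler_piMl//.
    by rewrite indicE; case: (_ \in _); rewrite ?normr1 ?normr0.
have lim2 : (fun n : nat => G n%:R - G 0) @ \oo --> 0 - G 0.
  apply: cvgB; last exact: cvg_cst.
  have : (fun n : nat => expR (- e) ^+ n * ((`|y| + e) / D)) @ \oo --> 0 * ((`|y| + e) / D).
    apply: cvgM; last exact: cvg_cst.
    by apply: cvg_expr; rewrite ger0_norm ?expR_ge0// -expR0 ltr_expR oppr_lt0.
  rewrite mul0r => h; apply: norm_cvg0; apply: (squeeze_cvgr _ (cvg_cst _) h).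
  apply: nearW => n; rewrite normr_ge0 /= /G -mulrA normrM ger0_norm ?expR_ge0//.
  rewrite -expRM_natl mulrN mulrC [in leRHS]mulrC [n%:R * e]mulrC.
  apply: ler_wpM2r; first exact: expR_ge0.
  rewrite normrM [`|D^-1|]gtr0_norm ?invr_gt0// ler_wpM2r ?invr_ge0 ?(ltW D0)//.
  apply: (le_trans (ler_normB _ _)); rewrite !normrM (gtr0_norm e0).
  apply: lerD.
    by rewrite ler_piMr// ler_norml sin_geN1 sin_le1.
  by rewrite ler_piMr ?(ltW e0)// ler_norml cos_geN1 cos_le1.
move: lim1; under eq_fun do rewrite step.
move=> /(cvg_unique (@Rhausdorff R))/(_ lim2) ->.
by rewrite /G mulr0 mul0r oppr0 expR0 sin0 cos0; ring.
Qed.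

Lemma integral_exp_cos e y : 0 < e ->
  \int[mu]_t (expR (- (e * `|t|)) * cos (t * y)) = 2 * e / (e ^+ 2 + y ^+ 2).
Proof.
move=> e0; pose g t := expR (- (e * `|t|)) * cos (t * y).
have cg : continuous g.
  move=> t; apply: cvgM.
    apply: continuous_comp; last exact: continuous_expR.
    by apply: cvgN; apply: cvgM; [exact: cvg_cst|exact: norm_continuous].
  apply: continuous_comp; last exact: continuous_cos.
  by apply: cvgM; [exact: cvg_id|exact: cvg_cst].
have mg := measurable_cont cg.
pose u t := \1_(`[0, +oo[%classic : set R) t * g t.
have su : summable_fun mu u.
  apply: (summable_le _ (summable_exp_abs e0)).
    by apply: measurable_funM => //; exact: measurable_indic.
  move=> t; rewrite normrM normrM [`|expR _|]ger0_norm ?expR_ge0// mulrCA.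
  rewrite ler_piMr ?expR_ge0// mulr_ile1//.
    by rewrite indicE; case: (_ \in _); rewrite ?normr1 ?normr0.
  by rewrite ler_norml cos_geN1 cos_le1.
have -> : \int[mu]_t g t = \int[mu]_t (u t + u (- t)).
  apply: Rint_ae => //.
    apply: measurable_funD; first exact: summable_measurable su.
    exact: (summable_measurable (summable_reflect su)).
  apply: ae_imply (ae_neq 0) _ => t t0; rewrite /u /g normrN mulNr cosN -mulrDl.
  rewrite !indicE; suff -> : ((t \in `[0, +oo[%classic)%:R + ((- t \in `[0, +oo[%classic)%:R) : R) = 1.
    by rewrite mul1r.
  have iE s : (s \in (`[0, +oo[%classic : set R)) = (0 <= s).
    by apply/idP/idP; rewrite inE /= in_itv /= andbT.
  rewrite !iE oppr_ge0.
  by have [_|_|te] := ltgtP 0 t; rewrite ?addr0 ?add0r//; rewrite te eqxx in t0.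
by rewrite RintD ?Rint_reflect ?integral_exp_cos_half//; [field; rewrite gt_eqF// ltr_pwDl ?exprn_gt0 ?sqr_ge0|exact: summable_reflect].
Qed.

End LebesgueTools.

(** * Fourier inversion for band-limited functions *)

Section Inversion.
Context {R : realType}.
Notation mu := (@lebesgue_measure R).
Implicit Types (f g h : R -> R) (r a b c t x y e : R).

(** The Fourier transform of a real function is handled through its two real
    components, with fourier h = fcos h - i fsin h. *)
Definition fcos h t : R := \int[mu]_x (h x * cos (t * x)).
Definition fsin h t : R := \int[mu]_x (h x * sin (t * x)).
Definition inv_trans h y : R :=
  (2 * pi)^-1 * \int[mu]_t (fcos h t * cos (t * y) + fsin h t * sin (t * y)).
(** The support condition on the Fourier transform in the weak form that is
    used: the transform vanishes outside [- A, A]. *)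
Definition band_limited A h := summable_fun mu h /\
  forall t, A < `|t| -> fcos h t = 0 /\ fsin h t = 0.

Lemma normr_indic (D : set R) x : `|\1_D x| = \1_D x :> R.
Proof. by rewrite ger0_norm. Qed.

Lemma cos_norm x : `|cos x| <= 1 :> R.
Proof. by rewrite ler_norml cos_geN1 cos_le1. Qed.

Lemma sin_norm x : `|sin x| <= 1 :> R.
Proof. by rewrite ler_norml sin_geN1 sin_le1. Qed.

Lemma measurable_cos : measurable_fun setT (@cos R).
Proof. by apply: measurable_cont; exact: continuous_cos. Qed.

Lemma measurable_sin : measurable_fun setT (@sin R).
Proof. by apply: measurable_cont; exact: continuous_sin. Qed.

Lemma summable_bounded_mul h f : summable_fun mu h -> measurable_fun setT f ->
  (forall x, `|f x| <= 1) -> summable_fun mu (fun x => h x * f x).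
Proof.
move=> sh mf f1; apply: (summable_le _ (summable_norm sh)).
  by apply: measurable_funM => //; exact: summable_measurable sh.
by move=> x; rewrite normrM ler_piMr.
Qed.

Lemma measurable_comp_lin (f : R -> R) t : measurable_fun setT f ->
  measurable_fun setT (fun x => f (t * x)).
Proof. by move=> mf; apply: (measurableT_comp mf); apply: measurable_funM. Qed.

Lemma measurable_comp_linr (f : R -> R) t : measurable_fun setT f ->
  measurable_fun setT (fun x => f (x * t)).
Proof. by move=> mf; apply: (measurableT_comp mf); apply: measurable_funM. Qed.

Lemma summable_mul_cos h t : summable_fun mu h -> summable_fun mu (fun x => h x * cos (t * x)).
Proof.
move=> sh; apply: summable_bounded_mul => //; last by move=> x; exact: cos_norm.
exact: measurable_comp_lin measurable_cos.
Qed.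

Lemma summable_mul_sin h t : summable_fun mu h -> summable_fun mu (fun x => h x * sin (t * x)).
Proof.
move=> sh; apply: summable_bounded_mul => //; last by move=> x; exact: sin_norm.
exact: measurable_comp_lin measurable_sin.
Qed.

Lemma fcos_le h t : summable_fun mu h -> `|fcos h t| <= \int[mu]_x `|h x|.
Proof.
move=> sh; apply: Rint_norm_le; [exact: summable_mul_cos|exact: summable_norm|].
by move=> x; rewrite normrM ler_piMr// cos_norm.
Qed.

Lemma fsin_le h t : summable_fun mu h -> `|fsin h t| <= \int[mu]_x `|h x|.
Proof.
move=> sh; apply: Rint_norm_le; [exact: summable_mul_sin|exact: summable_norm|].
by move=> x; rewrite normrM ler_piMr// sin_norm.
Qed.

Notation RR := (measurableTypeR R * measurableTypeR R)%type.

Lemma measurable_fun1 (f : R -> R) : measurable_fun setT f ->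
  measurable_fun setT (fun p : RR => f p.1).
Proof. by move=> mf; apply: (measurableT_comp mf); exact: measurable_fst. Qed.

Lemma measurable_fun2 (f : R -> R) : measurable_fun setT f ->
  measurable_fun setT (fun p : RR => f p.2).
Proof. by move=> mf; apply: (measurableT_comp mf); exact: measurable_snd. Qed.

Lemma measurable_prodcomp (f : R -> R) : measurable_fun setT f ->
  measurable_fun setT (fun p : RR => f (p.1 * p.2)).
Proof.
move=> mf; apply: (measurableT_comp mf).
apply: measurable_funM; [exact: measurable_fst|exact: measurable_snd].
Qed.

(** On [- A, A] the transform is a marginal of a function dominated by an
    indicator times |h|; outside it vanishes. *)
Lemma summable_trans A h (f : R -> R) : summable_fun mu h -> measurable_fun setT f ->
  (forall x, `|f x| <= 1) ->
  (forall t, A < `|t| -> \int[mu]_x (h x * f (t * x)) = 0) ->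
  summable_fun mu (fun t => \int[mu]_x (h x * f (t * x))).
Proof.
move=> sh mf f1 band.
pose F (p : RR) := \1_(`[- A, A]%classic : set R) p.1 * (h p.2 * f (p.1 * p.2)).
have mF : measurable_fun setT F.
  apply: measurable_funM.
    exact: (measurable_fun1 (measurable_indic _)).
  apply: measurable_funM; first exact: measurable_fun2 (summable_measurable sh).
  exact: measurable_prodcomp.
have FF t x : `|F (t, x)| <= \1_(`[- A, A]%classic : set R) t * `|h x|.
  by rewrite /F /= !normrM normr_indic ler_wpM2l// ler_piMr.
have := summable_marginal1 mF (summable_indic (- A) A) (summable_norm sh) FF.
congr (integrable _ _ _); apply/funext => t /=; congr EFin.
have sht : summable_fun mu (fun x => h x * f (t * x)).
  by apply: summable_bounded_mul => //; exact: measurable_comp_lin.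
rewrite /F /= RintZ// indicE.
have [|] := boolP (t \in _); rewrite ?mul1r// mul0r => tA.
rewrite band// ltNge; apply: contra tA => tA.
by rewrite inE /= in_itv /= -ler_norml.
Qed.

Lemma summable_fcos A h : band_limited A h -> summable_fun mu (fcos h).
Proof.
move=> [sh band]; apply: (@summable_trans A) => //; first exact: measurable_cos.
  exact: cos_norm.
by move=> t /band[].
Qed.

Lemma summable_fsin A h : band_limited A h -> summable_fun mu (fsin h).
Proof.
move=> [sh band]; apply: (@summable_trans A) => //; first exact: measurable_sin.
  exact: sin_norm.
by move=> t /band[].
Qed.

Lemma summable_inv_integrand A h y : band_limited A h ->
  summable_fun mu (fun t => fcos h t * cos (t * y) + fsin h t * sin (t * y)).
Proof.
move=> bh; apply: summableD; apply: summable_bounded_mul.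
- exact: summable_fcos bh.
- exact: measurable_comp_linr measurable_cos.
- by move=> x; exact: cos_norm.
- exact: summable_fsin bh.
- exact: measurable_comp_linr measurable_sin.
- by move=> x; exact: sin_norm.
Qed.

Definition tmass h : R := \int[mu]_t (`|fcos h t| + `|fsin h t|).

Lemma summable_tmass A h : band_limited A h ->
  summable_fun mu (fun t => `|fcos h t| + `|fsin h t|).
Proof. by move=> bh; apply: summableD; apply: summable_norm; [exact: summable_fcos bh|exact: summable_fsin bh]. Qed.

Lemma integrand_le h t y : `|fcos h t * cos (t * y) + fsin h t * sin (t * y)| <=
  `|fcos h t| + `|fsin h t|.
Proof.
rewrite (le_trans (ler_normD _ _))// lerD// normrM ler_piMr//.
  exact: cos_norm.
exact: sin_norm.
Qed.

Let w x : R := (1 + x ^+ 2)^-1.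

(** The weight 1 / (1 + y^2) makes the defining integrand summable in the pair
    (y, t), so the marginal is measurable; the weight is then divided out. *)
Lemma measurable_inv_trans A h : band_limited A h -> measurable_fun setT (inv_trans h).
Proof.
move=> bh; have mc := summable_measurable (summable_fcos bh); have ms := summable_measurable (summable_fsin bh).
pose F (p : RR) := w p.1 * (fcos h p.2 * cos (p.2 * p.1) + fsin h p.2 * sin (p.2 * p.1)).
have mw : measurable_fun setT w := summable_measurable summable_cauchy.
have mF : measurable_fun setT F.
  apply: measurable_funM; first exact: measurable_fun1.
  have swp (f : R -> R) : measurable_fun setT f ->
      measurable_fun setT (fun p : RR => f (p.2 * p.1)).
    by move=> mf; under eq_fun do rewrite mulrC; exact: measurable_prodcomp.
  apply: measurable_funD; apply: measurable_funM.
  - exact: measurable_fun2 mc.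
  - exact: swp measurable_cos.
  - exact: measurable_fun2 ms.
  - exact: swp measurable_sin.
have w0 x : 0 <= w x by rewrite invr_ge0 addr_ge0 ?sqr_ge0.
have FF y t : `|F (y, t)| <= w y * (`|fcos h t| + `|fsin h t|).
  by rewrite /F /= normrM ger0_norm// ler_wpM2l// integrand_le.
have := summable_measurable (summable_marginal1 mF summable_cauchy (summable_tmass bh) FF).
under eq_fun => y.
  rewrite /F /= RintZ; last exact: summable_inv_integrand bh.
  over.
move=> mm; rewrite (_ : inv_trans h = fun y => (2 * pi)^-1 * ((1 + y ^+ 2) *
  (w y * \int[mu]_t (fcos h t * cos (t * y) + fsin h t * sin (t * y))))).
  apply: measurable_funM => //; apply: measurable_funM => //.
  by apply: measurable_funD => //; exact: exprn_measurable.
apply/funext => y; rewrite /inv_trans [(1 + _) * _]mulrA /w mulfV ?mul1r//.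
by rewrite gt_eqF// ltr_pwDl// sqr_ge0.
Qed.

Lemma inv_trans_le A h y : band_limited A h ->
  `|inv_trans h y| <= (2 * pi)^-1 * tmass h.
Proof.
move=> bh; rewrite normrM ger0_norm ?invr_ge0 ?mulr_ge0 ?pi_ge0//.
rewrite ler_wpM2l ?invr_ge0 ?mulr_ge0 ?pi_ge0//.
apply: Rint_norm_le; [exact: summable_inv_integrand bh|exact: summable_tmass bh|].
by move=> t; exact: integrand_le.
Qed.

(** Convolution with the Poisson kernel is damping by exp(- e |t|) on the
    Fourier side: Fubini and the transform of the two-sided exponential. *)
Lemma poisson_smoothing h e y : 0 < e -> summable_fun mu h ->
  \int[mu]_x (h x * (2 * e / (e ^+ 2 + (y - x) ^+ 2))) =
  \int[mu]_t (expR (- (e * `|t|)) * (fcos h t * cos (t * y) + fsin h t * sin (t * y))).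
Proof.
move=> e0 sh; pose E t := expR (- (e * `|t|)).
have sE : summable_fun mu E by exact: summable_exp_abs.
pose F (p : RR) := h p.1 * (E p.2 * cos (p.2 * (y - p.1))).
have mF : measurable_fun setT F.
  apply: measurable_funM; first exact: measurable_fun1 (summable_measurable sh).
  apply: measurable_funM; first exact: measurable_fun2 (summable_measurable sE).
  apply: (measurableT_comp measurable_cos); apply: measurable_funM.
    exact: measurable_snd.
  by apply: measurable_funB => //; exact: measurable_fst.
have E0 t : 0 <= E t by exact: expR_ge0.
have FF x t : `|F (x, t)| <= `|h x| * E t.
  by rewrite /F /= !normrM (ger0_norm (E0 _)) ler_wpM2l// ler_piMr// cos_norm.
transitivity (\int[mu]_x \int[mu]_t F (x, t)).
  apply: eq_Rintegral => x _; rewrite /F /= -(integral_exp_cos _ e0) -RintZ//.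
  apply: summable_bounded_mul => //; last by move=> t; exact: cos_norm.
  exact: measurable_comp_linr measurable_cos.
rewrite (Rint_fubini mF (summable_norm sh) sE FF); apply: eq_Rintegral => t _; rewrite /F /=.
transitivity (\int[mu]_x (E t * (cos (t * y) * (h x * cos (t * x)) + sin (t * y) * (h x * sin (t * x))))).
  by apply: eq_Rintegral => x _; rewrite mulrBr cosB; ring.
have s1 := summableZ (cos (t * y)) (summable_mul_cos t sh); have s2 := summableZ (sin (t * y)) (summable_mul_sin t sh).
rewrite RintZ; last exact: summableD.
rewrite RintD// !RintZ; [|exact: summable_mul_sin|exact: summable_mul_cos].
by rewrite /E /fcos /fsin; ring.
Qed.

Lemma integral_poisson_box e a b x : 0 < e -> a <= b ->
  \int[mu]_y (\1_(`[a, b]%classic : set R) y * (2 * e / (e ^+ 2 + (y - x) ^+ 2))) =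
  2 * (atan ((b - x) / e) - atan ((a - x) / e)).
Proof.
move=> e0 ab; rewrite mulrBr.
have D0 y : 0 < e ^+ 2 + (y - x) ^+ 2 by rewrite ltr_pwDl ?exprn_gt0 ?sqr_ge0.
have dF y : is_derive y (1 : R) (fun y => 2 * atan ((y - x) / e))
    (2 * e / (e ^+ 2 + (y - x) ^+ 2)).
  apply: is_derive_eq; rewrite /GRing.scale/=.
  have d0 := D0 y; field; rewrite !gt_eqF//=.
have cf : continuous (fun y => 2 * e / (e ^+ 2 + (y - x) ^+ 2)).
  move=> y; apply: cvgM; first exact: cvg_cst.
  apply: cvgV; first by rewrite gt_eqF.
  apply: cvgD; first exact: cvg_cst.
  by apply: (@cvgM _ _ _ _ (fun y => y - x) (fun y => y - x));
    apply: cvgB; [exact: cvg_id|exact: cvg_cst|exact: cvg_id|exact: cvg_cst].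
exact: (ftc_indic ab dF cf).
Qed.

End Inversion.

Section InversionTheorem.
Context {R : realType}.
Notation mu := (@lebesgue_measure R).
Implicit Types (f g h : R -> R) (r a b c t x y e : R).
Notation RR := (measurableTypeR R * measurableTypeR R)%type.

Lemma atan_dilate_pos (z : R) : 0 < z ->
  (fun n : nat => atan (z / n.+1%:R^-1)) @ \oo --> (pi / 2 : R).
Proof.
move=> z0; apply: (cvg_comp _ (@atan R) _ (@cvgy_atan R)).
apply/cvgryPge => M; exists (Num.truncn (`|M| / z)).+1 => // n /= hn.
rewrite invrK (le_trans (ler_norm M))// mulrC -ler_pdivrMr// ltW//.
apply: (lt_trans (truncnS_gt _)).
by rewrite ltr_nat ltnS.
Qed.

Lemma atan_dilate (z : R) :
  (fun n : nat => atan (z / n.+1%:R^-1)) @ \oo --> (Num.sg z * (pi / 2) : R).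
Proof.
have [z0|z0|<-] := ltgtP 0 z.
- by rewrite gtr0_sg// mul1r; exact: atan_dilate_pos.
- rewrite ltr0_sg// mulN1r (_ : (fun n : nat => _) = (fun n : nat => - atan (- z / n.+1%:R^-1))).
    by apply: cvgN; apply: atan_dilate_pos; rewrite oppr_gt0.
  by apply/funext => n; rewrite mulNr atanN opprK.
- rewrite sgr0 mul0r; under eq_fun do rewrite mul0r atan0; exact: cvg_cst.
Qed.

(** Both sides are limits, as e tends to 0, of the integral over [a, b] of the
    Poisson smoothing of h. Inside the Fourier representation the damping tends
    to 1. On the other side Fubini turns the kernel into a difference of
    arctangents, which tends to 2 pi on ]a, b[ and to 0 outside [a, b]. *)
Lemma inversion_box A h a b : band_limited A h -> a <= b ->
  \int[mu]_x (\1_(`[a, b]%classic : set R) x * h x) =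
  \int[mu]_y (\1_(`[a, b]%classic : set R) y * inv_trans h y).
Proof.
move=> bh ab; have [sh _] := bh.
(* The smoothing parameter tends to 0 along a sequence, as dominated convergence requires. *)
pose e n : R := n.+1%:R^-1.
have e0 n : 0 < e n by rewrite invr_gt0.
pose P n x y : R := 2 * e n / (e n ^+ 2 + (y - x) ^+ 2).
pose X n y : R := \int[mu]_t (expR (- (e n * `|t|)) *
  (fcos h t * cos (t * y) + fsin h t * sin (t * y))).
pose Z n x : R := 2 * (atan ((b - x) / e n) - atan ((a - x) / e n)).
have mh := summable_measurable sh.
have mi : measurable_fun setT (\1_(`[a, b]%classic : set R) : R -> R) by exact: measurable_indic.
have PX n : summable_fun mu (fun y => \1_(`[a, b]%classic : set R) y * X n y) /\
    \int[mu]_y (\1_(`[a, b]%classic : set R) y * X n y) = \int[mu]_x (h x * Z n x).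
  pose F (p : RR) := \1_(`[a, b]%classic : set R) p.1 * (h p.2 * P n p.2 p.1).
  have D0 x y : 0 < e n ^+ 2 + (y - x) ^+ 2 by rewrite ltr_pwDl ?exprn_gt0 ?sqr_ge0.
  have mP : measurable_fun setT (fun p : RR => P n p.2 p.1).
    have mD : measurable_fun setT (fun p : RR => p.1 - p.2).
      by apply: measurable_funB; [exact: measurable_fst|exact: measurable_snd].
    have cQ : continuous (fun z : R => 2 * e n / (e n ^+ 2 + z ^+ 2)).
      move=> z; apply: cvgM; first exact: cvg_cst.
      apply: cvgV; first by have := D0 0 z; rewrite subr0 => /gt_eqF ->.
      apply: cvgD; first exact: cvg_cst.
      exact: exprn_continuous.
    exact: (measurableT_comp (measurable_cont cQ) mD).
  have mF : measurable_fun setT F.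
    apply: measurable_funM; first exact: measurable_fun1.
    by apply: measurable_funM; first exact: measurable_fun2.
  have P2 x y : `|P n x y| <= 2 / e n.
    rewrite ger0_norm; last by rewrite divr_ge0 ?mulr_ge0 ?(ltW (e0 n)) ?(ltW (D0 _ _)).
    rewrite ler_pdivrMr// mulrAC ler_pdivlMr// -mulrA ler_wpM2l// -expr2 lerDl sqr_ge0//.
  have FF y x : `|F (y, x)| <= \1_(`[a, b]%classic : set R) y * (2 / e n * `|h x|).
    by rewrite /F /= 2!normrM normr_indic ler_wpM2l// mulrC ler_wpM2r ?P2.
  have FX : (fun y => \1_(`[a, b]%classic : set R) y * X n y) =
      (fun y => \int[mu]_x F (y, x)).
    apply/funext => y; rewrite /F /X /= -poisson_smoothing//.
    rewrite -RintZ// (summable_le _ (summableZ (2 / e n) (summable_norm sh)))//.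
      apply: measurable_funM => //; apply: measurable_cont => x.
      apply: cvgM; first exact: cvg_cst.
      apply: cvgV; first by rewrite gt_eqF.
      apply: cvgD; first exact: cvg_cst.
      by apply: (@cvgM _ _ _ _ (fun x => y - x) (fun x => y - x));
        apply: cvgB; [exact: cvg_cst|exact: cvg_id|exact: cvg_cst|exact: cvg_id].
    by move=> x; rewrite normrM mulrC ler_wpM2r// P2.
  rewrite FX; split; first exact: (summable_marginal1 mF (summable_indic a b) (summableZ _ (summable_norm sh)) FF).
  rewrite (Rint_fubini mF (summable_indic a b) (summableZ _ (summable_norm sh)) FF).
  apply: eq_Rintegral => x _; rewrite /F /=.
  transitivity (\int[mu]_y (h x * (\1_(`[a, b]%classic : set R) y * P n x y))).
    by apply: eq_Rintegral => y _; ring.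
  rewrite RintZ ?integral_poisson_box//; apply: (@summable_indic_mul _ _ _ (2 / e n)) => //.
  have := measurableT_comp mP (measurable_pair2 x); apply.
have pi0 : 2 * pi != 0 :> R by rewrite mulf_neq0 ?gt_eqF ?pi_gt0.
have eexp n t : expR (- (e n * `|t|)) <= 1.
  by rewrite -expR0 ler_expR oppr_le0 mulr_ge0// ltW// e0.
have ce : e @ \oo --> (0 : R) by exact: cvg_harmonic.
have sI y := summable_inv_integrand y bh.
have mInv := measurable_inv_trans bh.
have Xle n y : `|X n y| <= tmass h.
  apply: Rint_norm_le; last first.
  - move=> t; rewrite normrM ger0_norm ?expR_ge0//.
    rewrite (le_trans _ (integrand_le h t y))// ler_piMl// eexp.
  - exact: summable_tmass bh.
  - under [X in EFin \o X]eq_fun do rewrite mulrC.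
    apply: summable_bounded_mul; [exact: sI|exact: summable_measurable (summable_exp_abs (e0 n))|].
    by move=> t; rewrite ger0_norm ?expR_ge0// eexp.
have l1 : (fun n => \int[mu]_y (\1_(`[a, b]%classic : set R) y * X n y)) @ \oo -->
    \int[mu]_y (\1_(`[a, b]%classic : set R) y * (2 * pi * inv_trans h y)).
  apply: (@Rint_dct _ _ _ mu _ _ (fun y => tmass h * \1_(`[a, b]%classic : set R) y)).
  - by move=> n; have [/summable_measurable] := PX n.
  - by apply: measurable_funM => //; apply: measurable_funM.
  - apply: aeW => y; apply: cvgM; first exact: cvg_cst.
    rewrite /inv_trans mulrA mulfV// mul1r.
    apply: (@Rint_dct _ _ _ mu _ _ (fun t => `|fcos h t| + `|fsin h t|)).
    + move=> n; apply: measurable_funM; first exact: summable_measurable (summable_exp_abs (e0 n)).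
      exact: summable_measurable (sI y).
    + exact: summable_measurable (sI y).
    + apply: aeW => t; rewrite -[X in _ --> X]mul1r; apply: cvgM; last exact: cvg_cst.
      rewrite -expR0; apply: (cvg_comp (fun n => - (e n * `|t|)) (@expR R) _ (@continuous_expR R 0)).
      rewrite -oppr0; apply: cvgN; rewrite -[X in _ --> X](mul0r `|t|).
      by apply: cvgM => //; exact: cvg_cst.
    + exact: summable_tmass bh.
    + move=> n t; rewrite normrM ger0_norm ?expR_ge0//.
      rewrite (le_trans _ (integrand_le h t y))// ler_piMl// eexp.
  - exact/summableZ/summable_indic.
  - move=> n y; rewrite normrM normr_indic mulrC ler_wpM2r//.
have l2 : (fun n => \int[mu]_x (h x * Z n x)) @ \oo -->
    \int[mu]_x (h x * (2 * pi * \1_(`[a, b]%classic : set R) x)).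
  have mZ n : measurable_fun setT (Z n).
    have mA c : measurable_fun setT (fun x : R => atan ((c - x) / e n)).
      apply: (measurableT_comp (measurable_cont (@continuous_atan R))).
      by apply: measurable_funM => //; apply: measurable_funB.
    by apply: measurable_funM => //; exact: measurable_funB.
  apply: (@Rint_dct _ _ _ mu _ _ (fun x => 2 * pi * `|h x|)).
  - by move=> n; apply: measurable_funM => //; exact: mZ.
  - by apply: measurable_funM => //; apply: measurable_funM.
  - apply: ae_imply (ae_and (ae_neq a) (ae_neq b)) _ => x [xa xb].
    apply: cvgM; first exact: cvg_cst.
    have : (fun n => Z n x) @ \oo -->
        2 * (Num.sg (b - x) * (pi / 2) - Num.sg (a - x) * (pi / 2)).
      apply: cvgM; first exact: cvg_cst.
      by apply: cvgB; exact: atan_dilate.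
    congr (_ --> _); rewrite indicE.
    have -> : (x \in (`[a, b]%classic : set R)) = (a <= x <= b).
      by apply/idP/idP; rewrite inE /= in_itv.
    have [ax|ax|axe] := ltgtP a x; last by rewrite axe eqxx in xa.
      have [xb'|xb'|xbe] := ltgtP x b; last by rewrite xbe eqxx in xb.
        by rewrite gtr0_sg ?subr_gt0// ltr0_sg ?subr_lt0//=; field.
      by rewrite ltr0_sg ?subr_lt0// ltr0_sg ?subr_lt0//= subrr !mulr0.
    have xb' : x < b by rewrite (lt_le_trans ax).
    by rewrite gtr0_sg ?subr_gt0// gtr0_sg ?subr_gt0//= subrr !mulr0.
  - exact/summableZ/summable_norm.
  - move=> n x; rewrite normrM mulrC ler_wpM2r// normrM ger0_norm// ler_wpM2l//.
    rewrite ler_norml.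
    have := atan_gtNpi2 ((b - x) / e n); have := atan_ltpi2 ((b - x) / e n).
    have := atan_gtNpi2 ((a - x) / e n); have := atan_ltpi2 ((a - x) / e n).
    by move: (atan _) (atan _) => u v; lra.
have : \int[mu]_y (\1_(`[a, b]%classic : set R) y * (2 * pi * inv_trans h y)) =
   \int[mu]_x (h x * (2 * pi * \1_(`[a, b]%classic : set R) x)).
  move: l1; under eq_fun do rewrite (PX _).2.
  by move=> l1; exact: (cvg_unique (@Rhausdorff R) l1 l2).
under eq_Rintegral do rewrite mulrCA.
under [RHS]eq_Rintegral do rewrite mulrCA [h _ * _]mulrC.
rewrite RintZ; last first.
  by apply: summable_indic_mul => // y _; exact: inv_trans_le bh.
rewrite RintZ; last first.
  apply: (summable_le _ (summable_norm sh)); first exact: measurable_funM.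
  by move=> x; rewrite normrM normr_indic ler_piMl// indicE; case: (_ \in _).
by move/(mulfI pi0).
Qed.

(** Two locally summable functions with the same integral on every interval
    coincide almost everywhere, by Lebesgue differentiation of the primitive of
    their difference. *)
Lemma inversion_ae A h : band_limited A h ->
  {ae mu, forall x, h x = inv_trans h x}.
Proof.
move=> bh; have [sh _] := bh; have mh := summable_measurable sh.
have mInv := measurable_inv_trans bh.
have main (M : nat) : {ae mu, forall x, - M%:R <= x <= M%:R -> h x = inv_trans h x}.
  pose d x := \1_(`[- M%:R, M%:R]%classic : set R) x * (h x - inv_trans h x).
  have dE x : d x = \1_(`[- M%:R, M%:R]%classic : set R) x * h x -
      \1_(`[- M%:R, M%:R]%classic : set R) x * inv_trans h x by rewrite /d mulrBr.
  have sh1 a b : summable_fun mu (fun x => \1_(`[a, b]%classic : set R) x * h x).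
    apply: (summable_le _ (summable_norm sh)).
      by apply: measurable_funM => //; exact: measurable_indic.
    by move=> x; rewrite normrM normr_indic ler_piMl// indicE; case: (_ \in _).
  have si1 a b : summable_fun mu (fun x => \1_(`[a, b]%classic : set R) x * inv_trans h x).
    by apply: summable_indic_mul => // y _; exact: inv_trans_le bh.
  have sd : summable_fun mu d.
    rewrite (_ : d = fun x => \1_(`[- M%:R, M%:R]%classic : set R) x * h x -
      \1_(`[- M%:R, M%:R]%classic : set R) x * inv_trans h x); last exact/funext.
    exact: summableB.
  (* The primitive of d vanishes, so d does almost everywhere. *)
  have F0 y : \int[mu]_(t in `]-oo, y]) d t = 0.
    rewrite -Rint_indic.
    have [yM|My] := ltP y (- M%:R).
      rewrite (_ : (fun x => _) = (fun=> 0)) ?Rint0//; apply/funext => t.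
      rewrite /d mulrA !indicE.
      have [ty|_] := boolP (t \in _); last by rewrite !mul0r.
      have [tM|_] := boolP (t \in _); last by rewrite mulr0 mul0r.
      move: ty tM; rewrite !inE /= !in_itv /= => ty /andP[tM _].
      by have := le_lt_trans (le_trans tM ty) yM; rewrite ltxx.
    have Mm : - M%:R <= Num.min y M%:R.
      by rewrite le_min My /= lerNl (@le_trans _ _ 0) ?ler0n// lerNl oppr0 ler0n.
    transitivity (\int[mu]_t (\1_(`[- M%:R, Num.min y M%:R]%classic : set R) t * h t -
        \1_(`[- M%:R, Num.min y M%:R]%classic : set R) t * inv_trans h t)).
      apply: eq_Rintegral => t _; rewrite /d mulrA -mulrBr; congr (_ * _).
      rewrite !indicE -natrM mulnb; congr (nat_of_bool _)%:R.
      apply/andP/idP; rewrite !inE /= !in_itv /= le_min.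
        by move=> [-> /andP[-> ->]].
      by move=> /andP[-> /andP[-> ->]].
    by rewrite RintB// (inversion_box bh Mm) subrr.
  have sdy y : mu.-integrable `]-oo, y] (EFin \o d).
    by apply: integrableS sd => //; exact: measurable_itv.
  have ld := open_integrable_locally openT sd.
  have := FTC1Ny sdy ld.
  rewrite (_ : (fun x => \int[mu]_(t in `]-oo, x]) d t) = cst 0); last exact/funext.
  move=> hd; apply: ae_imply hd _ => x [_]; rewrite derive1_cst /d => /esym + xM.
  rewrite indicE mem_set ?mul1r; last by rewrite /= in_itv.
  by move/eqP; rewrite subr_eq0 => /eqP.
have hm := ae_foralln main; apply: ae_imply hm _ => x hx.
apply: (hx (Num.truncn `|x|).+1); rewrite -ler_norml ltW//; exact: truncnS_gt.
Qed.

End InversionTheorem.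

(** * Decay, periodization and Parseval's identity *)

Section Decay.
Context {R : realType}.
Notation mu := (@lebesgue_measure R).
Implicit Types (f g h q : R -> R) (r a b c t x y e : R).
Notation RR := (measurableTypeR R * measurableTypeR R)%type.

Lemma fourierE h t : summable_fun mu h -> fourier h t = fcos h t +i* (- fsin h t).
Proof.
move=> sh; rewrite /fourier /cintegral /expi /leb; congr (_ +i* _).
  by apply: eq_Rintegral => x _; rewrite /= mul0r subr0 cosN.
rewrite -mulN1r -RintZ; last exact: summable_mul_sin.
by apply: eq_Rintegral => x _; rewrite /= mul0r addr0 sinN; ring.
Qed.

Lemma band_limited_supp h (S : set R) A : summable_fun mu h ->
  supp (fourier h) `<=` S -> (forall t, S t -> `|t| <= A) -> band_limited A h.
Proof.
move=> sh sS SA; split => // t tA.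
have : fourier h t = 0.
  apply: contrapT => /eqP ht; move: tA; rewrite ltNge (SA t)//.
  by apply: sS; apply: subset_closure.
by rewrite fourierE// => -[-> /eqP]; rewrite oppr_eq0 => /eqP ->.
Qed.

Lemma fourier_zero h (S : set R) t : summable_fun mu h ->
  supp (fourier h) `<=` S -> ~ S t -> fcos h t = 0 /\ fsin h t = 0.
Proof.
move=> sh sS nS; have : fourier h t = 0.
  apply: contrapT => /eqP ht; apply: nS.
  by apply: sS; apply: subset_closure.
by rewrite fourierE// => -[-> /eqP]; rewrite oppr_eq0 => /eqP ->.
Qed.

(** Two integrations by parts at once: for T = cos or sin, with primitive P, the
    function y f(t) P(t y) + f'(t) T(t y) has derivative y^2 f(t) T(t y) +
    f''(t) T(t y), and it vanishes beyond the support of f. *)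
Lemma smooth_trans_decay A f : (forall m t, derivable (derive1n m f) t 1) ->
  summable_fun mu f ->
  (forall t, A < `|t| -> f t = 0) -> exists2 K, 0 <= K & forall y,
    `|\int[mu]_t (f t * cos (t * y))| * (1 + y ^+ 2) <= K /\
    `|\int[mu]_t (f t * sin (t * y))| * (1 + y ^+ 2) <= K.
Proof.
move=> df sf fA.
pose f1 := derive1 f; pose f2 := derive1 f1.
have d0 t : is_derive t (1 : R) f (f1 t).
  by rewrite /f1 derive1E; apply: derivableP; exact: (df 0%N t).
have d1 t : is_derive t (1 : R) f1 (f2 t).
  by rewrite /f2 derive1E; apply: derivableP; exact: (df 1%N t).
have cts g : (forall t, derivable g t 1) -> continuous g.
  by move=> dg t; apply: differentiable_continuous; apply/derivable1_diffP.
have c0 : continuous f := cts _ (df 0%N).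
have c2 : continuous f2 := cts _ (df 2%N).
(* Strictly beyond the support, so that f and its derivative vanish at both ends. *)
pose B := `|A| + 1.
have B0 : - B <= B by rewrite /B; have := normr_ge0 A; lra.
have BA t : B <= `|t| -> A < `|t|.
  by apply: lt_le_trans; rewrite /B (le_lt_trans (ler_norm A))// ltrDl.
have f1A t : A < `|t| -> f1 t = 0.
  move=> tA; rewrite /f1 derive1E (@near_eq_derive _ _ _ _ (cst 0)).
    by rewrite derive_cst.
  have hn := @cvgr_gt _ _ _ (nbhs_filter t) _ _ (@norm_continuous _ R t) _ tA.
  have hn' : \forall u \near t, _ = (0 : R) := filterS (fun u => @fA u) hn.
exact: hn'.
have fB : f B = 0 /\ f (- B) = 0 /\ f1 B = 0 /\ f1 (- B) = 0.
  have h1 : A < `|B| by apply: BA; exact: ler_norm.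
  by rewrite !fA ?f1A ?normrN.
have [fB1 [fB2 [fB3 fB4]]] := fB.
have indE g t : (forall t, A < `|t| -> g t = 0) ->
    \1_(`[- B, B]%classic : set R) t * g t = g t.
  move=> gA; rewrite indicE; have [|tB] := boolP (t \in _); rewrite ?mul1r ?mul0r//.
  rewrite gA//; apply: BA; rewrite leNgt; apply: contra tB => tB.
  by rewrite inE /= in_itv /= -ler_norml ltW.
have m2 := measurable_cont c2.
have s2 : summable_fun mu (fun t => \1_(`[- B, B]%classic : set R) t * f2 t).
  have f2A t : A < `|t| -> f2 t = 0.
    move=> tA; rewrite /f2 derive1E (@near_eq_derive _ _ _ _ (cst 0)).
      by rewrite derive_cst.
    have hn := @cvgr_gt _ _ _ (nbhs_filter t) _ _ (@norm_continuous _ R t) _ tA.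
    have hn' : \forall u \near t, _ = (0 : R) := filterS (fun u => @f1A u) hn.
exact: hn'.
  have cw : {within `[- B, B], continuous (fun t => `|f2 t|)}.
    apply: continuous_subspaceT => t.
    by apply: (@continuous_comp _ _ _ f2 (fun z : R => `|z|)); [exact: c2|exact: norm_continuous].
  have [M _ hM2] := EVT_max B0 cw.
  apply: (@summable_indic_mul _ _ _ `|f2 M|) => //.
pose K2 := \int[mu]_t `|\1_(`[- B, B]%classic : set R) t * f2 t|.
have scos y : summable_fun mu (fun t => f t * cos (t * y)).
  apply: summable_bounded_mul => //; last by move=> x; exact: cos_norm.
  exact: measurable_comp_linr measurable_cos.
have ssin y : summable_fun mu (fun t => f t * sin (t * y)).
  apply: summable_bounded_mul => //; last by move=> x; exact: sin_norm.
  exact: measurable_comp_linr measurable_sin.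
have trig (T T' : R -> R) y : measurable_fun setT T -> (forall x, `|T x| <= 1) -> continuous T ->
    (forall x, is_derive x (1 : R) T (- T' x)) -> (forall x, is_derive x (1 : R) T' (T x)) ->
    summable_fun mu (fun t => f t * T (t * y)) ->
    `|\int[mu]_t (f t * T (t * y))| * (1 + y ^+ 2) <= \int[mu]_t `|f t| + K2.
  move=> mT T1 cT dT dT' sfT.
  pose G t := f t * (y * T' (t * y)) + f1 t * T (t * y).
  pose G' t := y ^+ 2 * (f t * T (t * y)) + f2 t * T (t * y).
  have dG t : is_derive t (1 : R) G (G' t).
    have e0 := d0 t; have e1 := d1 t.
    have e2 : is_derive t (1 : R) (fun t => T (t * y)) (y * - T' (t * y)).
      have := @is_derive1_comp _ T (fun t => t * y) t (- T' (t * y)) y (dT _) _.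
      by rewrite mulrC; apply; apply: is_derive_eq; rewrite /GRing.scale/=; ring.
    have e3 : is_derive t (1 : R) (fun t => T' (t * y)) (y * T (t * y)).
      have := @is_derive1_comp _ T' (fun t => t * y) t (T (t * y)) y (dT' _) _.
      by rewrite mulrC; apply; apply: is_derive_eq; rewrite /GRing.scale/=; ring.
    apply: is_derive_eq; rewrite /GRing.scale/= /G'; ring.
  have cTy : continuous (fun t => T (t * y)).
    move=> t; apply: (@continuous_comp _ _ _ (fun t => t * y) T); last exact: cT.
    by apply: cvgM; [exact: cvg_id|exact: cvg_cst].
  have cG : continuous G'.
    move=> t; apply: cvgD.
      by apply: cvgM; [exact: cvg_cst|apply: cvgM; [exact: c0|exact: cTy]].
    by apply: cvgM; [exact: c2|exact: cTy].
  have := ftc_indic B0 dG cG; rewrite /G fB1 fB2 fB3 fB4 !mul0r addr0 subrr.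
  have s2T : summable_fun mu (fun t => \1_(`[- B, B]%classic : set R) t * f2 t * T (t * y)).
    by apply: summable_bounded_mul => //; exact: measurable_cont.
  have e t : \1_(`[- B, B]%classic : set R) t * G' t =
      y ^+ 2 * (f t * T (t * y)) + \1_(`[- B, B]%classic : set R) t * f2 t * T (t * y).
    by rewrite -[in RHS](indE f t fA) /G'; ring.
  under eq_Rintegral do rewrite e.
  rewrite RintD//; last exact: summableZ.
  rewrite RintZ// => /eqP; rewrite addr_eq0 => /eqP h.
  rewrite mulrDr mulr1; apply: lerD.
    apply: Rint_norm_le => //; first exact: summable_norm.
    by move=> t; rewrite normrM ler_piMr.
  rewrite mulrC -[y ^+ 2]ger0_norm ?sqr_ge0// -normrM h normrN.
  apply: Rint_norm_le => //; first exact: summable_norm.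
  by move=> t; rewrite normrM ler_piMr.
exists (\int[mu]_t `|f t| + K2).
  by apply: addr_ge0; apply: Rintegral_ge0.
move=> y; split.
  apply: (trig cos sin) => //; [exact: measurable_cos|exact: cos_norm|exact: continuous_cos].
apply: (trig sin (fun x => - cos x)) => //; [exact: measurable_sin|exact: sin_norm|exact: continuous_sin|..].
  by move=> x; rewrite opprK; exact: is_derive_sin.
by move=> x; apply: is_derive_eq; rewrite opprK.
Qed.

Lemma inv_trans_decay A h : band_limited A h ->
  (forall m t, derivable (derive1n m (fcos h)) t 1) ->
  (forall m t, derivable (derive1n m (fun t => - fsin h t)) t 1) ->
  exists2 K, 0 <= K & forall y, `|inv_trans h y| <= K / (1 + y ^+ 2).
Proof.
move=> bh dc ds; have [_ band] := bh.
have [K1 K10 h1] := smooth_trans_decay dc (summable_fcos bh) (fun t tA => (band t tA).1).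
have sN : summable_fun mu (fun t => - fsin h t).
  by under [X in EFin \o X]eq_fun do rewrite -mulN1r; exact/summableZ/(summable_fsin bh).
have NA t : A < `|t| -> - fsin h t = 0 by move=> /band[_ ->]; rewrite oppr0.
have [K2 K20 h2] := smooth_trans_decay ds sN NA.
exists ((2 * pi)^-1 * (K1 + K2)).
  by rewrite mulr_ge0 ?addr_ge0 ?invr_ge0 ?mulr_ge0 ?pi_ge0.
move=> y; have y0 : 0 < 1 + y ^+ 2 by rewrite ltr_pwDl ?sqr_ge0.
rewrite ler_pdivlMr// /inv_trans normrM ger0_norm; last first.
  by rewrite invr_ge0 mulr_ge0 ?pi_ge0.
rewrite -mulrA ler_wpM2l//; first by rewrite invr_ge0 mulr_ge0 ?pi_ge0.
have [g1 _] := h1 y; have [_ g2] := h2 y.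
have ss : summable_fun mu (fun t => fsin h t * sin (t * y)).
  apply: summable_bounded_mul; [exact: summable_fsin bh| |by move=> x; exact: sin_norm].
  exact: measurable_comp_linr measurable_sin.
move: g2; rewrite (_ : \int[mu]_t (- fsin h t * sin (t * y)) =
    - \int[mu]_t (fsin h t * sin (t * y))); last first.
  by rewrite -mulN1r -RintZ//; apply: eq_Rintegral => t _; rewrite mulNr mulN1r.
rewrite normrN => g2.
rewrite RintD//; last first.
  apply: summable_bounded_mul; [exact: summable_fcos bh| |by move=> x; exact: cos_norm].
  exact: measurable_comp_linr measurable_cos.
rewrite (le_trans (ler_wpM2r (ltW y0) (ler_normD _ _)))// mulrDl.
exact: lerD.
Qed.

(** By the mean value theorem the increment is 1 / (1 + c^2) with |c - u| <=
    1/2, and then 1 + c^2 <= 2 (1 + u^2). *)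
Lemma cauchy_le_atan u : (1 + u ^+ 2)^-1 <= 2 * (atan (u + 2^-1) - atan (u - 2^-1)) :> R.
Proof.
have uu : u - 2^-1 < u + 2^-1 by rewrite ltrD2l gtrN.
have [c] := @MVT R (@atan R) (fun x => (1 + x ^+ 2)^-1) _ _ uu
  (fun x _ => is_derive1_atan x) (continuous_subspaceT (@continuous_atan R)).
rewrite in_itv /= => /andP[c1 c2] ->.
have -> : u + 2^-1 - (u - 2^-1) = 1 by field.
rewrite mulr1 -[2]invrK -invfM lef_pV2 ?posrE ?mulr_gt0 ?invr_gt0 ?ltr_pwDl ?sqr_ge0//.
have := sqr_ge0 (2 * u - c); have hc : `|c - u| <= 2^-1 by rewrite ler_norml; lra.
have : (c - u) ^+ 2 <= 4^-1.
  have -> : 4^-1 = 2^-1 ^+ 2 :> R by field.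
  by rewrite -[_ ^+ 2]real_normK ?num_real// lerXn2r ?nnegrE.
by move=> h1 h2; nra.
Qed.

(** The arctangent increments of cauchy_le_atan telescope over consecutive
    integers. *)
Lemma cauchy_sum x N : \sum_(k <- ints N) (1 + (x - k%:~R) ^+ 2)^-1 <= 2 * pi :> R.
Proof.
pose v i : R := x + N%:R - i%:R + 2^-1.
rewrite /ints big_map -[iota _ _]/(index_iota 0 N.*2.+1).
apply: (@le_trans _ _ (\sum_(0 <= i < N.*2.+1) (2 * atan (v i) - 2 * atan (v i.+1)))).
  apply: ler_sum => i _; rewrite -mulrBr.
  have -> : x - (i%:Z - N%:Z)%:~R = x + N%:R - i%:R.
    by rewrite intrB -!pmulrn; ring.
  have := cauchy_le_atan (x + N%:R - i%:R).
  rewrite (_ : x + N%:R - i%:R - 2^-1 = v i.+1)//.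
  by rewrite /v -natr1; field.
under eq_bigr do rewrite -opprB.
rewrite sumrN telescope_sumr// opprB.
have := atan_ltpi2 (v 0%N); have := atan_gtNpi2 (v N.*2.+1).
by move: (atan _) (atan _) => p q; lra.
Qed.

Lemma ae_affine r b (P : R -> Prop) : 0 < r -> {ae mu, forall x, P x} ->
  {ae mu, forall x, P (r * x + b)}.
Proof.
move=> r0 [N [mN N0 PN]].
exists ((fun x : measurableTypeR R => r * x + b : measurableTypeR R) @^-1` N); split.
- have := measurable_affine r b measurableT mN; rewrite setTI; exact.
- have := lebesgue_affine b r0 mN; rewrite N0 => /esym/eqP.
  rewrite mule_eq0 => /orP[|/eqP//].
  by rewrite eqe gt_eqF.
- by move=> x /= hx; apply: PN.
Qed.

(** The decay holds almost everywhere, hence almost everywhere simultaneously at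
    all the countably many points r x - k. *)
Lemma decay_periodization h r K : 0 < r ->
  {ae mu, forall x, `|h x| <= K / (1 + x ^+ 2)} ->
  {ae mu, forall x, forall N, \sum_(k <- ints N) `|h (r * x - k%:~R)| <= K * (2 * pi)}.
Proof.
move=> r0 hK.
have h1 : forall n : nat, {ae mu, forall x,
    (forall k : int, absz k = n -> `|h (r * x - k%:~R)| <= K / (1 + (r * x - k%:~R) ^+ 2))}.
  move=> n; have hp := ae_affine (- (n%:Z)%:~R) r0 hK; have hm := ae_affine (- (- n%:Z)%:~R) r0 hK.
  apply: ae_imply (ae_and hp hm) _ => x [hx1 hx2] k kn.
  by have [->|->] : k = n%:Z \/ k = - n%:Z by lia.
have h2 := ae_foralln h1; apply: ae_imply h2 _ => x hx N.
have K0 : 0 <= K.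
  have := hx 0%N 0 erefl; rewrite subr0 => h0.
  have := le_trans (normr_ge0 _) h0.
  by rewrite pmulr_lge0// invr_gt0 ltr_pwDl ?sqr_ge0.
rewrite (le_trans _ (ler_wpM2l K0 (cauchy_sum (r * x) N)))// mulr_sumr.
by apply: ler_sum => k _; exact: hx.
Qed.

(** An affine substitution multiplies the complex transform by a phase and a
    constant, so it preserves zeros; the addition formulas show this on the two
    real components. *)
Lemma trans_shift q r b t : 0 < r -> summable_fun mu q ->
  fcos q (t / r) = 0 -> fsin q (t / r) = 0 ->
  fcos (fun x => q (r * x + b)) t = 0 /\ fsin (fun x => q (r * x + b)) t = 0.
Proof.
move=> r0 sq c0 s0; have mq := summable_measurable sq.
have tE x : t * x = t / r * (r * x + b) - t / r * b.
  by field; rewrite gt_eqF.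
have scc := summableZ (cos (t / r * b)) (summable_mul_cos (t / r) sq).
have sss := summableZ (sin (t / r * b)) (summable_mul_sin (t / r) sq).
have scs := summableZ (cos (t / r * b)) (summable_mul_sin (t / r) sq).
have ssc := summableZ (sin (t / r * b)) (summable_mul_cos (t / r) sq).
pose Q1 u := cos (t / r * b) * (q u * cos (t / r * u)) +
  sin (t / r * b) * (q u * sin (t / r * u)).
pose Q2 u := cos (t / r * b) * (q u * sin (t / r * u)) -
  sin (t / r * b) * (q u * cos (t / r * u)).
have sQ1 : summable_fun mu Q1 by exact: summableD.
have sQ2 : summable_fun mu Q2 by exact: summableB.
split.
  transitivity (\int[mu]_x Q1 (r * x + b)).
    by apply: eq_Rintegral => x _; rewrite /Q1 tE cosB; ring.
  rewrite (Rint_affine b r0 sQ1) RintD// !RintZ; [|exact: summable_mul_sin|exact: summable_mul_cos].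
  by rewrite -/(fcos q _) -/(fsin q _) c0 s0 !mulr0 addr0 mulr0.
transitivity (\int[mu]_x Q2 (r * x + b)).
  by apply: eq_Rintegral => x _; rewrite /Q2 tE sinB; ring.
rewrite (Rint_affine b r0 sQ2) RintB// !RintZ; [|exact: summable_mul_cos|exact: summable_mul_sin].
by rewrite -/(fcos q _) -/(fsin q _) c0 s0 !mulr0 subr0 mulr0.
Qed.

(** Replace h by its inversion formula and exchange the integrals. *)
Lemma parseval A h q : band_limited A h -> summable_fun mu q ->
  \int[mu]_x (h x * q x) =
  (2 * pi)^-1 * \int[mu]_t (fcos h t * fcos q t + fsin h t * fsin q t).
Proof.
move=> bh sq; have mh := summable_measurable bh.1; have mq := summable_measurable sq.
have mInv := measurable_inv_trans bh.
transitivity (\int[mu]_x (inv_trans h x * q x)).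
  apply: Rint_ae; [exact: measurable_funM..|].
  by apply: ae_imply (inversion_ae bh) _ => x ->.
have mc := summable_measurable (summable_fcos bh); have ms := summable_measurable (summable_fsin bh).
pose F (p : RR) := q p.1 * (fcos h p.2 * cos (p.2 * p.1) + fsin h p.2 * sin (p.2 * p.1)).
have mF : measurable_fun setT F.
  apply: measurable_funM; first exact: measurable_fun1.
  have swp (f : R -> R) : measurable_fun setT f ->
      measurable_fun setT (fun p : RR => f (p.2 * p.1)).
    by move=> mf; under eq_fun do rewrite mulrC; exact: measurable_prodcomp.
  apply: measurable_funD; apply: measurable_funM.
  - exact: measurable_fun2 mc.
  - exact: swp measurable_cos.
  - exact: measurable_fun2 ms.
  - exact: swp measurable_sin.
have FF y t : `|F (y, t)| <= `|q y| * (`|fcos h t| + `|fsin h t|).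
  by rewrite /F /= normrM ler_wpM2l// integrand_le.
have sF := summable_marginal1 mF (summable_norm sq) (summable_tmass bh) FF.
transitivity ((2 * pi)^-1 * \int[mu]_x \int[mu]_t F (x, t)).
  rewrite -RintZ//; apply: eq_Rintegral => x _; rewrite /F /= RintZ; last exact: summable_inv_integrand bh.
  by rewrite /inv_trans; ring.
congr (_ * _); rewrite (Rint_fubini mF (summable_norm sq) (summable_tmass bh) FF).
apply: eq_Rintegral => t _; rewrite /F /=.
transitivity (\int[mu]_x (fcos h t * (q x * cos (t * x)) + fsin h t * (q x * sin (t * x)))).
  by apply: eq_Rintegral => x _; ring.
rewrite RintD ?RintZ//; [exact: summable_mul_sin|exact: summable_mul_cos|..].
  exact/summableZ/summable_mul_cos.
exact/summableZ/summable_mul_sin.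
Qed.

(** By Parseval's identity, since at every frequency one of the two transforms
    vanishes. *)
Lemma band_orthogonal A a' h q r b : 0 < r -> band_limited A h -> summable_fun mu q ->
  (forall t, `|t| <= a' -> fcos q t = 0 /\ fsin q t = 0) -> A <= r * a' ->
  \int[mu]_x (h x * q (r * x + b)) = 0.
Proof.
move=> r0 bh sq q0 Ara; rewrite (parseval bh (summable_affine b r0 sq)).
rewrite (_ : (fun t => _) = (fun=> 0)) ?Rint0 ?mulr0//; apply/funext => t.
have [tA|tA] := ltP A `|t|.
  by have [_ band] := bh; have [-> ->] := band _ tA; rewrite !mul0r addr0.
have [c0 s0] : fcos q (t / r) = 0 /\ fsin q (t / r) = 0.
  apply: q0; rewrite normrM [`|r^-1|]gtr0_norm ?invr_gt0// ler_pdivrMr// mulrC.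
  exact: le_trans Ara.
by have [-> ->] := trans_shift b r0 sq c0 s0; rewrite !mulr0 addr0.
Qed.

End Decay.

(** * The bias against test functions *)

Section BiasCore.
Context {R : realType}.
Notation mu := (@lebesgue_measure R).
Implicit Types (f g h q : R -> R) (r a b c d t x y e : R).

Lemma band_orthogonal_dil A a' h q l k c d : 0 < l -> 0 < k ->
  band_limited A h -> L2 h -> summable_fun mu q -> L2 q ->
  (forall t, `|t| <= a' -> fcos q t = 0 /\ fsin q t = 0) -> A * l <= k * a' ->
  \int[mu]_x (h (l * x + c) * q (k * x + d)) = 0.
Proof.
move=> l0 k0 bh Lh sq Lq q0 Alk; have kl0 : 0 < k / l by rewrite divr_gt0.
pose Q u := h u * q (k / l * u + (d - k / l * c)).
have sQ : summable_fun mu Q by apply: (L2_mul_summable Lh); exact: L2_affine.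
transitivity (\int[mu]_x Q (l * x + c)).
  apply: eq_Rintegral => x _; rewrite /Q; congr (_ * q _).
  by field; rewrite gt_eqF.
rewrite (Rint_affine c l0 sQ) (band_orthogonal _ kl0 bh sq q0) ?mulr0//.
by rewrite mulrAC ler_pdivlMr.
Qed.

Lemma powR1E (t : R) : 1 `^ t = 1.
Proof. by rewrite powR1. Qed.

Lemma sqn_proj (I : eqType) (e : I -> R -> R) h s : orthonormal e -> L2 h -> uniq s ->
  sqnorm (proj e h s) <= sqnorm h.
Proof.
move=> oe Lh us; have [Le _] := oe; have Lp := projL2 h s Le.
rewrite {1}/sqnorm inner_proj// (le_trans _ (bessel oe Lh us))//.
rewrite big_seq [leRHS]big_seq; apply: ler_sum => i si.
by rewrite inner_proj_basis// expr2.
Qed.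

(** The terms kept form a tail of a geometric series, whose first term is below
    X. Stated through the condition on the terms, so that no explicit first
    level of the tail has to be computed. *)
Lemma geom_tail (q X : R) (M : nat) : 0 < q -> q < 1 -> 0 < X ->
  \sum_(l < M | q ^+ l < X) q ^+ l <= X / (1 - q).
Proof.
move=> q0 q1 X0; have q1' : 0 < 1 - q by rewrite subr_gt0.
elim: M X X0 => [|M IH] X X0; first by rewrite big_ord0 divr_ge0 ?ltW.
have [X1|X1] := ltP 1 X.
  apply: (@le_trans _ _ (\sum_(l < M.+1) q ^+ l)).
    rewrite [leRHS](bigID (fun l : 'I_M.+1 => q ^+ l < X)) /= lerDl.
    by apply: sumr_ge0 => l _; rewrite exprn_ge0 ?ltW.
  rewrite ler_pdivlMr// mulrC -opprB mulNr -subrX1 opprB.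
  by rewrite lerBlDr (le_trans (ltW X1))// lerDl exprn_ge0 ?ltW.
rewrite big_mkcond big_ord_recl /= expr0 ltNge X1 /= add0r -big_mkcond /=.
have := IH (X / q) (divr_gt0 X0 q0).
under [X in _ -> X <= _]eq_bigl do rewrite /= exprS mulrC -ltr_pdivlMr//.
under [X in _ -> X <= _]eq_bigr do rewrite /= exprS.
rewrite -mulr_sumr => h; rewrite (le_trans (ler_wpM2l (ltW q0) h))//.
rewrite le_eqVlt; apply/orP; left; apply/eqP; field.
by rewrite !gt_eqF.
Qed.

(** The L1 norm of g suffices when the sum of the |u_i| is bounded: this is
    where bounded periodizations enter, and why the estimates are uniform over
    narrow test functions, whose L2 norm explodes. *)
Lemma sum_inner_le (I : Type) (s : seq I) (u : I -> R -> R) g B :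
  (forall i, L2 (u i)) -> L2 g -> summable_fun mu g ->
  {ae mu, forall x, \sum_(i <- s) `|u i x| <= B} ->
  \sum_(i <- s) `|inner2 (u i) g| <= B * \int[mu]_x `|g x|.
Proof.
move=> Lu Lg sg uB.
have sug i : summable_fun mu (fun x => `|u i x * g x|) by exact/summable_norm/L2_mul_summable.
apply: (@le_trans _ _ (\sum_(i <- s) \int[mu]_x `|u i x * g x|)).
  by apply: ler_sum => i _; apply: Rint_norm; exact: L2_mul_summable.
rewrite -Rintsum// -RintZ; last exact: summable_norm.
have sBg := summableZ B (summable_norm sg); have sS := summable_sum s sug.
have S0 x : 0 <= \sum_(i <- s) `|u i x * g x| by apply: sumr_ge0.
rewrite -lee_fin -!Rint_EFin//.
have aeB : {ae mu, forall x, \sum_(i <- s) `|u i x * g x| <= B * `|g x|}.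
  apply: ae_imply uB _ => x hx; under eq_bigr do rewrite normrM.
  by rewrite -mulr_suml ler_wpM2r.
rewrite -[leRHS](_ : (\int[mu]_x `|(B * `|g x|)%:E|)%E = _).
  apply: ae_ge0_le_integral => //.
  - by move=> x _; rewrite lee_fin.
  - exact: measurable_int sS.
  - by apply: measurableT_comp => //; exact: measurable_int sBg.
  - by apply: ae_imply aeB _ => x hx _ /=; rewrite lee_fin (le_trans hx)// ler_norm.
have B0g : {ae mu, forall x, 0 <= B * `|g x|}.
  by apply: ae_imply aeB _ => x; exact: le_trans.
apply: ae_eq_integral => //.
- by apply: measurableT_comp => //; exact: measurable_int sBg.
- exact: measurable_int sBg.
- by apply: ae_imply B0g _ => x hx _ /=; rewrite ger0_norm.
Qed.

Section Core.
Variables (phiM psiM phi psi : R -> R) (A a' BM s L r : R) (f : R -> R).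
Hypotheses (pairM : scaling_wavelet_pair phiM psiM)
  (pairp : scaling_wavelet_pair phi psi).
Hypotheses (A0 : 0 < A) (a0 : 0 < a') (s0 : 0 < s) (L0 : 0 < L) (r0 : 0 < r) (BM0 : 0 <= BM).
Hypotheses (bphiM : band_limited A phiM) (bpsiM : band_limited A psiM).
Hypothesis perphi : {ae mu, forall x, forall N, \sum_(k <- ints N) `|phiM (x - k%:~R)| <= BM}.
Hypothesis perpsi : forall l : nat,
  {ae mu, forall x, forall N, \sum_(k <- ints N) `|psiM (2 ^+ l * x - k%:~R)| <= BM}.
Hypotheses (spsi : summable_fun mu psi) (spsi0 :
  forall t, `|t| <= a' -> fcos psi t = 0 /\ fsin psi t = 0).
Hypotheses (Lf : L2 f).
Hypothesis alphaL : forall k, `|inner2 f (wavelet_family phiM psiM (inl k))| <= L.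
Hypothesis betaL : forall l k, `|inner2 f (wavelet_family phiM psiM (inr (l, k)))| <=
  L * 2 `^ (- (l%:R * (s + 2^-1))).

Let eM := wavelet_family phiM psiM.
Let e' := dilated_family r phi psi.
(* A Meyer function of level l has band 2^l A, and the wavelets psi at scales at least r
   have no frequency below r a'; the two are disjoint when 2^l <= R0. *)
Let R0 := r * a' / A.
Let R00 : 0 < R0. Proof. by rewrite divr_gt0// mulr_gt0. Qed.
Let oM : orthonormal eM.
Proof. by have [V [mra pW]] := pairM; exact: (pair_orthonormal mra pW). Qed.
Let spM g : L2 g -> spanned eM g.
Proof. by have [V [mra pW]] := pairM; exact: (pair_spanned mra pW). Qed.
Let o' : orthonormal e'. Proof. exact: dilated_family_orthonormal. Qed.
Let LphiM : L2 phiM.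
Proof.
have [+ _] := oM; move=> /(_ (inl 0)); congr (L2 _).
by apply/funext => x; rewrite /eM /= subr0.
Qed.
Let LpsiM : L2 psiM.
Proof.
have [+ _] := oM; move=> /(_ (inr (0%N, 0))); congr (L2 _).
by apply/funext => x; rewrite /eM /= mul0r powRr0 expr0 !mul1r subr0.
Qed.
Let Lpsi : L2 psi.
Proof.
have [V [mra pW]] := pairp; have [+ _] := pair_orthonormal mra pW.
move=> /(_ (inr (0%N, 0))); congr (L2 _).
by apply/funext => x; rewrite /= mul0r powRr0 expr0 !mul1r subr0.
Qed.

Let low (i : int + nat * int) := match i with
  | inl _ => 1 <= R0 | inr (l, _) => 2 ^+ l <= R0 end.

Let low_orth i l k : low i -> inner2 (eM i) (e' (inr (l, k))) = 0.
Proof.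
have p2 := pow2_gt0 l (R := R).
have r1 : r * a' <= 2 ^+ l * r * a'.
  by rewrite -mulrA ler_peMl ?exprn_ege1 ?ler1n// ltW// mulr_gt0.
case: i => [m|[n m]] /= lo.
  transitivity (\int[mu]_x (Num.sqrt r * 2 `^ (l%:R / 2) *
     (phiM (1 * x + - m%:~R) * psi (2 ^+ l * r * x + - k%:~R)))).
    by apply: eq_Rintegral => x _; rewrite /eM /e' /dilated_family /= mul1r mulrA; ring.
  rewrite RintZ; last first.
    apply: L2_mul_summable; first exact: L2_affine.
    by apply: L2_affine => //; rewrite mulr_gt0.
  rewrite (band_orthogonal_dil _ _ _ _ bphiM LphiM spsi Lpsi spsi0) ?mulr0 ?mulr_gt0//.
  by rewrite mulr1 (le_trans _ r1)//; move: lo; rewrite ler_pdivlMr// mul1r.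
have pn := pow2_gt0 n (R := R).
transitivity (\int[mu]_x (Num.sqrt r * 2 `^ (l%:R / 2) * 2 `^ (n%:R / 2) *
   (psiM (2 ^+ n * x + - m%:~R) * psi (2 ^+ l * r * x + - k%:~R)))).
  by apply: eq_Rintegral => x _; rewrite /eM /e' /dilated_family /= mulrA; ring.
rewrite RintZ; last first.
  apply: L2_mul_summable; first exact: L2_affine.
  by apply: L2_affine => //; rewrite mulr_gt0.
rewrite (band_orthogonal_dil _ _ _ _ bpsiM LpsiM spsi Lpsi spsi0) ?mulr0 ?mulr_gt0//.
by rewrite (le_trans _ r1)//; move: lo; rewrite ler_pdivlMr// mulrC.
Qed.

Let high_sum M rho : L2 rho -> summable_fun mu rho ->
  \sum_(i <- boxes M | ~~ low i) `|inner2 f (eM i)| * `|inner2 (eM i) rho| <=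
  L * R0 `^ (- s) * (1 + (1 - 2 `^ (- s))^-1) * BM * \int[mu]_x `|rho x|.
Proof.
have [LM _] := oM.
move=> Lr sr; set I1 := \int[mu]_x _.
have I10 : 0 <= I1 by apply: Rintegral_ge0.
rewrite /boxes big_cat.
have X0 : 0 < R0 `^ (- s) by rewrite powR_gt0.
have -> : L * R0 `^ (- s) * (1 + (1 - 2 `^ (- s))^-1) * BM * I1 =
  L * R0 `^ (- s) * (BM * I1) + L * (R0 `^ (- s) / (1 - 2 `^ (- s))) * (BM * I1) by ring.
have BI : 0 <= BM * I1 by rewrite mulr_ge0.
apply: lerD.
  rewrite big_map big_mkcond.
  have [R1|R1] := leP 1 R0.
    rewrite big1 => [|k _]; last by rewrite /= R1.
    by rewrite mulr_ge0// mulr_ge0 ?(ltW L0) ?ltW.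
  (* When R0 < 1 the scaling coefficients count as high; they are then paid by R0^(- s) >= 1. *)
  have X1 : 1 <= R0 `^ (- s).
    rewrite powRN invf_ge1 ?powR_gt0//.
    by rewrite -[leRHS](powR1E s) ge0_ler_powR ?nnegrE ?(ltW s0) ?(ltW R1) ?(ltW R00).
  apply: (@le_trans _ _ (\sum_(k <- ints M) L * `|inner2 (eM (inl k)) rho|)).
    by apply: ler_sum => k _; rewrite /= (lt_geF R1) /= ler_wpM2r.
  rewrite -mulr_sumr -mulrA ler_wpM2l ?(ltW L0)//.
  apply: (@le_trans _ _ (BM * I1)); last by rewrite ler_peMl.
  apply: (sum_inner_le (u := fun k => eM (inl k))) => //.
  by apply: ae_imply perphi _ => x; exact.
rewrite big_mkcond big_allpairs_dep.
pose q := 2 `^ (- s) : R.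
have q0 : 0 < q by rewrite powR_gt0.
have q1 : q < 1.
  by rewrite /q powRN invf_lt1 ?powR_gt0// -[ltLHS](powR1E s) gt0_ltr_powR ?nnegrE// ltr1n.
have qX l : ~~ (2 ^+ l <= R0) -> q ^+ l < R0 `^ (- s).
  rewrite -ltNge => h; rewrite /q -powR_mulrn ?powR_ge0// -powRrM mulrC powRrM powR_mulrn//.
  rewrite !powRN ltf_pV2 ?posrE ?powR_gt0 ?exprn_gt0//.
  by rewrite gt0_ltr_powR ?nnegrE ?(ltW R00)// exprn_ge0.
apply: (@le_trans _ _ (\sum_(0 <= l < M) (if q ^+ l < R0 `^ (- s) then L * (q ^+ l * (BM * I1)) else 0))).
  rewrite /index_iota subn0; apply: ler_sum => l _.
  case: (boolP (2 ^+ l <= R0)) => [lo|hi].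
    rewrite big1 => [|k _]; last by rewrite /= lo.
    case: ifP => // _; by rewrite mulr_ge0 ?(ltW L0)// mulr_ge0// exprn_ge0 ?ltW.
  rewrite (qX _ hi).
  apply: (@le_trans _ _ (\sum_(k <- ints M) (L * 2 `^ (- (l%:R * (s + 2^-1)))) *
      `|inner2 (eM (inr (l, k))) rho|)).
    by apply: ler_sum => k _; rewrite /= hi ler_wpM2r.
  rewrite -mulr_sumr -mulrA ler_wpM2l ?(ltW L0)//.
  have h := sum_inner_le (s := ints M) (u := fun k => eM (inr (l, k)))
    (B := 2 `^ (l%:R / 2) * BM) (fun k => LM _) Lr sr.
  apply: (le_trans (ler_wpM2l (powR_ge0 _ _) (h _))).
    apply: ae_imply (perpsi l) _ => x /(_ M) hx; rewrite /eM /=.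
    under eq_bigr do rewrite normrM ger0_norm ?powR_ge0//.
    by rewrite -mulr_sumr ler_wpM2l ?powR_ge0.
  rewrite -/I1 -!mulrA !mulrA -powRD; last by rewrite pnatr_eq0 implybT.
  rewrite -mulrA -[leRHS]mulrA ler_wpM2r//.
  rewrite (_ : - (l%:R * (s + 2^-1)) + l%:R / 2 = - s * l%:R); last by ring.
  by rewrite powRrM powR_mulrn ?powR_ge0.
rewrite big_mkord -big_mkcond /= -mulr_sumr -mulr_suml -mulrA.
rewrite ler_wpM2l ?(ltW L0)// ler_wpM2r//.
exact: geom_tail.
Qed.

(** Let rho be the residual of eta after projection on the translates of phi at
    scale r. In the Meyer expansion of f, the low levels give almost nothing,
    because rho is close in L2 to a combination of the wavelets psi at scales at
    least r, to which they are orthogonal; the high levels are bounded by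
    high_sum. The error terms del / 2 come from truncating the two expansions. *)
Lemma bias_core eta : L2 eta -> summable_fun mu eta ->
  forall I1, (forall N, \int[mu]_x `|eta x - proj e' eta [seq inl k | k <- ints N] x| <= I1) ->
  (forall N, summable_fun mu (proj e' eta [seq inl k | k <- ints N])) ->
  forall del, 0 < del -> exists N0, forall N, (N0 <= N)%N ->
  `|inner2 f (fun x => eta x - proj e' eta [seq inl k | k <- ints N] x)| <=
  L * R0 `^ (- s) * (1 + (1 - 2 `^ (- s))^-1) * BM * I1 + del.
Proof.
move=> Le se I1 hI1 sth del del0; have [LM _] := oM; have [L' _] := o'.
pose sf := Num.sqrt (sqnorm f) + 1.
have sf0 : 0 < sf by rewrite ltr_wpDl ?sqrtr_ge0.
pose d1 := del / 2 / sf; have d10 : 0 < d1 by rewrite !divr_gt0.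
have sp' := dilated_family_spanned r0 pairp Le.
have [N0 hN0] := box_approx o' Le sp' uniq_boxes boxes_exhaust (exprn_gt0 2 d10).
exists N0 => N /hN0 hN.
set th := proj e' eta _; pose rho x := eta x - th x.
have Lth : L2 th by exact: projL2.
have Lr : L2 rho by exact: L2B.
have sr : summable_fun mu rho by apply: summableB => //; exact: sth.
pose sr1 := Num.sqrt (sqnorm rho) + 1.
have sr0 : 0 < sr1 by rewrite ltr_wpDl ?sqrtr_ge0.
pose d2 := del / 2 / sr1; have d20 : 0 < d2 by rewrite !divr_gt0.
have [M0 hM0] := box_approx oM Lf (spM Lf) uniq_boxes boxes_exhaust (exprn_gt0 2 d20).
have hM := hM0 _ (leqnn _); set fM := proj eM f (boxes M0) in hM.
have LfM : L2 fM by exact: projL2.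
have sqn_lt u d : 0 < d -> sqnorm u < d ^+ 2 -> Num.sqrt (sqnorm u) <= d.
  move=> d0 h; rewrite -[leRHS]gtr0_norm// -sqrtr_sqr ler_sqrt ?ltW//.
  by rewrite exprn_gt0.
pose ps := [seq inr (l, k) | l <- iota 0 N, k <- ints N] : seq (int + nat * int).
pose psp := proj e' eta ps; have Lpsp : L2 psp by exact: projL2.
have hN' : sqnorm (fun x => rho x - psp x) < d1 ^+ 2.
  rewrite (_ : (fun x => _) = (fun x => eta x - proj e' eta (boxes N) x))//.
  apply/funext => x; rewrite /rho /psp /th /proj /lin_comb /boxes map_cat big_cat /=.
  by rewrite opprD addrA.
have -> : inner2 f (fun x => eta x - th x) =
    inner2 (fun x => f x - fM x) rho + inner2 fM rho.
  by rewrite innerBl// subrK.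
have h1 : `|inner2 (fun x => f x - fM x) rho| <= del / 2.
  rewrite (le_trans (inner_norm (L2B Lf LfM) Lr))//.
  rewrite -(divfK (lt0r_neq0 sr0) (del / 2)) ler_pM ?sqrtr_ge0//.
    exact: sqn_lt.
  by rewrite /sr1 lerDl.
(* The low-frequency part of the truncated Meyer expansion of f. *)
pose g := proj eM f [seq i <- boxes M0 | low i].
have Lg : L2 g by exact: projL2.
have us : uniq [seq i <- boxes M0 | low i] by rewrite filter_uniq// uniq_boxes.
have h2 : `|inner2 g rho| <= del / 2.
  have -> : inner2 g rho = inner2 g (fun x => rho x - psp x).
    rewrite innerBr// [inner2 g psp](_ : _ = 0) ?subr0//.
    rewrite innerC inner_proj//; apply: big1_seq => i /andP[_].
    rewrite mem_filter => /andP[lo _].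
    rewrite [inner2 psp _]innerC /psp inner_proj// big1_seq ?mulr0// => j /andP[_ /allpairsP[[l k] [_ _ ->]]].
    by rewrite low_orth// mulr0.
  rewrite (le_trans (inner_norm Lg (L2B Lr Lpsp)))//.
  rewrite mulrC -(divfK (lt0r_neq0 sf0) (del / 2)) ler_pM ?sqrtr_ge0//.
    exact: sqn_lt.
  rewrite (@le_trans _ _ (Num.sqrt (sqnorm f)))// ?lerDl//.
  by rewrite ler_sqrt ?sqn_ge0// sqn_proj.
have h3 : `|inner2 fM rho - inner2 g rho| <=
    L * R0 `^ (- s) * (1 + (1 - 2 `^ (- s))^-1) * BM * I1.
  rewrite [inner2 fM _]innerC [inner2 g _]innerC !inner_proj//.
  rewrite big_filter (bigID low) addrAC subrr add0r.
  apply: (le_trans (ler_norm_sum _ _ _)).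
  under eq_bigr do rewrite normrM [inner2 rho _]innerC.
  apply: (le_trans (high_sum _ Lr sr)).
  apply: ler_wpM2l; last exact: hI1.
  rewrite mulr_ge0// mulr_ge0//; first by rewrite mulr_ge0 ?powR_ge0 ?ltW.
  rewrite addr_ge0// invr_ge0 subr_ge0 powRN invf_le1 ?powR_gt0//.
  by rewrite -[leLHS](powR1E s) ge0_ler_powR ?nnegrE ?(ltW s0)// ler1n.
have -> : inner2 fM rho = (inner2 fM rho - inner2 g rho) + inner2 g rho by rewrite subrK.
rewrite addrCA (le_trans (ler_normD _ _))// lerD//.
rewrite (le_trans (ler_normD _ _))// [leRHS]splitr lerD//.
Qed.

End Core.

End BiasCore.

(** * Series over the integers *)

Section Sums.
Context {R : realType}.
Notation mu := (@lebesgue_measure R).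
Implicit Types (f g h phi psi : R -> R) (u v : int -> R).

Definition psum u N : R := \sum_(k <- ints N) u k.

Lemma perm_intsD N k : perm_eq (ints (N + k))
  (ints N ++ [seq j <- ints (N + k) | (N < absz j)%N]).
Proof.
apply: uniq_perm; first exact: uniq_ints.
  rewrite cat_uniq uniq_ints filter_uniq ?uniq_ints// andbT andTb.
  by apply/hasPn => j; rewrite mem_filter !mem_ints -ltnNge => /andP[].
move=> j; rewrite mem_cat mem_filter !mem_ints.
by case: (leqP (absz j) N) => //= jN; rewrite (leq_trans jN) ?leq_addr.
Qed.

Lemma psumD u N k : psum u (N + k) =
  psum u N + \sum_(j <- ints (N + k) | (N < absz j)%N) u j.
Proof. by rewrite /psum (perm_big _ (perm_intsD N k)) big_cat big_filter. Qed.

(** The increasing sequence of partial sums of |u| is within e of its supremum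
    from some index on. *)
Lemma psum_tail u B : (forall N, psum (fun k => `|u k|) N <= B) ->
  forall e, 0 < e -> exists N, forall k,
    \sum_(j <- ints (N + k) | (N < absz j)%N) `|u j| < e.
Proof.
move=> uB e e0; pose P := psum (fun k => `|u k|).
have hs : has_sup (range P) by split; [exists (P 0%N), 0%N|exists B => _ [n _ <-]].
have [_ [N _ <-] hN] := sup_adherent e0 hs.
exists N => k; move: hN; rewrite ltrBlDr => hN.
have : P (N + k)%N <= sup (range P) by apply: ub_le_sup; [case: hs|exists (N + k)%N].
by rewrite /P psumD => /le_lt_trans/(_ hN); rewrite ltrD2l.
Qed.

Lemma psum_term u B : (forall N, psum (fun k => `|u k|) N <= B) -> forall k, `|u k| <= B.
Proof.
move=> uB k; apply: le_trans (uB (absz k)); rewrite /psum (bigD1_seq k)/=.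
- by rewrite lerDl sumr_ge0.
- by rewrite mem_ints.
- exact: uniq_ints.
Qed.

Lemma psum_null u B : (forall N, psum (fun k => `|u k|) N <= B) ->
  forall e, 0 < e -> exists N, forall k, (N < absz k)%N -> `|u k| < e.
Proof.
move=> uB e e0; have [N hN] := psum_tail uB e0; exists N => k Nk.
apply: le_lt_trans (hN (absz k - N)%N); rewrite subnKC ?(ltnW Nk)//.
rewrite big_mkcond (bigD1_seq k) ?uniq_ints ?mem_ints//= Nk lerDl.
by apply: sumr_ge0 => j _; case: ifP.
Qed.

Lemma zsumE u : zsum u = limn (psum u).
Proof.
rewrite /zsum; congr (lim (_ @ \oo)); apply/funext => N.
by rewrite /psum big_map -[iota _ _]/(index_iota 0 N.*2.+1) big_mkord.
Qed.

Lemma psum_diff u c B M N k : (forall N, psum (fun k => `|c k|) N <= B) ->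
  (forall j, (N < absz j)%N -> `|u j| <= M) ->
  `|psum (fun j => c j * u j) (N + k) - psum (fun j => c j * u j) N| <=
  \sum_(j <- ints (N + k) | (N < absz j)%N) `|c j| * M.
Proof.
move=> cB uM; rewrite psumD addrAC subrr add0r.
apply: (le_trans (ler_norm_sum _ _ _)); apply: ler_sum => j Nj.
by rewrite normrM ler_wpM2l// uM.
Qed.

(** Absolute convergence of the sum of the c_k dominates all tails. *)
Lemma cvg_psum c u B M : (forall N, psum (fun k => `|c k|) N <= B) ->
  (forall j, `|u j| <= M) -> cvgn (psum (fun k => c k * u k)).
Proof.
move=> cB uM; have M0 : 0 <= M by rewrite (le_trans (normr_ge0 _) (uM 0)).
apply: cauchy_cvg; apply: cauchy_exP => e e0.
have M1 : 0 < M + 1 by rewrite ltr_wpDl.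
have [N hN] := psum_tail cB (divr_gt0 e0 M1).
exists (psum (fun k => c k * u k) N); exists N => // n /= Nn.
rewrite /ball /= distrC -(subnKC Nn).
apply: (le_lt_trans (psum_diff _ cB (fun j _ => uM j))).
rewrite -mulr_suml (le_lt_trans (ler_wpM2l _ (_ : M <= M + 1)))//.
- by apply: sumr_ge0.
- by rewrite lerDl.
- by rewrite -ltr_pdivlMr// hN.
Qed.

(** Bounds the tail by the supremum M' of the far coefficients. It is thus
    uniform over families c with a common bound B, here c_k = phi(r x - k) for
    all x at once. *)
Lemma zsum_tail c u B M N : (forall N, psum (fun k => `|c k|) N <= B) ->
  (forall j, `|u j| <= M) -> forall M', (forall j, (N < absz j)%N -> `|u j| <= M') ->
  `|zsum (fun k => c k * u k) - psum (fun k => c k * u k) N| <= B * M'.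
Proof.
move=> cB uM M' uM'; rewrite zsumE; have cv := cvg_psum cB uM.
have M'0 : 0 <= M' by apply: le_trans (normr_ge0 _) (uM' N.+1%:Z _).
have : (fun n => `|psum (fun k => c k * u k) n - psum (fun k => c k * u k) N|) @ \oo -->
    `|limn (psum (fun k => c k * u k)) - psum (fun k => c k * u k) N|.
  by apply: cvg_norm; apply: cvgB; [exact: cv|exact: cvg_cst].
move=> h; rewrite -(cvg_lim (@Rhausdorff R) h); apply: limr_le.
  by apply/cvg_ex; eexists; exact: h.
exists N => // n /= Nn; rewrite -(subnKC Nn).
apply: (le_trans (psum_diff _ cB uM')); rewrite -mulr_suml ler_wpM2r//.
by rewrite (le_trans _ (cB (N + (n - N))%N))// psumD lerDr sumr_ge0.
Qed.

Lemma zsum_le c u B M : (forall N, psum (fun k => `|c k|) N <= B) ->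
  (forall j, `|u j| <= M) -> `|zsum (fun k => c k * u k)| <= B * M.
Proof.
move=> cB uM; rewrite zsumE; have cv := cvg_psum cB uM.
have M0 : 0 <= M by apply: le_trans (normr_ge0 _) (uM 0).
have h : (fun n => `|psum (fun k => c k * u k) n|) @ \oo -->
    `|limn (psum (fun k => c k * u k))| by exact: cvg_norm.
 rewrite -(cvg_lim (@Rhausdorff R) h); apply: limr_le.
  by apply/cvg_ex; eexists; exact: h.
apply: nearW => n; rewrite /psum (le_trans (ler_norm_sum _ _ _))//.
rewrite (le_trans _ (ler_wpM2r M0 (cB n)))// mulr_suml.
by apply: ler_sum => j _; rewrite normrM ler_wpM2l.
Qed.

Lemma zsum_lin (I : Type) (s : seq I) (a : I -> R) c (u : I -> int -> R) (v : int -> R) B M :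
  (forall N, psum (fun k => `|c k|) N <= B) ->
  (forall i j, `|u i j| <= M) -> (forall j, `|v j| <= M) ->
  \sum_(i <- s) a i * zsum (fun k => c k * u i k) - zsum (fun k => c k * v k) =
  zsum (fun k => c k * (\sum_(i <- s) a i * u i k - v k)).
Proof.
move=> cB uM vM; apply/esym; rewrite zsumE; apply: cvg_lim => //.
rewrite (_ : psum _ = fun n => \sum_(i <- s) a i * psum (fun k => c k * u i k) n -
    psum (fun k => c k * v k) n); last first.
  apply/funext => n; rewrite /psum.
  under [X in _ = X - _]eq_bigr do rewrite mulr_sumr.
  rewrite exchange_big /= -sumrB; apply: eq_bigr => k _.
  by rewrite mulrBr mulr_sumr; congr (_ - _); apply: eq_bigr => i _; rewrite mulrCA.
apply: cvgB; last by rewrite zsumE; exact: cvg_psum cB vM.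
apply: cvg_big => // [|i _].
  exact: add_continuous.
apply: cvgM; first exact: cvg_cst.
by rewrite zsumE; exact: cvg_psum cB (uM i).
Qed.

Lemma periodization_bound phi : bounded_periodization phi ->
  exists2 B, 0 <= B & forall x N, psum (fun k => `|phi (x - k%:~R)|) N <= B.
Proof.
rewrite /bounded_periodization; set S := ereal_sup _ => Soo.
have le1 x N : ((psum (fun k => `|phi (x - k%:~R)|) N)%:E <= S)%E.
  apply: (@le_trans _ _ (\esum_(k in [set: int]) (`|phi (x - k%:~R)|)%:E)); last first.
    by apply: ereal_sup_ubound; exists x.
  apply: esum_ge; exists [set` ints N]; first by split; [exact: finite_seq|].
  by rewrite -fsbig_seq ?uniq_ints// sumEFin.
have S0 : (0 <= S)%E.
  by rewrite (le_trans _ (le1 0 0%N))// lee_fin sumr_ge0.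
have Sf : S \is a fin_num by rewrite ge0_fin_numE.
exists (fine S); first exact: fine_ge0.
by move=> x N; rewrite -lee_fin fineK//; exact: le1.
Qed.

End Sums.

(** * The pointwise bias *)

Section Bias.
Context {R : realType}.
Notation mu := (@lebesgue_measure R).
Implicit Types (f g h phi psi : R -> R) (r x y : R).

(** The coefficient of f on phi(r . - k), without the factor making that
    function of norm 1; the square of this factor is the r in front of wproj. *)
Definition wcoef phi r f k : R := \int[mu]_y (phi (r * y - k%:~R) * f y).

Definition wproj phi r f x : R :=
  r * zsum (fun k => phi (r * x - k%:~R) * wcoef phi r f k).

Section Kernel.
Variables (phi : R -> R) (B r : R).
Hypotheses (cphi : continuous phi) (sphi : summable_fun mu phi) (r0 : 0 < r).
Hypothesis perB : forall x N, psum (fun k => `|phi (x - k%:~R)|) N <= B.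

Let B0 : 0 <= B.
Proof. by apply: le_trans (perB 0 0%N); apply: sumr_ge0. Qed.

Lemma per_bounded x : `|phi x| <= B.
Proof. by have := psum_term (perB x) 0; rewrite subr0. Qed.

Let mphik k : measurable_fun setT (fun y => phi (r * y - k%:~R)).
Proof.
exact: (measurableT_comp (measurable_cont cphi) (measurable_affine r (- k%:~R))).
Qed.

Lemma summable_atom_mul f k : summable_fun mu f ->
  summable_fun mu (fun y => phi (r * y - k%:~R) * f y).
Proof.
move=> sf; apply: (summable_le _ (summableZ B (summable_norm sf))).
  by apply: measurable_funM; [exact: mphik|exact: summable_measurable sf].
by move=> y; rewrite normrM ler_wpM2r// per_bounded.
Qed.

Lemma wcoef_le f k : summable_fun mu f -> `|wcoef phi r f k| <= B * \int[mu]_y `|f y|.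
Proof.
move=> sf; rewrite -RintZ; last exact: summable_norm.
apply: Rint_norm_le; [exact: summable_atom_mul|exact/summableZ/summable_norm|].
by move=> y; rewrite normrM ler_wpM2r// per_bounded.
Qed.

(** Dominated convergence: for fixed y the terms phi(r y - k) tend to 0 as |k|
    grows, since they are summable over k. *)
Lemma wcoef_null f e : summable_fun mu f -> 0 < e ->
  exists N, forall k, (N < absz k)%N -> `|wcoef phi r f k| < e.
Proof.
move=> sf e0; have mf := summable_measurable sf.
have lim (sg : nat -> int) : (forall n, absz (sg n) = n) ->
    (fun n => wcoef phi r f (sg n)) @ \oo --> (0 : R).
  move=> sgn; rewrite -[X in _ --> X](Rint0 mu).
  apply: (@Rint_dct _ _ _ mu _ _ (fun y => B * `|f y|)).
  - by move=> n; apply: measurable_funM => //; exact: mphik.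
  - by [].
  - apply: aeW => y; rewrite -[X in _ --> X](mul0r (f y)); apply: cvgMl.
    apply/cvgrPdist_lt => d d0; have [N hN] := psum_null (perB (r * y)) d0.
    by exists N.+1 => // n /= Nn; rewrite sub0r normrN hN// sgn.
  - exact/summableZ/summable_norm.
  - by move=> n y; rewrite normrM ler_wpM2r// per_bounded.
have := lim Posz (fun n => erefl); move/cvgr0_norm_lt => /(_ _ e0) [N1 _ h1].
have := lim (fun n => - n%:Z) (fun n => abszN n); move/cvgr0_norm_lt => /(_ _ e0) [N2 _ h2].
exists (maxn N1 N2) => k; rewrite gtn_max => /andP[k1 k2].
have [kE|kE] : k = (absz k)%:Z \/ k = - (absz k)%:Z by lia.
  by rewrite kE; apply: h1 => /=; exact: ltnW.
by rewrite kE; apply: h2 => /=; exact: ltnW.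
Qed.

Definition wpart f N x : R :=
  r * psum (fun k => phi (r * x - k%:~R) * wcoef phi r f k) N.

Lemma wpart_unif f d : summable_fun mu f -> 0 < d -> exists N0, forall N, (N0 <= N)%N ->
  forall x, `|wproj phi r f x - wpart f N x| <= d.
Proof.
move=> sf d0; have rB0 : 0 < r * (B + 1) by rewrite mulr_gt0// ltr_wpDl.
have [N0 hN0] := wcoef_null sf (divr_gt0 d0 rB0); exists N0 => N NN x.
rewrite /wproj /wpart -mulrBr normrM gtr0_norm//.
have := zsum_tail (N := N) (perB (r * x)) (fun k => wcoef_le k sf)
  (M' := d / (r * (B + 1))) _.
move=> h; apply: (le_trans (ler_wpM2l (ltW r0) (h _))).
  by move=> j Nj; rewrite ltW// hN0// (leq_ltn_trans NN).
have -> : r * (B * (d / (r * (B + 1)))) = d * (B / (B + 1)).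
  by field; rewrite !gt_eqF// ltr_wpDl.
by rewrite ler_piMr ?(ltW d0)// ler_pdivrMr ?ltr_wpDl// mul1r lerDl.
Qed.

Lemma wpart_cont f N : continuous (wpart f N).
Proof.
move=> x; apply: cvgM; first exact: cvg_cst.
apply: cvg_big => [|k _]; first exact: add_continuous.
apply: cvgM; last exact: cvg_cst.
apply: (@continuous_comp _ _ _ (fun x => r * x - k%:~R) phi); last exact: cphi.
by apply: cvgB; [apply: cvgM; [exact: cvg_cst|exact: cvg_id]|exact: cvg_cst].
Qed.

(** The partial sums are continuous and converge uniformly: zsum_tail is uniform
    in x once the coefficients tend to 0. *)
Lemma wproj_cont f : summable_fun mu f -> continuous (wproj phi r f).
Proof.
move=> sf x; apply/cvgrPdist_lt => e e0.
have e3 : 0 < e / 4 by rewrite divr_gt0.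
have [N hN] := wpart_unif sf e3.
have /cvgrPdist_lt/(_ _ e3) := @wpart_cont f N x.
apply: filterS => y hy.
have h1 := hN N (leqnn N) x; have h2 := hN N (leqnn N) y.
have -> : wproj phi r f x - wproj phi r f y =
  (wproj phi r f x - wpart f N x) + (wpart f N x - wpart f N y) -
  (wproj phi r f y - wpart f N y) by ring.
rewrite (le_lt_trans (ler_normB _ _))//.
rewrite (@le_lt_trans _ _ (e / 4 + e / 4 + e / 4))//; last by lra.
by rewrite lerD// (le_trans (ler_normD _ _))// lerD// ltW.
Qed.

End Kernel.

Section Pointwise.
Variables (phi psi phiM psiM : R -> R) (B A a' BM s L r : R) (f : R -> R).
Hypotheses (pairM : scaling_wavelet_pair phiM psiM)
  (pairp : scaling_wavelet_pair phi psi).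
Hypotheses (cphi : continuous phi) (sphi : summable_fun mu phi).
Hypothesis perB : forall x N, psum (fun k => `|phi (x - k%:~R)|) N <= B.
Hypotheses (A0 : 0 < A) (a0 : 0 < a') (s0 : 0 < s) (L0 : 0 < L) (r0 : 0 < r) (BM0 : 0 <= BM).
Hypotheses (bphiM : band_limited A phiM) (bpsiM : band_limited A psiM).
Hypothesis perphi : {ae mu, forall x, forall N, \sum_(k <- ints N) `|phiM (x - k%:~R)| <= BM}.
Hypothesis perpsi : forall l : nat,
  {ae mu, forall x, forall N, \sum_(k <- ints N) `|psiM (2 ^+ l * x - k%:~R)| <= BM}.
Hypotheses (spsi : summable_fun mu psi) (spsi0 :
  forall t, `|t| <= a' -> fcos psi t = 0 /\ fsin psi t = 0).
Hypotheses (Lf : L2 f) (sf : summable_fun mu f) (cf : continuous f).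
Hypothesis alphaL : forall k, `|inner2 f (wavelet_family phiM psiM (inl k))| <= L.
Hypothesis betaL : forall l k, `|inner2 f (wavelet_family phiM psiM (inr (l, k)))| <=
  L * 2 `^ (- (l%:R * (s + 2^-1))).

Let e' := dilated_family r phi psi.
Let C := L * (r * a' / A) `^ (- s) * (1 + (1 - 2 `^ (- s))^-1) * BM *
  (1 + B * \int[mu]_x `|phi x|).
Let inls N : seq (int + nat * int) := [seq inl k | k <- ints N].

Let Le' i : L2 (e' i).
Proof. by have [+ _] := dilated_family_orthonormal r0 pairp; exact. Qed.

Let se' k : summable_fun mu (e' (inl k)) /\
  \int[mu]_x `|e' (inl k) x| = Num.sqrt r * (r^-1 * \int[mu]_x `|phi x|).
Proof.
have sk := summable_affine (- k%:~R) r0 sphi; split; first exact: summableZ.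
rewrite -(Rint_affine (- k%:~R) r0 (summable_norm sphi)) -RintZ; last exact: summable_norm.
by apply: eq_Rintegral => x _; rewrite /e' /dilated_family /= normrM ger0_norm ?sqrtr_ge0.
Qed.

(** bias_core applied to the normalized indicator eta of an interval, whose L1
    norm is 1 for every width. The coefficients of eta on the translates of phi
    are summable with sum at most B, so that rho has L1 norm at most 1 + B
    |phi|_1, again for every width. *)
Lemma bias_average (x eps : R) : 0 < eps ->
  let eta y := (2 * eps)^-1 * \1_(`[x - eps, x + eps]%classic : set R) y in
  forall d, 0 < d -> exists N0, forall N, (N0 <= N)%N ->
  `|\int[mu]_y (eta y * (f y - wpart phi r f N y))| <= C + d.
Proof.
move=> e0 eta d d0.
have e20 : 0 < (2 * eps)^-1 by rewrite invr_gt0 mulr_gt0.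
have seta : summable_fun mu eta by exact/summableZ/summable_indic.
have eta0 y : 0 <= eta y by apply: mulr_ge0 => //; exact: ltW.
have Leta : L2 eta.
  apply/L2P; split; first exact: summable_measurable seta.
  have := summableZ (2 * eps)^-1 seta; congr (integrable _ _ _); apply/funext => y /=.
  congr EFin; rewrite /eta indicE; case: (_ \in _) => /=; ring.
have Ieta : \int[mu]_y eta y = 1.
  rewrite RintZ; last exact: summable_indic.
  have : \int[mu]_y (\1_(`[x - eps, x + eps]%classic : set R) y * 1) = (x + eps) - (x - eps).
    apply: (@ftc_indic _ id) => [|y]; last exact: cvg_cst.
    by rewrite lerBlDr -addrA lerDl addr_ge0 ?ltW.
  under eq_Rintegral do rewrite mulr1.
  by move=> ->; field; rewrite gt_eqF.
have oe := dilated_family_orthonormal r0 pairp.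
have sth N : summable_fun mu (proj e' eta (inls N)).
  have := summable_sum (ints N) (fun k => summableZ (inner2 eta (e' (inl k))) (se' k).1).
  congr (integrable _ _ _); apply/funext => y /=; congr EFin.
  by rewrite /proj /lin_comb !big_map.
have dk k : inner2 eta (e' (inl k)) = Num.sqrt r * inner2 (fun y => phi (r * y - k%:~R)) eta.
  rewrite /inner2 -RintZ.
    by apply: eq_Rintegral => y _; rewrite /e' /dilated_family /=; ring.
  by apply: (summable_atom_mul r cphi perB); exact: seta.
have sumd N : \sum_(k <- ints N) `|inner2 (fun y => phi (r * y - k%:~R)) eta| <= B.
  have Lk k : L2 (fun y => phi (r * y - k%:~R)).
    have := L2Z (Num.sqrt r)^-1 (Le' (inl k)); congr (L2 _); apply/funext => y.
    by rewrite /e' /dilated_family mulrA mulVf ?mul1r// gt_eqF// sqrtr_gt0.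
  have aeB : {ae mu, forall y, \sum_(k <- ints N) `|phi (r * y - k%:~R)| <= B}.
    by apply: aeW => y; exact: perB.
  apply: (le_trans (sum_inner_le Lk Leta seta aeB)).
  have -> : \int[mu]_y `|eta y| = \int[mu]_y eta y.
    by apply: eq_Rintegral => y _; rewrite ger0_norm.
  by rewrite Ieta mulr1.
have I1le N : \int[mu]_y `|eta y - proj e' eta (inls N) y| <= 1 + B * \int[mu]_x `|phi x|.
  apply: (@le_trans _ _ (\int[mu]_y (eta y + \sum_(k <- ints N)
      (`|inner2 eta (e' (inl k))| * `|e' (inl k) y|)))).
    have s1 : summable_fun mu (fun y => \sum_(k <- ints N)
        (`|inner2 eta (e' (inl k))| * `|e' (inl k) y|)).
      by apply: summable_sum => k; apply/summableZ/summable_norm; have [] := se' k.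
    apply: Rintle; [exact/summable_norm/summableB|exact: summableD|].
    move=> y; rewrite (le_trans (ler_normB _ _))// ger0_norm// lerD2l.
    rewrite /proj /lin_comb !big_map (le_trans (ler_norm_sum _ _ _))//.
    by apply: ler_sum => k _; rewrite normrM.
  have s2 k : summable_fun mu (fun y => `|inner2 eta (e' (inl k))| * `|e' (inl k) y|).
    by apply/summableZ/summable_norm; have [] := se' k.
  rewrite RintD//; last exact: summable_sum.
  rewrite Ieta lerD2l Rintsum//.
  apply: (@le_trans _ _ (\sum_(k <- ints N)
      `|inner2 (fun y => phi (r * y - k%:~R)) eta| * \int[mu]_x `|phi x|)).
    apply: ler_sum => k _; have [sk ik] := se' k.
    rewrite RintZ ?ik; last exact: summable_norm.
    rewrite dk normrM ger0_norm ?sqrtr_ge0// le_eqVlt; apply/orP; left; apply/eqP.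
    have sr2 : Num.sqrt r * Num.sqrt r = r by rewrite -expr2 sqr_sqrtr// ltW.
    transitivity ((Num.sqrt r * Num.sqrt r) * r^-1 *
      (`|inner2 (fun y => phi (r * y - k%:~R)) eta| * \int[mu]_x `|phi x|)); first by ring.
    by rewrite sr2 mulfV ?mul1r// gt_eqF.
  by rewrite -mulr_suml ler_wpM2r// Rintegral_ge0.
have [N0 hN0] := bias_core pairM pairp A0 a0 s0 L0 r0 BM0 bphiM bpsiM perphi perpsi
  spsi spsi0 Lf alphaL betaL Leta seta I1le sth d0.
exists N0 => N /hN0; congr (_ <= _); congr (`|_|).
have Lth := projL2 eta (inls N) Le'.
have swp : summable_fun mu (fun y => eta y * wpart phi r f N y).
  rewrite /wpart /psum.
  have : summable_fun mu (fun y => r * \sum_(k <- ints N) (wcoef phi r f k *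
      (phi (r * y - k%:~R) * eta y))).
    by apply/summableZ/summable_sum => k; apply/summableZ/(summable_atom_mul r cphi perB).
  congr (integrable _ _ _); apply/funext => y /=; congr EFin.
  rewrite [RHS]mulrCA [in RHS]mulr_sumr; congr (_ * _); apply: eq_bigr => k _; ring.
rewrite innerBr//.
transitivity (\int[mu]_y (eta y * f y - eta y * wpart phi r f N y)); last first.
  by apply: eq_Rintegral => y _; rewrite mulrBr.
rewrite RintB//; last exact: L2_mul_summable.
congr (_ - _); first by rewrite -/(inner2 eta f) innerC.
rewrite inner_proj// big_map.
transitivity (\int[mu]_y (r * \sum_(k <- ints N) (wcoef phi r f k *
      (phi (r * y - k%:~R) * eta y)))); last first.
  apply: eq_Rintegral => y _; rewrite /wpart /psum [RHS]mulrCA [in RHS]mulr_sumr.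
  by congr (_ * _); apply: eq_bigr => k _; ring.
rewrite RintZ; last by apply: summable_sum => k; apply/summableZ/(summable_atom_mul r cphi perB).
rewrite Rintsum; last by move=> k; apply/summableZ/(summable_atom_mul r cphi perB).
rewrite mulr_sumr; apply: eq_bigr => k _.
rewrite RintZ; last exact: (summable_atom_mul r cphi perB).
have -> : inner2 f (e' (inl k)) = Num.sqrt r * wcoef phi r f k.
  rewrite /wcoef -RintZ; last exact: (summable_atom_mul r cphi perB).
  by apply: eq_Rintegral => y _; rewrite /e' /dilated_family /=; ring.
have sr2 : Num.sqrt r * Num.sqrt r = r by rewrite -expr2 sqr_sqrtr// ltW.
transitivity (Num.sqrt r * Num.sqrt r * (wcoef phi r f k *
    inner2 (fun y => phi (r * y - k%:~R)) eta)); last by rewrite sr2.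
by rewrite dk; ring.
Qed.

(** By continuity the average of f - K f over a narrow interval is close to its
    value at the centre. *)
Lemma bias_pointwise x : `|wproj phi r f x - f x| <= C.
Proof.
have C0 : 0 <= C.
  rewrite /C mulr_ge0//; last first.
    rewrite addr_ge0// mulr_ge0//; last by apply: Rintegral_ge0.
    by apply: le_trans (perB 0 0%N); apply: sumr_ge0.
  rewrite mulr_ge0// mulr_ge0//; first by rewrite mulr_ge0 ?powR_ge0 ?ltW.
  rewrite addr_ge0// invr_ge0 subr_ge0 powRN invf_le1 ?powR_gt0//.
  by rewrite -[leLHS](powR1E s) ge0_ler_powR ?nnegrE ?(ltW s0)// ler1n.
apply/ler_addgt0Pl => d d0.
pose D y := f y - wproj phi r f y.
have cD : continuous D.
  by move=> y; apply: cvgB; [exact: cf|exact: (wproj_cont cphi sphi r0 perB sf)].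
have d4 : 0 < d / 4 by rewrite divr_gt0.
have /cvgrPdist_lt/(_ _ d4)/nbhs_ballP [e1 /= e10 he] := cD x.
(* Half of e1, as the interval of eta is closed and the ball open. *)
pose eps := e1 / 2; have eps0 : 0 < eps by rewrite divr_gt0.
have [N0 hN0] := bias_average x eps0 d4.
have [N1 hN1] := wpart_unif cphi sphi r0 perB sf d4.
pose N := maxn N0 N1.
have hN := hN0 N (leq_maxl _ _).
pose eta y := (2 * eps)^-1 * \1_(`[x - eps, x + eps]%classic : set R) y.
have e20 : 0 < (2 * eps)^-1 by rewrite invr_gt0 mulr_gt0.
have seta : summable_fun mu eta by exact/summableZ/summable_indic.
have eta0 y : 0 <= eta y by apply: mulr_ge0 => //; exact: ltW.
have Ieta : \int[mu]_y eta y = 1.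
  rewrite RintZ; last exact: summable_indic.
  have : \int[mu]_y (\1_(`[x - eps, x + eps]%classic : set R) y * 1) = (x + eps) - (x - eps).
    apply: (@ftc_indic _ id) => [|y]; last exact: cvg_cst.
    by rewrite lerBlDr -addrA lerDl addr_ge0 ?ltW.
  under eq_Rintegral do rewrite mulr1.
  by move=> ->; field; rewrite gt_eqF.
pose Dn y := f y - wpart phi r f N y.
have cDn : continuous Dn.
  by move=> y; apply: cvgB; [exact: cf|exact: wpart_cont].
have close y : eta y * `|Dn y - D x| <= (d / 2) * eta y.
  rewrite /eta indicE; have [|_] := boolP (y \in _); last by rewrite !mulr0 mul0r.
  rewrite inE /= in_itv /= => yx; rewrite mulr1 mulrC ler_wpM2r ?(ltW e20)//.
  have yb : `|D x - D y| < d / 4.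
    apply: he; rewrite /ball /= ltr_distlC; move: yx; rewrite /eps => /andP[y1 y2].
    by apply/andP; split; lra.
  have yn := hN1 N (leq_maxr _ _) y.
  have -> : Dn y - D x = (wproj phi r f y - wpart phi r f N y) - (D x - D y).
    by rewrite /Dn /D; ring.
  rewrite (le_trans (ler_normB _ _))// (_ : d / 2 = d / 4 + d / 4); last by field.
  by rewrite lerD// ltW.
have sDn : summable_fun mu (fun y => eta y * (Dn y - D x)).
  apply: (summable_le _ (summableZ (d / 2) seta)).
    apply: measurable_funM; first exact: summable_measurable seta.
    by apply: measurable_funB => //; exact: measurable_cont.
  by move=> y; rewrite normrM ger0_norm.
have h2 : `|\int[mu]_y (eta y * (Dn y - D x))| <= d / 2.
  apply: (@le_trans _ _ (\int[mu]_y (d / 2 * eta y))); last by rewrite RintZ// Ieta mulr1.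
  apply: Rint_norm_le => //; first exact: summableZ.
  by move=> y; rewrite normrM ger0_norm.
have sDx := summableZ (D x) seta.
have h3 : `|\int[mu]_y (eta y * (f y - wpart phi r f N y))| <= C + d / 4 := hN.
move: h3; have -> : \int[mu]_y (eta y * (f y - wpart phi r f N y)) =
    \int[mu]_y (eta y * (Dn y - D x)) + D x.
  have {2}-> : D x = \int[mu]_y (D x * eta y) by rewrite RintZ// Ieta mulr1.
  rewrite -RintD//.
  by apply: eq_Rintegral => y _; rewrite /Dn; ring.
move=> h3; rewrite distrC -/(D x).
have -> : D x = (\int[mu]_y (eta y * (Dn y - D x)) + D x) - \int[mu]_y (eta y * (Dn y - D x)).
  by ring.
apply: (le_trans (ler_normB _ _)); apply: (@le_trans _ _ (C + d / 4 + d / 2)).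
  exact: lerD.
by rewrite [leRHS]addrC -addrA lerD2l; lra.
Qed.

End Pointwise.
End Bias.

(** * The bias over the Hoelder class *)

Section Concrete.
Context {R : realType}.
Notation mu := (@lebesgue_measure R).
Implicit Types (f g h phi psi : R -> R) (r x y : R).

Lemma Lfun1_summable f : f \in Lfun leb 1%:E -> summable_fun mu f.
Proof. by move/Lfun1_integrable. Qed.

Lemma Lfuny_bounded f : f \in Lfun leb +oo%E ->
  measurable_fun setT f /\ exists M, {ae mu, forall x, `|f x| <= M}.
Proof.
move=> /andP[/[!inE] mf]; rewrite /finite_norm => fn; split => //.
have {fn} : ('N[leb]_+oo [EFin \o f] < +oo)%E by exact: fn.
have muT : (0 < leb [set: R])%E.
  by rewrite /leb -set_itvNyy [X in (_ < X)%E]lebesgue_measure_itv /= ltry.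
rewrite unlock muT.
set E := ess_sup _ _ => Eoo.
have hE : {ae mu, forall x, (`|(f x)%:E| <= E)%E} by exact: ess_sup_ge.
exists (fine E); apply: ae_imply hE _ => x; rewrite -lee_fin /=.
by case: E Eoo.
Qed.

(** A bounded summable function is square-summable. *)
Lemma holder_L2 phiM psiM s L f : holder_class phiM psiM s L f ->
  [/\ L2 f, summable_fun mu f & \int[mu]_x f x = 1].
Proof.
move=> [cf /Lfuny_bounded[mf [M fM]] f0 If _].
have sf : summable_fun mu f by apply: summable_ge0 => //; rewrite If ltry.
split => //; last by rewrite /Rintegral If.
apply/L2P; split => //; apply: (summable_le_ae _ (summableZ M sf)); first exact: measurable_funM.
apply: ae_imply fM _ => x fx; rewrite normrM ger0_norm// ler_wpM2r//.
by rewrite (le_trans _ fx)// ger0_norm.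
Qed.

Lemma holder_coefs phiM psiM s L f : holder_class phiM psiM s L f ->
  (forall k, `|inner2 f (wavelet_family phiM psiM (inl k))| <= L) /\
  (forall l k, `|inner2 f (wavelet_family phiM psiM (inr (l, k)))| <=
    L * 2 `^ (- (l%:R * (s + 2^-1)))).
Proof.
move=> [_ _ _ _]; rewrite /holder_norm.
set a := ereal_sup _; set b := ereal_sup _ => abL.
have aE k : ((`|inner2 f (wavelet_family phiM psiM (inl k))|)%:E <= a)%E.
  by apply: ereal_sup_ubound; exists k.
have bE l k : ((2 `^ (l%:R * (s + 2^-1)))%:E *
    (`|inner2 f (wavelet_family phiM psiM (inr (l, k)))|)%:E <= b)%E.
  apply: (@le_trans _ _ ((2 `^ (l%:R * (s + 2^-1)))%:E *
                  ereal_sup [set (`|meyer_beta psiM f l k|)%:E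
                            | k in [set: int]])%E).
    apply: lee_wpmul2l; first by rewrite lee_fin powR_ge0.
    by apply: ereal_sup_ubound; exists k.
  by apply: ereal_sup_ubound; exists l.
have a0 : (0 <= a)%E by apply: le_trans (aE 0); rewrite lee_fin.
have b0 : (0 <= b)%E.
  by apply: le_trans (bE 0%N 0); rewrite -EFinM lee_fin mulr_ge0 ?powR_ge0.
split=> [k|l k].
  by rewrite -lee_fin (le_trans (aE k))// (le_trans _ abL)// leeDl.
have : ((2 `^ (l%:R * (s + 2^-1)))%:E *
    (`|inner2 f (wavelet_family phiM psiM (inr (l, k)))|)%:E <= L%:E)%E.
  by rewrite (le_trans (bE l k))// (le_trans _ abL)// leeDr.
rewrite -EFinM lee_fin => h.
by rewrite powRN ler_pdivlMr ?powR_gt0// mulrC.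
Qed.

(** Smoothness of the compactly supported transform is decay of the inverse
    transform, and inversion_ae transfers it to h. *)
Lemma meyer_decay (h : R -> R) A : summable_fun mu h ->
  smooth (fun t => complex.Re (fourier h t)) ->
  smooth (fun t => complex.Im (fourier h t)) ->
  band_limited A h ->
  exists2 K, 0 <= K & {ae mu, forall x, `|h x| <= K / (1 + x ^+ 2)}.
Proof.
move=> sh sr si bh.
have [|m t|K K0 hK] := @inv_trans_decay R A h bh.
- have -> : fcos h = (fun t => complex.Re (fourier h t)) by apply/funext => t; rewrite fourierE.
  exact: sr.
- have -> : (fun t => - fsin h t) = (fun t => complex.Im (fourier h t)).
    by apply/funext => t'; rewrite fourierE.
  exact: si.
by exists K => //; apply: ae_imply (inversion_ae bh) _ => x ->.
Qed.

Theorem bias_bound phiM psiM phi psi a' a s L : meyer_pair phiM psiM ->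
  wavelet_condition phi psi a' a -> 0 < s -> 0 < L ->
  exists Cb, forall r, 0 < r -> forall f, holder_class phiM psiM s L f ->
  forall x, `|wproj phi r f x - f x| <= Cb * r `^ (- s).
Proof.
move=> [pairM [/Lfun1_summable sM /Lfun1_summable spM] smo supM supP].
move=> [pairp cphi Lp [/andP[a'0 a'a] sup1 sup2] [perp _]] s0 L0.
pose A : R := 8 * pi / 3.
have A0 : 0 < A by rewrite divr_gt0// mulr_gt0// pi_gt0.
have pi0 := pi_gt0 R.
have bM : band_limited A phiM.
  apply: (band_limited_supp sM supM) => t /=; rewrite in_itv /= -ler_norml => h.
  by rewrite (le_trans h)// /A; lra.
have bP : band_limited A psiM.
  by apply: (band_limited_supp spM supP) => t /= /andP[].
have [smr smi] := smo phiM (or_introl erefl).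
have [spr spi] := smo psiM (or_intror erefl).
have [K1 K10 h1] := meyer_decay sM smr smi bM.
have [K2 K20 h2] := meyer_decay spM spr spi bP.
pose BM := (K1 + K2) * (2 * pi).
have BM0 : 0 <= BM by rewrite mulr_ge0 ?addr_ge0// mulr_ge0// ltW.
have p1 : {ae mu, forall x, forall N, \sum_(k <- ints N) `|phiM (x - k%:~R)| <= BM}.
  apply: ae_imply (decay_periodization ltr01 h1) _ => x hx N.
  have := hx N; rewrite mul1r => /le_trans; apply.
  by rewrite ler_wpM2r ?lerDl// mulr_ge0// ltW.
have p2 (l : nat) : {ae mu, forall x, forall N,
    \sum_(k <- ints N) `|psiM (2 ^+ l * x - k%:~R)| <= BM}.
  apply: ae_imply (decay_periodization (pow2_gt0 l) h2) _ => x hx N.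
  rewrite (le_trans (hx N))//.
  by rewrite ler_wpM2r ?lerDr// mulr_ge0// ltW.
have [/Lfun1_summable sphi /Lfun1_summable spsi] := Lp 1%:E (lexx _).
have spsi0 t : `|t| <= a' -> fcos psi t = 0 /\ fsin psi t = 0.
  move=> ta; apply: (fourier_zero spsi sup2) => -[_]; apply => /=.
  by rewrite in_itv /= -ler_norml.
have [B B0 perB] := periodization_bound perp.
exists (L * (a' / A) `^ (- s) * (1 + (1 - 2 `^ (- s))^-1) * BM *
  (1 + B * \int[mu]_x `|phi x|)) => r r0 f hf x.
have [Lf sf _] := holder_L2 hf; have [cf _ _ _ _] := hf.
have [aL bL] := holder_coefs hf.
have := bias_pointwise pairM pairp cphi sphi perB A0 a'0 s0 L0 r0 BM0 bM bP p1 p2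
  spsi spsi0 Lf sf cf aL bL x.
have -> : (r * a' / A) `^ (- s) = r `^ (- s) * (a' / A) `^ (- s).
  by rewrite -mulrA powRM ?(ltW r0)// divr_ge0 ?ltW.
by move=> h; apply: (le_trans h); rewrite le_eqVlt; apply/orP; left; apply/eqP; ring.
Qed.

End Concrete.

(** * Expectations under laws, densities and independence *)

Section Laws.
Context {R : realType}.
Notation mu := (@lebesgue_measure R).
Notation MR := (measurableTypeR R).

Section OneSpace.
Context d (T : measurableType d) (P : probability T R).
Implicit Types (X Z : {RV P >-> MR}) (u v f : R -> R).

Lemma summable_prob (g : T -> R) c : measurable_fun setT g -> (forall w, `|g w| <= c) ->
  summable_fun P g.
Proof.
move=> mg gc; apply: (summable_le mg _ gc).
exact: (finite_measure_integrable_cst P c measurableT).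
Qed.

Lemma Rint_prob_cst c : \int[P]_w c = c.
Proof.
rewrite Rintegral_cst// -[RHS]mulr1; congr (_ * _).
rewrite -[RHS]/(fine 1%E); congr fine; exact: probability_setT.
Qed.

End OneSpace.

Section OneSpace2.
Context d (T : measurableType d) (P : probability T R).
Implicit Types (X Z : {RV P >-> MR}) (u v f : R -> R).

Lemma measurable_RV u X : measurable_fun setT u -> measurable_fun setT (fun w => u (X w)).
Proof. by move=> mu'; apply: (measurableT_comp mu'); exact: (@measurable_funP _ _ _ _ setT X). Qed.

Lemma summable_RV u X c : measurable_fun setT u -> (forall x, `|u x| <= c) ->
  summable_fun P (fun w => u (X w)).
Proof. by move=> mu' u1; apply: summable_prob => //; exact: measurable_RV. Qed.

Lemma Rint_RV u X c : measurable_fun setT u -> (forall x, `|u x| <= c) ->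
  \int[P]_w u (X w) = \int[distribution P X]_x u x.
Proof.
move=> mu' u1; rewrite /Rintegral; congr fine; apply/esym.
rewrite (@integral_distribution _ _ _ _ _ P X (EFin \o u))//.
  exact/measurable_EFinP.
exact: (summable_RV X mu' u1).
Qed.

(** The joint law is the product of the marginal laws, because the two agree on
    rectangles; then Fubini. *)
Lemma independent_expectation X Z u v : independent2 P X Z ->
  measurable_fun setT u -> measurable_fun setT v ->
  (forall x, `|u x| <= 1) -> (forall x, `|v x| <= 1) ->
  \int[P]_w (u (X w) * v (Z w)) = (\int[P]_w u (X w)) * (\int[P]_w v (Z w)).
Proof.
move=> ind mu' mv u1 v1.
rewrite (Rint_RV X mu' u1) (Rint_RV Z mv v1).
pose J w : MR * MR := (X w, Z w).
have mJ : measurable_fun setT J.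
  by apply: measurable_fun_pair; exact: measurable_funP.
pose mixin := isMeasurableFun.Build _ _ _ _ J mJ.
pose J' : {mfun _ >-> _} := HB.pack J mixin.
pose mX := distribution P X; pose mZ := distribution P Z.
pose F (p : MR * MR) : R := u p.1 * v p.2.
have mF : measurable_fun setT F.
  by apply: measurable_funM; [exact: measurable_fun1|exact: measurable_fun2].
have su : summable_fun mX u.
  exact: (@summable_prob _ _ mX u 1 mu' u1).
have sv : summable_fun mZ v.
  exact: (@summable_prob _ _ mZ v 1 mv v1).
have FF x z : `|F (x, z)| <= `|u x| * `|v z| by rewrite normrM.
have sF := summable_prod mF (summable_norm su) (summable_norm sv) FF.
have sJ : summable_fun P (fun w => F (J w)).
  apply: (@summable_prob _ _ _ _ 1); first exact: (measurableT_comp mF mJ).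
  by move=> w; rewrite normrM mulr_ile1.
transitivity (\int[mX]_x \int[mZ]_z F (x, z)); last first.
  transitivity (\int[mX]_x (\int[mZ]_z v z * u x)); last by rewrite RintZ// mulrC.
  by apply: eq_Rintegral => x _; rewrite /F /= RintZ// mulrC.
transitivity (fine (\int[(mX \x mZ)%E]_z (F z)%:E)%E).
  rewrite /Rintegral; congr fine.
  transitivity (\int[pushforward P J']_z (F z)%:E)%E.
    by rewrite (@integral_pushforward _ _ _ _ R J mJ P setT (EFin \o F))//; exact/measurable_EFinP.
  apply: eq_measure_integral => A mA _; apply/esym.
  apply: (product_measure_unique (m1 := mX) (m2 := mZ) (m' := pushforward P J')) => //.
rewrite -(integral12_prod_meas1 sF) /Rintegral; congr fine.
apply: eq_integral => x _; rewrite /fubini_F /= Rint_EFin//.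
exact: (summable_slice1 mF (summable_norm sv) FF).
Qed.

Lemma law_expectation (m : {measure set MR -> \bar R}) X u c : has_law P X m ->
  measurable_fun setT u -> (forall x, `|u x| <= c) ->
  \int[P]_w u (X w) = \int[m]_x u x.
Proof.
move=> hX mu' u1; rewrite (Rint_RV X mu' u1) /Rintegral; congr fine.
by apply: eq_measure_integral => A mA _; exact: hX.
Qed.

(** The density agrees almost everywhere with the Radon-Nikodym derivative of
    the law of X, through which integrals against the law become Lebesgue
    integrals. *)
Lemma density_expectation X u c (f : R -> R) : has_density P X f ->
  measurable_fun setT f -> (forall x, 0 <= f x) -> summable_fun mu f ->
  measurable_fun setT u -> (forall x, `|u x| <= c) ->
  \int[P]_w u (X w) = \int[mu]_x (f x * u x).
Proof.
move=> hX mf f0 sf mu' u1; rewrite (Rint_RV X mu' u1).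
pose nu := distribution P X.
have dom : nu `<< mu.
  apply/null_content_dominatesP => A mA A0; rewrite /nu [LHS]hX//.
  apply: null_set_integral => //.
  by apply: measurable_funTS; exact/measurable_EFinP.
have RNi := Radon_Nikodym_integral (nu := charge_of_finite_measure nu) dom.
have ae : ae_eq mu setT (Radon_Nikodym (charge_of_finite_measure nu) mu) (EFin \o f).
  apply: integral_ae_eq => //.
  - exact: Radon_Nikodym_integrable.
  - exact/measurable_EFinP.
  - by move=> E _ mE; rewrite -RNi//; exact: hX.
rewrite /Rintegral; congr fine.
rewrite -(Radon_Nikodym_change_of_variables (nu := nu) dom measurableT); last first.
  exact: (@summable_prob _ _ nu u c mu' u1).
have RNm := measurable_int _ (Radon_Nikodym_integrable (nu := charge_of_finite_measure nu) dom).
apply: ae_eq_integral => //.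
- by apply: emeasurable_funM => //; exact/measurable_EFinP.
- by apply/measurable_EFinP; exact: measurable_funM.
- by apply: ae_imply ae _ => x hx _; rewrite hx//= -EFinM mulrC.
Qed.

End OneSpace2.

Lemma pushforward_expectation d (T : measurableType d) (P : probability T R)
    d0 (T0 : measurableType d0) (P0 : probability T0 R)
    (Y : {RV P >-> MR}) (W : T0 -> R) (u : R -> R) (c : R) :
  measurable_fun setT W -> has_law P Y (pushforward P0 W) ->
  measurable_fun setT u -> (forall x, `|u x| <= c) ->
  \int[P]_w u (Y w) = \int[P0]_w u (W w).
Proof.
move=> mW hY mu' u1.
pose mixin := isMeasurableFun.Build _ _ _ _ (W : T0 -> MR) mW.
pose W' : {RV P0 >-> MR} := HB.pack (W : T0 -> MR) mixin.
rewrite (Rint_RV Y mu' u1) (Rint_RV (W' : {RV P0 >-> MR}) mu' u1).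
rewrite /Rintegral; congr fine.
by apply: eq_measure_integral => A mA _; exact: hY.
Qed.

Lemma pairwise_independent d (T : measurableType d) (P : probability T R) n
    (Y : 'I_n -> {RV P >-> MR}) (i j : 'I_n) : i != j ->
  mutually_independent P (fun m => Y m : T -> R) ->
  independent2 P (Y i) (Y j).
Proof.
move=> ij mi A B mA mB.
pose C (m : 'I_n) : set MR := if m == i then A else if m == j then B else setT.
have mC m : measurable (C m) by rewrite /C; case: ifP => // _; case: ifP.
have := mi C mC.
have -> : \bigcap_(m in [set: 'I_n]) (Y m @^-1` C m) = Y i @^-1` A `&` Y j @^-1` B.
  apply/seteqP; split => [w h|w [hA hB] m _].
    split; first by have := h i I; rewrite /C eqxx.
    by have := h j I; rewrite /C eqxx eq_sym (negbTE ij).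
  by rewrite /C /=; case: eqP => [->//|_]; case: eqP => [->|].
move=> ->; rewrite (bigD1 i)//= (bigD1 j) ?(eq_sym j)//= big1 ?mule1.
  by rewrite /C !eqxx eq_sym (negbTE ij).
move=> m /andP[mi' mj]; rewrite /C (negbTE mi') (negbTE mj) preimage_setT.
exact: probability_setT.
Qed.

(** The variance of the mean is at most 1 / n, since only the diagonal terms
    survive. The bound |z| <= (sqrt n z^2 + 1 / sqrt n) / 2 passes from it to
    the first absolute moment. *)
Lemma mean_deviation d (T : measurableType d) (P : probability T R) n
    (Y : 'I_n -> {RV P >-> MR}) (u : R -> R) (m : R) : (0 < n)%N ->
  mutually_independent P (fun m => Y m : T -> R) ->
  measurable_fun setT u -> (forall x, `|u x| <= 1) ->
  (forall i, \int[P]_w u (Y i w) = m) ->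
  \int[P]_w `|n%:R^-1 * \sum_(i < n) u (Y i w) - m| <= (Num.sqrt n%:R)^-1.
Proof.
move=> n0 mi mu' u1 Eu.
have su i : summable_fun P (fun w => u (Y i w)) by exact: summable_RV mu' u1.
have n0' : 0 < n%:R :> R by rewrite ltr0n.
have sn0 : 0 < Num.sqrt n%:R :> R by rewrite sqrtr_gt0.
pose Z i w := u (Y i w) - m.
have mZ i : measurable_fun setT (Z i).
  by apply: measurable_funB => //; exact: measurable_RV.
have m1 : `|m| <= 1.
  rewrite -(Eu (Ordinal n0)) -[leRHS](Rint_prob_cst P).
  apply: Rint_norm_le => //.
  exact: (finite_measure_integrable_cst P 1 measurableT).
have Z2 i w : `|Z i w| <= 2.
  by rewrite (le_trans (ler_normB _ _))// (_ : 2 = 1 + 1 :> R)// lerD.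
have sZZ i j : summable_fun P (fun w => Z i w * Z j w).
  apply: (@summable_prob _ _ _ _ 4); first exact: measurable_funM.
  by move=> w; rewrite normrM (_ : 4 = 2 * 2 :> R) ?ler_pM//; ring.
have sZ_ i : summable_fun P (Z i) by apply: (@summable_prob _ _ _ _ 2).
have sm : summable_fun P (fun=> m) by exact: (finite_measure_integrable_cst P m measurableT).
have EZZ i j : \int[P]_w (Z i w * Z j w) <= (i == j)%:R.
  have [->|ij] := eqVneq i j.
    have su2 : summable_fun P (fun w => u (Y j w) * u (Y j w)).
      apply: (@summable_prob _ _ _ _ 1); first by apply: measurable_funM; exact: measurable_RV.
      by move=> w; rewrite normrM mulr_ile1.
    have s2 := summableZ (2 * m) (su j).
    have -> : \int[P]_w (Z j w * Z j w) = \int[P]_w (u (Y j w) * u (Y j w)) - m ^+ 2.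
      transitivity (\int[P]_w (u (Y j w) * u (Y j w) - 2 * m * u (Y j w) + m ^+ 2)).
        by apply: eq_Rintegral => w _; rewrite /Z; ring.
      rewrite RintD; [|exact: summableB|exact: (finite_measure_integrable_cst P _ measurableT)].
      by rewrite RintB// RintZ// Eu Rint_prob_cst; ring.
    rewrite lerBlDr (@le_trans _ _ 1)//; last by rewrite lerDl sqr_ge0.
    rewrite -[leRHS](Rint_prob_cst P); apply: Rintle => //.
      exact: (finite_measure_integrable_cst P 1 measurableT).
    by move=> w; rewrite (le_trans (ler_norm _))// normrM mulr_ile1.
  have suu : summable_fun P (fun w => u (Y i w) * u (Y j w)).
    apply: (@summable_prob _ _ _ _ 1); first by apply: measurable_funM; exact: measurable_RV.
    by move=> w; rewrite normrM mulr_ile1.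
  have si := summableZ m (su i); have sj := summableZ m (su j).
  rewrite (_ : \int[P]_w _ = 0)//.
  transitivity (\int[P]_w (u (Y i w) * u (Y j w) - (m * u (Y i w) + m * u (Y j w)) + m ^+ 2)).
    by apply: eq_Rintegral => w _; rewrite /Z; ring.
  rewrite RintD; [|by apply: summableB => //; exact: summableD|exact: (finite_measure_integrable_cst P _ measurableT)].
  rewrite RintB//; last exact: summableD.
  rewrite RintD// !RintZ// !Eu Rint_prob_cst.
  rewrite (independent_expectation (pairwise_independent ij mi) mu' mu' u1 u1) !Eu.
  by ring.
pose S w := n%:R^-1 * \sum_(i < n) Z i w.
have SE w : n%:R^-1 * \sum_(i < n) u (Y i w) - m = S w.
  rewrite /S /Z sumrB mulrBr; congr (_ - _).
  by rewrite sumr_const card_ord -[m *+ n]mulr_natl mulrA mulVf ?mul1r// gt_eqF.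
have sS : summable_fun P S by apply/summableZ/summable_sum.
have SS w : S w ^+ 2 = n%:R^-1 ^+ 2 * \sum_(i < n) \sum_(j < n) (Z i w * Z j w).
  by rewrite /S exprMn; congr (_ * _); rewrite expr2 big_distrlr.
have sSS : summable_fun P (fun w => S w ^+ 2).
  under [X in EFin \o X]eq_fun do rewrite SS.
  by apply/summableZ/summable_sum => i; exact: summable_sum.
have ESS : \int[P]_w (S w ^+ 2) <= n%:R^-1.
  under eq_Rintegral do rewrite SS.
  rewrite RintZ; last by apply: summable_sum => i; exact: summable_sum.
  rewrite Rintsum; last by move=> i; exact: summable_sum.
  apply: (@le_trans _ _ (n%:R^-1 ^+ 2 * \sum_(i < n) 1)).
    rewrite ler_wpM2l ?sqr_ge0//; apply: ler_sum => i _; rewrite Rintsum//.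
    apply: (@le_trans _ _ (\sum_(j < n) (i == j)%:R)); first exact: ler_sum.
    by rewrite (bigD1 i)//= eqxx big1 ?addr0// => j; rewrite eq_sym => /negbTE ->.
  rewrite sumr_const card_ord expr2 -mulrA mulVf ?mulr1//.
  by rewrite gt_eqF.
under eq_Rintegral do rewrite SE.
pose sn : R := Num.sqrt n%:R.
have sn2 : sn * sn = n%:R by rewrite -expr2 sqr_sqrtr ?ler0n.
have s1 := summableZ (2^-1 * sn) sSS.
have s2 := finite_measure_integrable_cst P (2^-1 * sn^-1) measurableT.
(* Pointwise, by (sn |S| - 1)^2 >= 0. *)
apply: (@le_trans _ _ (\int[P]_w (2^-1 * sn * S w ^+ 2 + 2^-1 * sn^-1))).
  apply: Rintle; [exact: summable_norm|exact: summableD|].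
  move=> w; rewrite -[S w ^+ 2]real_normK ?num_real//.
  rewrite -subr_ge0.
  have -> : 2^-1 * sn * `|S w| ^+ 2 + 2^-1 * sn^-1 - `|S w| =
    2^-1 * sn^-1 * (sn * `|S w| - 1) ^+ 2 by field; rewrite gt_eqF.
  by rewrite mulr_ge0 ?sqr_ge0// mulr_ge0 ?invr_ge0// ltW.
rewrite RintD// RintZ// Rint_prob_cst.
rewrite (le_trans (lerD (ler_wpM2l _ ESS) (lexx _)))//.
  by rewrite mulr_ge0// sqrtr_ge0.
rewrite -/sn -sn2 le_eqVlt; apply/orP; left; apply/eqP; field.
by rewrite gt_eqF.
Qed.

End Laws.

(** * Trigonometric transforms as bounded functions *)

Section Symbols.
Context {R : realType}.
Notation mu := (@lebesgue_measure R).
Notation MR := (measurableTypeR R).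
Implicit Types (g h q : R -> R) (c r t : R).

(** The functions of the frequency that may be paired with the deconvolution
    symbol: trigonometric functions, transforms, and their combinations. *)
Definition bounded_measurable (g : R -> R) :=
  measurable_fun setT g /\ exists c, forall t, `|g t| <= c.

Lemma bmB g h : bounded_measurable g -> bounded_measurable h ->
  bounded_measurable (fun t => g t - h t).
Proof.
move=> [mg [c gc]] [mh [d hd]]; split; first exact: measurable_funB.
by exists (c + d) => t; rewrite (le_trans (ler_normB _ _))// lerD.
Qed.

Lemma bmM g h : bounded_measurable g -> bounded_measurable h ->
  bounded_measurable (fun t => g t * h t).
Proof.
move=> [mg [c gc]] [mh [d hd]]; split; first exact: measurable_funM.
by exists (c * d) => t; rewrite normrM ler_pM.
Qed.

Lemma bm_cst c : bounded_measurable (fun=> c).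
Proof. by split; [exact: measurable_cst|exists `|c|]. Qed.

Lemma bmN g : bounded_measurable g -> bounded_measurable (fun t => - g t).
Proof.
by move=> /(bmB (bm_cst 0)); congr bounded_measurable; apply/funext => t; rewrite sub0r.
Qed.

Lemma bmD g h : bounded_measurable g -> bounded_measurable h ->
  bounded_measurable (fun t => g t + h t).
Proof.
move=> bg /bmN bh; have := bmB bg bh.
by congr bounded_measurable; apply/funext => t; rewrite opprK.
Qed.

Lemma bm_sum (I : Type) (s : seq I) (g : I -> R -> R) :
  (forall i, bounded_measurable (g i)) ->
  bounded_measurable (fun t => \sum_(i <- s) g i t).
Proof.
move=> bg; elim: s => [|i s IH].
  have := bm_cst 0; congr bounded_measurable; apply/funext => t.
  by rewrite big_nil.
have := bmD (bg i) IH; congr bounded_measurable; apply/funext => t.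
by rewrite big_cons.
Qed.

Lemma bm_cos y : bounded_measurable (fun t => cos (t * y)).
Proof.
split; first exact: measurable_comp_linr measurable_cos.
by exists 1 => t; exact: cos_norm.
Qed.

Lemma bm_sin y : bounded_measurable (fun t => sin (t * y)).
Proof.
split; first exact: measurable_comp_linr measurable_sin.
by exists 1 => t; exact: sin_norm.
Qed.

(** As for inv_trans, the weight 1 / (1 + t^2) makes the integrand summable in
    the pair, and is then divided out. *)
Lemma bm_trans (m : {sigma_finite_measure set MR -> \bar R}) f g :
  summable_fun m f -> measurable_fun setT g -> (forall x, `|g x| <= 1) ->
  bounded_measurable (fun t => \int[m]_x (f x * g (t * x))).
Proof.
move=> sf mg g1; have sabsf := summable_norm sf.
have sg t : summable_fun m (fun x => f x * g (t * x)).
  apply: (summable_le _ sabsf); last by move=> x; rewrite normrM ler_piMr.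
  by apply: measurable_funM; [exact: summable_measurable sf|exact: measurable_comp_lin].
split; last first.
  exists (\int[m]_x `|f x|) => t; apply: Rint_norm_le => // x.
  by rewrite normrM ler_piMr.
pose w t : R := (1 + t ^+ 2)^-1.
have mw : measurable_fun setT w := summable_measurable summable_cauchy.
pose F (p : MR * MR) := w p.1 * (f p.2 * g (p.1 * p.2)).
have mF : measurable_fun setT F.
  apply: measurable_funM; first exact: measurable_fun1.
  by apply: measurable_funM; [exact: measurable_fun2 (summable_measurable sf)|exact: measurable_prodcomp].
have w0 t : 0 <= w t by rewrite invr_ge0 addr_ge0 ?sqr_ge0.
have FF t x : `|F (t, x)| <= w t * `|f x|.
  by rewrite /F /= normrM ger0_norm// ler_wpM2l// normrM ler_piMr.
have := summable_measurable (summable_marginal1 (m1 := mu) (m2 := m) mF summable_cauchy sabsf FF).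
under eq_fun do rewrite /F /= RintZ//.
move=> mm; rewrite (_ : (fun t => _) = fun t => (1 + t ^+ 2) *
  (w t * \int[m]_x (f x * g (t * x)))).
  apply: measurable_funM => //.
  by apply: measurable_funD => //; exact: exprn_measurable.
apply/funext => t; rewrite mulrA /w mulfV ?mul1r//.
by rewrite gt_eqF// ltr_pwDl// sqr_ge0.
Qed.

Lemma bm_fcos h : summable_fun mu h -> bounded_measurable (fcos h).
Proof. by move=> sh; apply: bm_trans => //; [exact: measurable_cos|exact: cos_norm]. Qed.

Lemma bm_fsin h : summable_fun mu h -> bounded_measurable (fsin h).
Proof. by move=> sh; apply: bm_trans => //; [exact: measurable_sin|exact: sin_norm]. Qed.

Section Law.
Variable law : probability MR R.

Definition lcos (t : R) : R := \int[law]_x cos (t * x).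
Definition lsin (t : R) : R := \int[law]_x sin (t * x).

Lemma fourier_lawE t : fourier_law law t = lcos t +i* (- lsin t).
Proof.
rewrite /fourier_law /cintegral /expi; congr (_ +i* _).
  by apply: eq_Rintegral => x _; rewrite /= cosN.
rewrite -mulN1r -RintZ; last first.
  apply: (@summable_prob _ _ _ law _ 1); first exact: measurable_comp_lin measurable_sin.
  by move=> x; exact: sin_norm.
by apply: eq_Rintegral => x _; rewrite /= sinN mulN1r.
Qed.

Lemma bm_law_trans g : measurable_fun setT g -> (forall x, `|g x| <= 1) ->
  bounded_measurable (fun t => \int[law]_x g (t * x)).
Proof.
move=> mg g1.
have s1 : summable_fun law (fun=> 1) by exact: (finite_measure_integrable_cst law 1 measurableT).
have := bm_trans s1 mg g1; congr bounded_measurable; apply/funext => t.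
by apply: eq_Rintegral => x _; rewrite mul1r.
Qed.

Lemma bm_lcos : bounded_measurable lcos.
Proof. by apply: bm_law_trans; [exact: measurable_cos|exact: cos_norm]. Qed.

Lemma bm_lsin : bounded_measurable lsin.
Proof. by apply: bm_law_trans; [exact: measurable_sin|exact: sin_norm]. Qed.

Lemma lcosN t : lcos (- t) = lcos t.
Proof. by apply: eq_Rintegral => x _; rewrite mulNr cosN. Qed.

Lemma lsinN t : lsin (- t) = - lsin t.
Proof.
rewrite /lsin -[RHS]mulN1r -RintZ; last first.
  apply: (@summable_prob _ _ _ law _ 1); first exact: measurable_comp_lin measurable_sin.
  by move=> x; exact: sin_norm.
by apply: eq_Rintegral => x _; rewrite mulNr sinN mulN1r.
Qed.

End Law.

Lemma fcosN h t : fcos h (- t) = fcos h t.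
Proof. by apply: eq_Rintegral => x _; rewrite mulNr cosN. Qed.

Lemma fsinN h t : summable_fun mu h -> fsin h (- t) = - fsin h t.
Proof.
move=> sh; rewrite /fsin -[RHS]mulN1r -RintZ; last exact: summable_mul_sin.
by apply: eq_Rintegral => x _; rewrite mulNr sinN; ring.
Qed.

Lemma summable_translates h k : summable_fun mu h -> summable_fun mu (translates h k).
Proof.
move=> sh; have := summable_affine (- k%:~R) ltr01 sh.
by congr (integrable _ _ _); apply/funext => x; rewrite /translates /= mul1r.
Qed.

Lemma band_translates A h k : band_limited A h -> band_limited A (translates h k).
Proof.
move=> [sh bh]; split; first exact: summable_translates.
move=> t /bh [c0 s0].
have [||c1 s1] := @trans_shift R h 1 (- k%:~R) t ltr01 sh; rewrite ?divr1//.
have -> : translates h k = fun x => h (1 * x + - k%:~R).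
  by apply/funext => x; rewrite /translates mul1r.
by split.
Qed.

Lemma Rint_translates h k : summable_fun mu h ->
  \int[mu]_x `|translates h k x| = \int[mu]_x `|h x|.
Proof.
move=> sh; transitivity (\int[mu]_x `|h (1 * x + - k%:~R)|).
  by apply: eq_Rintegral => x _; rewrite mul1r.
by rewrite (Rint_affine (- k%:~R) ltr01 (summable_norm sh)) invr1 mul1r.
Qed.

Lemma trans_dilate q r t : 0 < r -> summable_fun mu q ->
  fcos (fun x => q (r * x)) t = r^-1 * fcos q (r^-1 * t) /\
  fsin (fun x => q (r * x)) t = r^-1 * fsin q (r^-1 * t).
Proof.
move=> r0 sq.
have tE x : t * x = r^-1 * t * (r * x) by field; rewrite gt_eqF.
have sc := summable_mul_cos (r^-1 * t) sq; have ss := summable_mul_sin (r^-1 * t) sq.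
split.
  rewrite -(Rint_affine 0 r0 sc).
  by apply: eq_Rintegral => x _; rewrite addr0 -tE.
rewrite -(Rint_affine 0 r0 ss).
by apply: eq_Rintegral => x _; rewrite addr0 -tE.
Qed.

(** The numerator is at most 2 W n with n^2 = p^2 + q^2, and n >= D. *)
Lemma quotient_le (w1 w2 p q W r D : R) : `|w1| <= W -> `|w2| <= W -> 0 < r -> 0 < D ->
  D <= Num.sqrt (p ^+ 2 + q ^+ 2) ->
  `|(w1 * p - w2 * q) / (r * (p ^+ 2 + q ^+ 2))| <= 2 * W / (r * D).
Proof.
set n := Num.sqrt _ => w1W w2W r0 D0 Dn.
have W0 : 0 <= W by exact: le_trans w1W.
have n0 : 0 < n by exact: lt_le_trans Dn.
have nn : p ^+ 2 + q ^+ 2 = n * n by rewrite -expr2 sqr_sqrtr// addr_ge0 ?sqr_ge0.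
have pn : `|p| <= n.
  by rewrite -ler_sqr ?nnegrE ?(ltW n0)// real_normK ?num_real// [n ^+ 2]expr2 -nn lerDl sqr_ge0.
have qn : `|q| <= n.
  by rewrite -ler_sqr ?nnegrE ?(ltW n0)// real_normK ?num_real// [n ^+ 2]expr2 -nn lerDr sqr_ge0.
rewrite nn normrM normfV [`|r * _|]gtr0_norm ?mulr_gt0//.
apply: (@le_trans _ _ ((2 * W * n) / (r * (n * n)))).
  rewrite ler_pM2r ?invr_gt0 ?mulr_gt0// (le_trans (ler_normB _ _))// !normrM.
  rewrite (_ : 2 * W * n = W * n + W * n); last by ring.
  by rewrite lerD// ler_pM.
rewrite (_ : 2 * W * n / _ = 2 * W / r * n^-1); last by field; rewrite !gt_eqF.
rewrite (_ : 2 * W / (r * D) = 2 * W / r * D^-1); last by field; rewrite !gt_eqF.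
rewrite ler_wpM2l ?lef_pV2 ?posrE//.
apply: mulr_ge0; last by rewrite invr_ge0 ltW.
exact: mulr_ge0.
Qed.

End Symbols.

(** * The deconvolution symbol *)

Section Deconvolution.
Context {R : realType}.
Notation mu := (@lebesgue_measure R).
Notation MR := (measurableTypeR R).
Implicit Types (f g h : R -> R) (k : int) (t x : R).

Variables (phi : R -> R) (law : probability MR R) (a j D : R).
Let r : R := 2 `^ j.
Hypotheses (bphi : band_limited a phi) (D0 : 0 < D).
Hypothesis lawD : forall t, `|t| <= r * a -> D <= normc (fourier_law law t).

Let r0 : 0 < r. Proof. by rewrite powR_gt0. Qed.
Let sphi : summable_fun mu phi. Proof. by case: bphi. Qed.
Let N t := lcos law t ^+ 2 + lsin law t ^+ 2.

(** The real and imaginary parts of the function that phi_tilde inverts, namely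
    the transform (w1 - i w2) of the k-th translate of phi at t / r divided by r
    (p + i q). *)
Definition symR k t : R :=
  (fcos (translates phi k) (r^-1 * t) * lcos law t -
   fsin (translates phi k) (r^-1 * t) * lsin law t) / (r * N t).

Definition symI k t : R :=
  - (fcos (translates phi k) (r^-1 * t) * lsin law t +
     fsin (translates phi k) (r^-1 * t) * lcos law t) / (r * N t).

(** Holds also where p^2 + q^2 = 0, since both inverses are then 0. *)
Lemma symbolE k t :
  fourier (translates phi k) (2 `^ (- j) * t) /
    ((2 `^ j)%:C * (fourier_law law t)^*) = symR k t +i* symI k t.
Proof.
rewrite powRN -/r fourierE; last exact: summable_translates.
rewrite fourier_lawE /symR /symI.
set w1 := fcos _ _; set w2 := fsin _ _; set p := lcos _ _; set q := lsin _ _.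
have quotE (x y A B : R) : (x +i* y) / (A +i* B) =
    (x * (A / (A ^+ 2 + B ^+ 2)) - y * - (B / (A ^+ 2 + B ^+ 2))) +i*
    (x * - (B / (A ^+ 2 + B ^+ 2)) + y * (A / (A ^+ 2 + B ^+ 2))) by [].
apply: (etrans (quotE w1 (- w2) (r * p - 0 * - - q) (r * - - q + 0 * p))).
rewrite /N -/p -/q.
have -> : (r * p - 0 * - - q) ^+ 2 + (r * - - q + 0 * p) ^+ 2 =
  r * (r * (p ^+ 2 + q ^+ 2)) by ring.
rewrite !invfM; set i := (p ^+ 2 + q ^+ 2)^-1.
by congr (_ +i* _); field; rewrite gt_eqF.
Qed.

(** A majorant of the symbol that does not depend on k. It exists because
    translating phi does not change the L1 norm that bounds its transform. *)
Definition envelope t : R :=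
  \1_(`[- (r * a), r * a]%classic : set R) t * (2 * (\int[mu]_x `|phi x|) / (r * D)).

Lemma summable_envelope : summable_fun mu envelope.
Proof.
have := summableZ (2 * (\int[mu]_x `|phi x|) / (r * D)) (summable_indic (- (r * a)) (r * a)).
by congr (integrable _ _ _); apply/funext => t; rewrite /= /envelope mulrC.
Qed.

Lemma sym_out k t : r * a < `|t| ->
  fcos (translates phi k) (r^-1 * t) = 0 /\ fsin (translates phi k) (r^-1 * t) = 0.
Proof.
move=> rt; have [_ bt] := band_translates k bphi; apply: bt.
by rewrite normrM gtr0_norm ?invr_gt0// mulrC ltr_pdivlMr// mulrC.
Qed.

Lemma law_norm t : `|t| <= r * a -> D <= Num.sqrt (N t).
Proof. by move=> /lawD; rewrite fourier_lawE /N /= sqrrN. Qed.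

Lemma sym_le k t : `|symR k t| <= envelope t /\ `|symI k t| <= envelope t.
Proof.
have sk := summable_translates k sphi.
have [tr|tr] := leP `|t| (r * a); last first.
  have [c0 s0] := sym_out k tr; have e0 : envelope t = 0.
    rewrite /envelope indicE memNset ?mul0r//= in_itv /= -ler_norml => /le_lt_trans.
    by move=> /(_ _ tr); rewrite ltxx.
  by rewrite /symR /symI c0 s0 !mul0r subrr addr0 oppr0 !mul0r e0 normr0.
have -> : envelope t = 2 * (\int[mu]_x `|phi x|) / (r * D).
  by rewrite /envelope indicE mem_set ?mul1r//= in_itv /= -ler_norml.
have w1 : `|fcos (translates phi k) (r^-1 * t)| <= \int[mu]_x `|phi x|.
  by rewrite -(Rint_translates k sphi); exact: fcos_le.
have w2 : `|fsin (translates phi k) (r^-1 * t)| <= \int[mu]_x `|phi x|.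
  by rewrite -(Rint_translates k sphi); exact: fsin_le.
have lN := law_norm tr; split; first exact: quotient_le.
have := @quotient_le R (- fcos (translates phi k) (r^-1 * t))
  (fsin (translates phi k) (r^-1 * t)) (lsin law t) (lcos law t) _ r D.
rewrite normrN => /(_ _ w1 w2 r0 D0); rewrite addrC => /(_ lN).
by rewrite /symI mulNr opprD.
Qed.

Lemma measurable_sym k :
  measurable_fun setT (symR k) /\ measurable_fun setT (symI k).
Proof.
have bk := band_translates k bphi.
have mc : measurable_fun setT (fun t => fcos (translates phi k) (r^-1 * t)).
  exact: measurable_comp_lin (summable_measurable (summable_fcos bk)).
have ms : measurable_fun setT (fun t => fsin (translates phi k) (r^-1 * t)).
  exact: measurable_comp_lin (summable_measurable (summable_fsin bk)).
have [mp _] := bm_lcos law; have [mq _] := bm_lsin law.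
have mN : measurable_fun setT (fun t => (r * N t)^-1).
  rewrite (_ : (fun t => _) = fun t => (r * N t) `^ (-1)); last first.
    apply/funext => t; rewrite powR_inv1// mulr_ge0 ?(ltW r0)//.
    by rewrite addr_ge0 ?sqr_ge0.
  apply: (measurableT_comp (measurable_powR _)).
  apply: measurable_funM => //; apply: measurable_funD.
    by apply: (measurableT_comp (exprn_measurable 2)).
  by apply: (measurableT_comp (exprn_measurable 2)).
split; apply: measurable_funM => //.
  by apply: measurable_funB; exact: measurable_funM.
apply: (measurableT_comp (@oppr_measurable R setT)).
by apply: measurable_funD; exact: measurable_funM.
Qed.

Lemma summable_sym_mul k g : bounded_measurable g ->
  summable_fun mu (fun t => symR k t * g t) /\
  summable_fun mu (fun t => symI k t * g t).
Proof.
move=> [mg [c gc]]; have [mR mI] := measurable_sym k.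
have c0 : 0 <= c by exact: le_trans (gc 0).
have sU := summableZ c summable_envelope.
split; apply: (summable_le _ sU); try exact: measurable_funM.
  by move=> t; have [h _] := sym_le k t; rewrite normrM mulrC ler_pM.
by move=> t; have [_ h] := sym_le k t; rewrite normrM mulrC ler_pM.
Qed.

Lemma summable_pairing k g h : bounded_measurable g -> bounded_measurable h ->
  summable_fun mu (fun t => symR k t * g t - symI k t * h t).
Proof.
by move=> bg bh; apply: summableB; [case: (summable_sym_mul k bg)|case: (summable_sym_mul k bh)].
Qed.

(** The real part of (2 pi)^-1 times the integral of the symbol against g + i h.
    The imaginary part is the real part for h - i g, so that one real functional
    serves for both. *)
Definition pairing k g h : R :=
  (2 * pi)^-1 * \int[mu]_t (symR k t * g t - symI k t * h t).

Lemma pairing_lin (I : Type) (s : seq I) (al : I -> R) k (u v : I -> R -> R) g h :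
  (forall i, bounded_measurable (u i)) -> (forall i, bounded_measurable (v i)) ->
  bounded_measurable g -> bounded_measurable h ->
  \sum_(i <- s) al i * pairing k (u i) (v i) - pairing k g h =
  pairing k (fun t => \sum_(i <- s) al i * u i t - g t)
            (fun t => \sum_(i <- s) al i * v i t - h t).
Proof.
move=> bu bv bg bh; rewrite /pairing.
have su i := summableZ (al i) (summable_pairing k (bu i) (bv i)).
under eq_bigr => i _.
  rewrite mulrCA -RintZ; last exact: summable_pairing.
  over.
rewrite -mulr_sumr -mulrBr; congr (_ * _).
rewrite -Rintsum; last exact: su.
rewrite -RintB; [|by apply: summable_sum; exact: su|exact: summable_pairing].
apply: eq_Rintegral => t _; rewrite !mulrBr opprB.
rewrite (_ : \sum_(i <- s) _ = symR k t * (\sum_(i <- s) al i * u i t) -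
  symI k t * (\sum_(i <- s) al i * v i t)); first by ring.
rewrite !mulr_sumr -sumrB; apply: eq_bigr => i _; ring.
Qed.

Lemma pairing_le k g h : bounded_measurable g -> bounded_measurable h ->
  `|pairing k g h| <= (2 * pi)^-1 * \int[mu]_t (envelope t * (`|g t| + `|h t|)).
Proof.
move=> bg bh; have pi0 : (0 : R) <= (2 * pi)^-1 by rewrite invr_ge0 mulr_ge0 ?pi_ge0.
rewrite normrM ger0_norm// ler_wpM2l//.
apply: Rint_norm_le; first exact: summable_pairing.
  have [mg [c gc]] := bg; have [mh [d hd]] := bh.
  have sU := summableZ (c + d) summable_envelope.
  apply: (summable_le _ sU).
    apply: measurable_funM; first exact: summable_measurable summable_envelope.
    by apply: measurable_funD; exact: measurableT_comp.
  move=> t; have U0 : 0 <= envelope t.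
    by have [h0 _] := sym_le k t; exact: le_trans h0.
  rewrite normrM (ger0_norm U0) mulrC ler_wpM2r// ger0_norm ?addr_ge0//.
  exact: lerD.
move=> t; have [h1 h2] := sym_le k t.
apply: (le_trans (ler_normB _ _)); rewrite (normrM (symR k t)) (normrM (symI k t)).
rewrite [leRHS]mulrDr; apply: lerD.
  exact: ler_wpM2r.
exact: ler_wpM2r.
Qed.

Lemma phi_tildeE k y : phi_tilde phi law j k y =
  pairing k (fun t => cos (t * y)) (fun t => sin (t * y)) +i*
  pairing k (fun t => sin (t * y)) (fun t => - cos (t * y)).
Proof.
rewrite /phi_tilde /inv_fourier /pairing.
under [X in cintegral _ X]eq_fun do rewrite symbolE /expi.
have mE (c u v : R) : c%:C * (u +i* v) = (c * u) +i* (c * v).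
  apply: (etrans (_ : _ = (c * u - 0 * v) +i* (c * v + 0 * u))) => //.
  by congr (_ +i* _); ring.
rewrite /cintegral /leb mE; congr (_ +i* _).
by congr (_ * _); apply: eq_Rintegral => t _ /=; ring.
Qed.

Section Target.
Variable f : R -> R.
Hypothesis sf : summable_fun mu f.

(** The real and imaginary parts of the characteristic function of Y, the
    product of those of X and of the error. *)
Definition mean_cos t := fcos f t * lcos law t - fsin f t * lsin law t.
Definition mean_sin t := fcos f t * lsin law t + fsin f t * lcos law t.

Lemma bm_mean : bounded_measurable mean_cos /\ bounded_measurable mean_sin.
Proof.
have := bm_fcos sf; have := bm_fsin sf; have := bm_lcos law; have := bm_lsin law.
by move=> bq bp bs bc; split; [apply: bmB|apply: bmD]; exact: bmM.
Qed.

(** On the band the characteristic function of the error cancels, and what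
    remains is Parseval's identity for phi(r . - k) and f; outside the band both
    sides vanish. *)
Lemma pairing_mean k : pairing k mean_cos mean_sin = wcoef phi r f k.
Proof.
have bh : band_limited (r * a) (fun y => phi (r * y - k%:~R)).
  split; first exact: summable_affine.
  move=> t /(sym_out k)[c0 s0].
  have [c1 s1] := @trans_dilate R (translates phi k) r t r0 (summable_translates k sphi).
  by rewrite /translates in c1 s1 *; rewrite c1 s1 c0 s0 !mulr0.
have [c1 s1] : (forall t, fcos (fun y => phi (r * y - k%:~R)) t = r^-1 * fcos (translates phi k) (r^-1 * t)) /\
  (forall t, fsin (fun y => phi (r * y - k%:~R)) t = r^-1 * fsin (translates phi k) (r^-1 * t)).
  by split => t; have [] := @trans_dilate R (translates phi k) r t r0 (summable_translates k sphi).
rewrite /wcoef (parseval bh sf) /pairing; congr (_ * _).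
apply: eq_Rintegral => t _; rewrite c1 s1 /symR /symI /mean_cos /mean_sin.
have [tr|/(sym_out k)[-> ->]] := leP `|t| (r * a); last by ring.
have Nt : N t != 0.
  have := law_norm tr; apply: contraTneq => ->.
  by rewrite sqrtr0 -ltNge.
by rewrite /N in Nt *; field; rewrite Nt gt_eqF.
Qed.

(** The imaginary part of the coefficient vanishes because its integrand is odd. *)
Lemma pairing_mean0 k : bounded_measurable mean_cos -> bounded_measurable mean_sin ->
  pairing k mean_sin (fun t => - mean_cos t) = 0.
Proof.
move=> bc bs; rewrite /pairing.
set G := fun t => _; have sG : summable_fun mu G by exact: summable_pairing bs (bmN bc).
have sk := summable_translates k sphi.
have GN t : G (- t) = - G t.
  rewrite /G /symR /symI /mean_cos /mean_sin /N mulrN !fcosN !fsinN// lcosN lsinN.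
  rewrite !sqrrN; ring.
have : \int[mu]_t G t = - \int[mu]_t G t.
  rewrite -{1}(Rint_reflect sG) -[RHS]mulN1r -RintZ//.
  by apply: eq_Rintegral => t _; rewrite GN mulN1r.
by move=> h; rewrite (_ : \int[mu]_t _ = 0) ?mulr0//; lra.
Qed.

End Target.

End Deconvolution.

(** * The stochastic error *)

Section ComplexParts.
Context {R : realType}.
Implicit Types (c u v : R).

Lemma real_mul_complex c u v : c%:C * (u +i* v) = (c * u) +i* (c * v).
Proof.
apply: (etrans (_ : _ = (c * u - 0 * v) +i* (c * v + 0 * u))) => //.
by congr (_ +i* _); ring.
Qed.

Lemma sum_complex (I : Type) (s : seq I) (u v : I -> R) :
  \sum_(i <- s) ((u i) +i* (v i)) =
  (\sum_(i <- s) u i) +i* (\sum_(i <- s) v i) :> R[i].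
Proof. by elim: s => [|i s IH]; rewrite ?big_nil// !big_cons IH. Qed.

Lemma normc_le u v : normc (u +i* v) <= `|u| + `|v|.
Proof.
have -> : `|u| + `|v| = Num.sqrt ((`|u| + `|v|) ^+ 2).
  by apply/esym; rewrite sqrtr_sqr ger0_norm ?addr_ge0.
rewrite /= ler_wsqrtr// -[u ^+ 2]real_normK ?num_real//.
rewrite -[v ^+ 2]real_normK ?num_real// sqrrD lerD2r lerDl.
by rewrite mulrn_wge0// mulr_ge0.
Qed.

End ComplexParts.

Section Stochastic.
Context {R : realType}.
Notation mu := (@lebesgue_measure R).
Notation MR := (measurableTypeR R).
Implicit Types (g h : R -> R) (k : int) (t x : R).

Variables (phi : R -> R) (law : probability MR R) (a j D B : R).
Let r : R := 2 `^ j.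
Hypotheses (cphi : continuous phi) (bphi : band_limited a phi) (D0 : 0 < D).
Hypothesis lawD : forall t, `|t| <= r * a -> D <= normc (fourier_law law t).
Hypothesis perB : forall x N, psum (fun k => `|phi (x - k%:~R)|) N <= B.

Let r0 : 0 < r. Proof. by rewrite powR_gt0. Qed.
Let sphi : summable_fun mu phi. Proof. by case: bphi. Qed.

Variable f : R -> R.
Hypotheses (sf : summable_fun mu f) (bc : bounded_measurable (mean_cos law f))
  (bs : bounded_measurable (mean_sin law f)).
Variables (n : nat).
Hypothesis n0 : (0 < n)%N.

(** The deviations of the empirical characteristic function from its mean, by
    components. *)
Definition dev_cos (y : 'I_n -> R) t : R :=
  n%:R^-1 * (\sum_(m < n) cos (t * y m)) - mean_cos law f t.
Definition dev_sin (y : 'I_n -> R) t : R :=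
  n%:R^-1 * (\sum_(m < n) sin (t * y m)) - mean_sin law f t.

(** One random variable that majorizes the errors on all coefficients at once. *)
Definition noise (y : 'I_n -> R) : R := (2 * pi)^-1 *
  \int[mu]_t (envelope phi a j D t * (`|dev_cos y t| + `|dev_sin y t|)).

Lemma bm_dev y : bounded_measurable (dev_cos y) /\ bounded_measurable (dev_sin y).
Proof.
by split; apply: bmB => //; apply: (bmM (bm_cst _)); apply: bm_sum => i;
  [exact: bm_cos|exact: bm_sin].
Qed.

Let ptR k y := pairing phi law j k (fun t => cos (t * y)) (fun t => sin (t * y)).
Let ptI k y := pairing phi law j k (fun t => sin (t * y)) (fun t => - cos (t * y)).

Lemma noise_coefR (y : 'I_n -> R) k :
  `|\sum_(m < n) n%:R^-1 * ptR k (y m) - wcoef phi r f k| <= noise y.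
Proof.
rewrite -(pairing_mean bphi D0 lawD sf) (pairing_lin bphi D0 lawD)//.
- have [b1 b2] := bm_dev y.
  under [X in pairing _ _ _ _ X]eq_fun do rewrite -mulr_sumr.
  under [X in pairing _ _ _ _ _ X]eq_fun do rewrite -mulr_sumr.
  by have := pairing_le bphi D0 lawD k b1 b2.
- by move=> i; exact: bm_cos.
- by move=> i; exact: bm_sin.
Qed.

(** The subtracted 0 is the imaginary part of the target coefficient, kept so
    that the real and imaginary parts are treated by the same linearity lemma. *)
Lemma noise_coefI (y : 'I_n -> R) k :
  `|\sum_(m < n) n%:R^-1 * ptI k (y m) - 0| <= noise y.
Proof.
have := @pairing_lin _ _ _ _ _ _ bphi D0 lawD 'I_n (index_enum _) (fun=> n%:R^-1) k
  (fun m t => sin (t * y m)) (fun m t => - cos (t * y m)) _ _ _ _ bs (bmN bc).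
rewrite (pairing_mean0 bphi D0 lawD sf k bc bs) => ->.
- have [b1 b2] := bm_dev y.
  have := pairing_le bphi D0 lawD k b2 (bmN b1).
  under eq_Rintegral do rewrite normrN addrC.
  under [X in _ -> `|pairing _ _ _ _ X _| <= _]eq_fun do rewrite -mulr_sumr.
  under [X in _ -> `|pairing _ _ _ _ _ X| <= _]eq_fun do
    rewrite -mulr_sumr sumrN mulrN -opprD.
  exact.
- by move=> i; exact: bm_sin.
- by move=> i; apply: bmN; exact: bm_cos.
Qed.

Let M : R := (2 * pi)^-1 * \int[mu]_t (2 * envelope phi a j D t).

Let pt_le k y : `|ptR k y| <= M /\ `|ptI k y| <= M.
Proof.
have e0 t : 0 <= envelope phi a j D t.
  by have [h _] := sym_le bphi D0 lawD k t; exact: le_trans h.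
have sU := summableZ 2 (summable_envelope phi a j D).
have pi0 : (0 : R) <= (2 * pi)^-1 by rewrite invr_ge0 mulr_ge0 ?pi_ge0.
have key g h : bounded_measurable g -> bounded_measurable h ->
    (forall t, `|g t| <= 1) -> (forall t, `|h t| <= 1) ->
    `|pairing phi law j k g h| <= M.
  move=> bg bh g1 h1; rewrite (le_trans (pairing_le bphi D0 lawD k bg bh))//.
  rewrite ler_wpM2l//.
  have sg : summable_fun mu (fun t => envelope phi a j D t * (`|g t| + `|h t|)).
    apply: (summable_le _ sU).
      apply: measurable_funM; first exact: summable_measurable (summable_envelope _ _ _ _).
      by apply: measurable_funD; apply: measurableT_comp => //; [case: bg|case: bh].
    move=> t; rewrite normrM (ger0_norm (e0 t)) mulrC ler_wpM2r// ger0_norm ?addr_ge0//.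
    by rewrite (_ : 2 = 1 + 1 :> R)// lerD.
  apply: Rintle => // t; rewrite mulrC ler_wpM2r//.
  by rewrite (_ : 2 = 1 + 1 :> R)// lerD.
split; apply: key; try exact: bm_cos; try exact: bm_sin.
- by move=> t; exact: cos_norm.
- by move=> t; exact: sin_norm.
- by apply: bmN; exact: bm_cos.
- by move=> t; exact: sin_norm.
- by move=> t; rewrite normrN; exact: cos_norm.
Qed.

Lemma estimatorE (y : 'I_n -> R) x : estimator phi law y x j =
  (r * \sum_(m < n) n%:R^-1 * zsum (fun k => phi (r * x - k%:~R) * ptR k (y m))) +i*
  (r * \sum_(m < n) n%:R^-1 * zsum (fun k => phi (r * x - k%:~R) * ptI k (y m))).
Proof.
rewrite /estimator.
under eq_bigr => m _.
  rewrite /kernel_star /czsum.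
  under [fun k => complex.Re _]eq_fun do rewrite (phi_tildeE law j bphi) real_mul_complex /=.
  under [fun k => complex.Im _]eq_fun do rewrite (phi_tildeE law j bphi) real_mul_complex /=.
  rewrite real_mul_complex.
  over.
rewrite sum_complex -(rmorph_nat (real_complex R)) -fmorphV real_mul_complex.
by congr (_ +i* _); rewrite -!mulr_sumr mulrCA.
Qed.

(** The sum over k of |phi(r x - k)| is at most B and each coefficient is off by
    at most the noise, in the real and in the imaginary part; hence the factor
    2. *)
Lemma stochastic_error (y : 'I_n -> R) x :
  normc (estimator phi law y x j - (wproj phi r f x)%:C) <= 2 * (r * B * noise y).
Proof.
have B0 : 0 <= B by apply: le_trans (perB 0 0%N); apply: sumr_ge0.
rewrite estimatorE.
set SR := \sum_(m < n) _; set SI := \sum_(m < n) _.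
have -> : (r * SR) +i* (r * SI) - (wproj phi r f x)%:C =
  (r * SR - wproj phi r f x) +i* (r * (SI - 0)).
  apply: (etrans (_ : _ = (r * SR - wproj phi r f x) +i* (r * SI - 0))) => //.
  by congr (_ +i* _); ring.
apply: (le_trans (normc_le _ _)).
have per := perB (r * x).
pose F := \int[mu]_y `|f y|.
have M'1 k : `|wcoef phi r f k| <= M + B * F.
  rewrite (le_trans (wcoef_le r cphi perB k sf))// lerDr.
  by apply: le_trans (pt_le 0 0).1.
have F0 : 0 <= F by apply: Rintegral_ge0.
have M'2 k y0 : `|ptR k y0| <= M + B * F /\ `|ptI k y0| <= M + B * F.
  by have [h1 h2] := pt_le k y0; rewrite !(le_trans h1, le_trans h2)// lerDl mulr_ge0.
have M0 : 0 <= M + B * F by apply: le_trans (M'1 0).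
rewrite [2 * _]mulr_natl mulr2n; apply: lerD.
  rewrite /wproj -mulrBr normrM gtr0_norm// -mulrA ler_wpM2l ?(ltW r0)//.
  rewrite /SR (zsum_lin _ (fun=> n%:R^-1) (M := M + B * F) per)//; last first.
    by move=> m k; have [] := M'2 k (y m).
  by apply: zsum_le => // k; exact: noise_coefR.
rewrite normrM gtr0_norm// -mulrA ler_wpM2l ?(ltW r0)//.
have z0 : zsum (fun k : int => phi (r * x - k%:~R) * 0) = 0.
  apply/eqP; rewrite -normr_le0 (le_trans (zsum_le (M := 0) per _)) ?mulr0//.
  by move=> k; rewrite normr0.
rewrite -{1}z0 /SI (zsum_lin _ (fun=> n%:R^-1) (M := M + B * F) per)//; last 2 first.
- by move=> m k; have [] := M'2 k (y m).
- by move=> k; rewrite normr0.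
by apply: zsum_le => // k; exact: noise_coefI.
Qed.

Section Expectation.
Context d (T : measurableType d) (P : probability T R).
Variable Y : 'I_n -> {RV P >-> MR}.
Hypotheses (indY : mutually_independent P (fun m => Y m : T -> R)) (a0 : 0 <= a).
Hypothesis Ecos : forall t i, \int[P]_w cos (t * Y i w) = mean_cos law f t.
Hypothesis Esin : forall t i, \int[P]_w sin (t * Y i w) = mean_sin law f t.

Lemma integral_envelope : \int[mu]_t envelope phi a j D t =
  4 * a * (\int[mu]_x `|phi x|) / D.
Proof.
have ra0 : 0 <= r * a by rewrite mulr_ge0// ltW.
have len : \int[mu]_t (\1_(`[- (r * a), r * a]%classic : set R) t) = 2 * (r * a).
  rewrite /Rintegral integral_indic// setIT.
  apply: (etrans (congr1 fine (@lebesgue_measure_itv R `[- (r * a), r * a]))); rewrite /= lte_fin.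
  by case: ifPn => [_|]; [rewrite /=; ring|rewrite -leNgt /=; lra].
rewrite /envelope; under eq_Rintegral do rewrite mulrC.
rewrite RintZ; last exact: summable_indic.
by rewrite len -/r; field; rewrite !gt_eqF.
Qed.

(** For each frequency both deviations have expectation at most n^(-1/2); the
    factors r in the length of the band and in the envelope cancel. *)
Lemma noise_expectation :
  summable_fun P (fun w => noise (fun m => Y m w)) /\
  \int[P]_w noise (fun m => Y m w) <=
    (4 * a * (\int[mu]_x `|phi x|) / (pi * D)) * (Num.sqrt n%:R)^-1.
Proof.
have e0 t : 0 <= envelope phi a j D t.
  by have [h _] := sym_le bphi D0 lawD 0 t; exact: le_trans h.
have [mc [c1 hc1]] := bc; have [ms [c2 hc2]] := bs.
pose F (p : T * MR) := envelope phi a j D p.2 *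
  (`|dev_cos (fun m => Y m p.1) p.2| + `|dev_sin (fun m => Y m p.1) p.2|).
have msnd (g : R -> R) : measurable_fun setT g ->
    measurable_fun setT (fun p : T * MR => g p.2).
  by move=> mg; apply: (measurableT_comp mg); exact: measurable_snd.
have mtr (g : R -> R) i : measurable_fun setT g ->
    measurable_fun setT (fun p : T * MR => g (p.2 * Y i p.1)).
  move=> mg; apply: (measurableT_comp mg); apply: measurable_funM.
    exact: measurable_snd.
  by apply: (measurableT_comp _ measurable_fst); exact: (@measurable_funP _ _ _ _ setT (Y i)).
have mF : measurable_fun setT F.
  apply: measurable_funM; first exact: msnd (summable_measurable (summable_envelope phi a j D)).
  apply: measurable_funD; apply: measurableT_comp => //; apply: measurable_funB;
    try exact: msnd; apply: measurable_funM => //; apply: measurable_sum => i.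
    exact: mtr measurable_cos.
  exact: mtr measurable_sin.
have avg_le (u : 'I_n -> R) : (forall i, `|u i| <= 1) -> `|n%:R^-1 * \sum_(i < n) u i| <= 1.
  move=> u1; rewrite normrM ger0_norm ?invr_ge0// ler_pdivrMl ?ltr0n// mulr1.
  rewrite (le_trans (ler_norm_sum _ _ _))// (le_trans (ler_sum _ (fun i _ => u1 i)))//.
  by rewrite sumr_const card_ord.
have d1 w t : `|dev_cos (fun m => Y m w) t| <= 1 + c1.
  rewrite (le_trans (ler_normB _ _))// lerD//; apply: avg_le => i; exact: cos_norm.
have d2 w t : `|dev_sin (fun m => Y m w) t| <= 1 + c2.
  rewrite (le_trans (ler_normB _ _))// lerD//; apply: avg_le => i; exact: sin_norm.
have s1 : summable_fun P (fun=> 1) by exact: (finite_measure_integrable_cst P 1 measurableT).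
have sU := summableZ (2 + c1 + c2) (summable_envelope phi a j D).
have FF w t : `|F (w, t)| <= 1 * ((2 + c1 + c2) * envelope phi a j D t).
  rewrite mul1r /F /= normrM (ger0_norm (e0 t)) mulrC ler_wpM2r//.
  rewrite ger0_norm ?addr_ge0//.
  by rewrite (_ : 2 + c1 + c2 = 1 + c1 + (1 + c2)) ?lerD//; ring.
have pi0 : (0 : R) < 2 * pi by rewrite mulr_gt0 ?pi_gt0.
have sn := summableZ (2 * pi)^-1 (summable_marginal1 (m1 := P) (m2 := mu) mF s1 sU FF).
split; first exact: sn.
rewrite /noise RintZ; last exact: (summable_marginal1 (m1 := P) (m2 := mu) mF s1 sU FF).
rewrite (Rint_fubini (m1 := P) (m2 := mu) mF s1 sU FF).
have sE := summableZ (2 * (Num.sqrt n%:R)^-1) (summable_envelope phi a j D).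
apply: (@le_trans _ _ ((2 * pi)^-1 * (2 * (Num.sqrt n%:R)^-1 *
   \int[mu]_t envelope phi a j D t))).
  rewrite ler_wpM2l ?invr_ge0 ?(ltW pi0)// -RintZ; last exact: summable_envelope.
  apply: Rintle => //; first exact: (summable_marginal2 (m1 := P) (m2 := mu) mF s1 sU FF).
  move=> t; rewrite /F /=.
  have mYc i : measurable_fun setT (fun w => cos (t * Y i w)).
    exact: (measurable_RV (Y i) (measurable_comp_lin t measurable_cos)).
  have mYs i : measurable_fun setT (fun w => sin (t * Y i w)).
    exact: (measurable_RV (Y i) (measurable_comp_lin t measurable_sin)).
  have sc : summable_fun P (fun w => `|dev_cos (fun m => Y m w) t|).
    apply: summable_norm; apply: (@summable_prob _ _ _ P _ (1 + c1)) => //.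
    by apply: measurable_funB => //; apply: measurable_funM => //; exact: measurable_sum.
  have ss : summable_fun P (fun w => `|dev_sin (fun m => Y m w) t|).
    apply: summable_norm; apply: (@summable_prob _ _ _ P _ (1 + c2)) => //.
    by apply: measurable_funB => //; apply: measurable_funM => //; exact: measurable_sum.
  rewrite RintZ; last exact: summableD.
  rewrite mulrC ler_wpM2r// RintD// mulr_natl mulr2n; apply: lerD.
    apply: (mean_deviation (u := fun x => cos (t * x)) n0 indY) => //.
      exact: measurable_comp_lin measurable_cos.
    by move=> x; exact: cos_norm.
  apply: (mean_deviation (u := fun x => sin (t * x)) n0 indY) => //.
    exact: measurable_comp_lin measurable_sin.
  by move=> x; exact: sin_norm.
rewrite integral_envelope le_eqVlt; apply/orP; left; apply/eqP.
set i := (Num.sqrt _)^-1.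
move: (pi_gt0 R); generalize (@pi R) => p p0.
by field; rewrite (gt_eqF D0) (gt_eqF p0).
Qed.

End Expectation.
End Stochastic.

(** * The risk of the estimator *)

Section Risk.
Context {R : realType}.
Notation mu := (@lebesgue_measure R).
Notation MR := (measurableTypeR R).

Section Convolution.
Variables (law : probability MR R) (f : R -> R).
Context d0 (T0 : measurableType d0) (P0 : probability T0 R).
Variables X eps : {RV P0 >-> MR}.
Context d (T : measurableType d) (P : probability T R).
Variable Y : {RV P >-> MR}.
Hypotheses (mf : measurable_fun setT f) (f0 : forall x, 0 <= f x)
  (sf : summable_fun mu f).
Hypotheses (hX : has_density P0 X f) (heps : has_law P0 eps law)
  (ind : independent2 P0 X eps) (hY : has_law P Y (pushforward P0 (X \+ eps))).

Let ms : measurable_fun setT (X \+ eps : T0 -> R).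
Proof.
by apply: measurable_funD; [exact: (@measurable_funP _ _ _ _ setT X)|
  exact: (@measurable_funP _ _ _ _ setT eps)].
Qed.

Let mc t : measurable_fun setT (fun x : R => cos (t * x)).
Proof. exact: measurable_comp_lin measurable_cos. Qed.

Let mS t : measurable_fun setT (fun x : R => sin (t * x)).
Proof. exact: measurable_comp_lin measurable_sin. Qed.

Let c1 t x : `|cos (t * x)| <= 1 :> R. Proof. exact: cos_norm. Qed.
Let s1 t x : `|sin (t * x)| <= 1 :> R. Proof. exact: sin_norm. Qed.

Let prodE (u v : R -> R) : measurable_fun setT u -> measurable_fun setT v ->
  (forall x, `|u x| <= 1) -> (forall x, `|v x| <= 1) ->
  \int[P0]_w (u (X w) * v (eps w)) =
    (\int[mu]_x (f x * u x)) * (\int[law]_x v x) /\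
  summable_fun P0 (fun w => u (X w) * v (eps w)).
Proof.
move=> mu' mv u1 v1; split.
  rewrite (independent_expectation ind mu' mv u1 v1).
  by rewrite (density_expectation hX mf f0 sf mu' u1) (law_expectation heps mv v1).
apply: (@summable_prob _ _ _ P0 _ 1).
  by apply: measurable_funM; exact: measurable_RV.
by move=> w; rewrite normrM mulr_ile1.
Qed.

Lemma expectation_cos t : \int[P]_w cos (t * Y w) = mean_cos law f t.
Proof.
rewrite (pushforward_expectation ms hY (mc t) (c1 t)).
have [e1 h1] := prodE (mc t) (mc t) (c1 t) (c1 t).
have [e2 h2] := prodE (mS t) (mS t) (s1 t) (s1 t).
rewrite /mean_cos /fcos /fsin /lcos /lsin -e1 -e2 -RintB//.
by apply: eq_Rintegral => w _; rewrite /= mulrDr cosD.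
Qed.

Lemma expectation_sin t : \int[P]_w sin (t * Y w) = mean_sin law f t.
Proof.
rewrite (pushforward_expectation ms hY (mS t) (s1 t)).
have [e1 h1] := prodE (mc t) (mS t) (c1 t) (s1 t).
have [e2 h2] := prodE (mS t) (mc t) (s1 t) (c1 t).
rewrite /mean_sin /fcos /fsin /lcos /lsin -e1 -e2 -RintD//.
by apply: eq_Rintegral => w _; rewrite /= mulrDr sinD addrC.
Qed.

End Convolution.

(** The bound g on the supremum does not depend on x and is summable, so
    integral_le_any applies. *)
Lemma sup_risk (phi f : R -> R) (law : probability MR R) (a j D B bias : R) n
    d (T : measurableType d) (P : probability T R) (Y : 'I_n -> {RV P >-> MR}) :
  continuous phi -> band_limited a phi -> 0 < D -> 0 <= a -> (0 < n)%N ->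
  (forall t, `|t| <= 2 `^ j * a -> D <= normc (fourier_law law t)) ->
  (forall x N, psum (fun k => `|phi (x - k%:~R)|) N <= B) ->
  summable_fun mu f ->
  (forall x, `|wproj phi (2 `^ j) f x - f x| <= bias) ->
  mutually_independent P (fun m => Y m : T -> R) ->
  (forall t i, \int[P]_w cos (t * Y i w) = mean_cos law f t) ->
  (forall t i, \int[P]_w sin (t * Y i w) = mean_sin law f t) ->
  (\int[P]_w ereal_sup
     [set (normc (estimator phi law (fun m => Y m w) x j - (f x)%:C))%:E
     | x in [set: R]] <=
   (2 `^ j * B * (8 * a * (\int[mu]_x `|phi x|) / (pi * D)) *
      (Num.sqrt n%:R)^-1 + bias)%:E)%E.
Proof.
move=> cphi bphi D0 a0 n0 lawD perB sf hbias ind Ec Es.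
have [bc bs] := bm_mean law sf.
have B0 : 0 <= B by apply: le_trans (perB 0 0%N); apply: sumr_ge0.
have [sn En] := noise_expectation bphi D0 lawD bc bs n0 ind a0 Ec Es.
pose g w := 2 * (2 `^ j * B) * noise phi law a j D f (fun m => Y m w) + bias.
have sg1 := summableZ (2 * (2 `^ j * B)) sn.
have sb : summable_fun P (fun=> bias) by exact: (finite_measure_integrable_cst P bias measurableT).
apply: (@le_trans _ _ (\int[P]_w (g w)%:E)%E).
  apply: integral_le_any => w.
    apply: le_trans (ereal_sup_ubound _); last by exists 0.
    by rewrite lee_fin; case: (_ - _) => u v; rewrite /= sqrtr_ge0.
  apply: ge_ereal_sup => _ [x _ <-]; rewrite lee_fin.
  set e := estimator _ _ _ _ _; set p := wproj phi (2 `^ j) f x.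
  have -> : e - (f x)%:C = (e - p%:C) + ((p - f x) +i* 0).
    have -> : (p - f x) +i* 0 = p%:C - (f x)%:C.
      by rewrite -rmorphB.
    by rewrite addrA subrK.
  rewrite (le_trans (le_normcD _ _))// /g lerD//.
    by rewrite -mulrA; exact: stochastic_error.
  by rewrite (le_trans (normc_le _ _))// normr0 addr0; exact: hbias.
rewrite Rint_EFin; last exact: summableD.
rewrite lee_fin RintD// RintZ// Rint_prob_cst lerD2r.
apply: le_trans (ler_wpM2l _ En) _.
  by rewrite mulr_ge0// mulr_ge0// powR_ge0.
rewrite le_eqVlt; apply/orP; left; apply/eqP.
move: (pi_gt0 R); generalize (@pi R) => q q0; set i := (Num.sqrt _)^-1.
by field; rewrite (gt_eqF D0) (gt_eqF q0).
Qed.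

Lemma resolutionE (alpha nu : R) n : 0 < nu -> (2 <= n)%N ->
  2 `^ resolution alpha nu n = (nu * ln n%:R) `^ alpha^-1.
Proof.
move=> nu0 n2; have l2 : 0 < ln 2 :> R by rewrite ln_gt0// ltr1n.
have u0 : 0 < ln n%:R :> R by rewrite ln_gt0// ltr1n.
rewrite /resolution /powR !gt_eqF ?mulr_gt0//.
by congr expR; rewrite -mulrA divfK// gt_eqF.
Qed.

(** From ln w <= w - 1 with w = delta u / p. It absorbs the powers of ln n in
    the negative power n^(- delta). *)
Lemma power_exp_le (u p delta : R) : 0 < u -> 0 < p -> 0 < delta ->
  u `^ p * expR (- (delta * u)) <= (p / delta) `^ p.
Proof.
move=> u0 p0 d0; have w0 : 0 < delta * u / p by rewrite divr_gt0 ?mulr_gt0.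
have pd0 : 0 < p / delta by rewrite divr_gt0.
have -> : u = p / delta * (delta * u / p) by field; rewrite !gt_eqF.
set w := delta * u / p in w0 *.
have -> : delta * (p / delta * w) = p * w by field; rewrite gt_eqF.
rewrite (powRM _ (ltW pd0) (ltW w0)) -[_ * expR _]mulrA ler_piMr ?powR_ge0//.
rewrite {1}/powR gt_eqF// -expRD -[leRHS](expR0) ler_expR -mulrBr.
have : ln w <= w - 1.
  by rewrite -{1}(subrKC 1 w) le_ln1Dx// ltrBrDl subrr.
by move=> h; rewrite pmulr_rle0// subr_le0 (le_trans h)// gerBl.
Qed.

End Risk.

Lemma powRV_r (R : realType) (u p : R) : 0 <= u -> u^-1 `^ p = u `^ (- p).
Proof. by move=> u0; rewrite -powR_inv1// -powRrM mulN1r. Qed.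

Lemma sqrt_nat (R : realType) n : (0 < n)%N ->
  (Num.sqrt n%:R)^-1 = expR (- (ln n%:R / 2)) :> R.
Proof.
move=> n0; rewrite expRN; congr (_^-1).
have {1}-> : n%:R = expR (ln n%:R / 2) ^+ 2 :> R.
  by rewrite -expRM_natr divfK ?lnK// ?posrE ?ltr0n.
by rewrite sqrtr_sqr ger0_norm// expR_ge0.
Qed.

Theorem theorem2 (R : realType) (phiM psiM : R -> R)
    (hM : meyer_pair phiM psiM)
    (phi psi : R -> R) (C c0 alpha nu s L : R)
    (hC : 0 < C) (hc0 : 0 < c0) (halpha : 0 < alpha) (hnu : 0 < nu)
    (hs : 0 < s) (hL : 0 < L) :
  exists L''' : R,
    forall (a' a : R), wavelet_condition phi psi a' a ->
      c0 * a `^ alpha * nu < 2^-1 ->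
    forall law : probability (measurableTypeR R) R,
      (forall t : R,
        C * expR (- (c0 * `|t| `^ alpha)) <= normc (fourier_law law t)) ->
    forall n : nat, (2 <= n)%N ->
    forall f : R -> R, holder_class phiM psiM s L f ->
    (* Y = X + eps *)
    forall (d0 : measure_display) (T0 : measurableType d0)
      (P0 : probability T0 R) (X eps : {RV P0 >-> measurableTypeR R}),
      has_density P0 X f -> has_law P0 eps law -> independent2 P0 X eps ->
    (* Y_1, ..., Y_n i.i.d. copies of Y *)
    forall (d : measure_display) (T : measurableType d)
      (P : probability T R) (Y : 'I_n -> {RV P >-> measurableTypeR R}),
      (forall m, has_law P (Y m) (pushforward P0 (X \+ eps))) ->
      mutually_independent P (fun m => Y m : T -> R) ->
    (\int[P]_w ereal_sup
        [set (normc (estimator phi law (fun m => Y m w) x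
                       (resolution alpha nu n) - (f x)%:C))%:E
        | x in [set: R]]
     <= (L''' * (ln n%:R)^-1 `^ (s / alpha))%:E)%E.

Proof.
have [[a' [a [hw hk]]]|none] := pselect (exists a' a : R,
    wavelet_condition phi psi a' a /\ c0 * a `^ alpha * nu < 2^-1); last first.
  by exists 0 => a' a hw hk; case: none; exists a', a.
have [_ cphi Lp [/andP[a'0 a'a] supphi _] [perphi _]] := hw.
have a0 : 0 < a by exact: lt_trans a'a.
have [/Lfun1_summable sphi _] := Lp 1%:E (lexx _).
have bphi : band_limited a phi.
  by apply: (band_limited_supp sphi supphi) => t /=; rewrite in_itv /= -ler_norml.
have [B B0 perB] := periodization_bound perphi.
have [Cb hCb] := bias_bound hM hw hs hL.
pose kappa := c0 * a `^ alpha * nu.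
(* The polynomial rate left in the stochastic part; positive by the condition on nu. *)
pose delta := 2^-1 - kappa.
have d0 : 0 < delta by rewrite subr_gt0.
(* The power of ln n to be absorbed: 1 / alpha from the factor r and s / alpha to reach
   the rate. *)
pose p := (1 + s) / alpha.
have p0 : 0 < p by rewrite divr_gt0// addr_gt0.
pose K := B * (8 * a * (\int[lebesgue_measure]_x `|phi x|) / (pi * C)).
have K0 : 0 <= K.
  apply: mulr_ge0 => //; apply: divr_ge0; last by rewrite mulr_ge0 ?pi_ge0 ?(ltW hC).
  apply: mulr_ge0; last by apply: Rintegral_ge0.
  by rewrite mulr_ge0// ltW.
exists (K * nu `^ alpha^-1 * (p / delta) `^ p + Cb * nu `^ (- (s / alpha))).
move=> _ _ _ _ law hlaw n n2 f hf d1 T0 P0 X eps hX heps ind d T P Y hY indY.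
pose u : R := ln n%:R.
have u0 : 0 < u by rewrite ln_gt0// ltr1n.
have n0 : (0 < n)%N by exact: ltn_trans n2.
have [cf _ f0 _ _] := hf.
have [_ sf _] := holder_L2 hf.
have mf : measurable_fun setT f := measurable_cont cf.
set j := resolution alpha nu n.
have rE : 2 `^ j = (nu * u) `^ alpha^-1 by exact: resolutionE.
have r0 : 0 < 2 `^ j :> R by rewrite powR_gt0.
have nu0 : 0 < nu * u by rewrite mulr_gt0.
have ra : (2 `^ j * a) `^ alpha = nu * u * a `^ alpha.
  rewrite powRM ?(ltW r0) ?(ltW a0)// rE -powRrM mulVf ?gt_eqF// powRr1//.
  exact: ltW.
(* The lower bound of the characteristic function of the errors at the edge of the band,
   C n^(- kappa). *)
pose D := C * expR (- (kappa * u)).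
have D0 : 0 < D by rewrite mulr_gt0 ?expR_gt0.
have lawD t : `|t| <= 2 `^ j * a -> D <= normc (fourier_law law t).
  move=> ht; apply: le_trans (hlaw t); rewrite /D ler_wpM2l ?(ltW hC)//.
  rewrite ler_expR lerN2.
  have -> : kappa * u = c0 * (2 `^ j * a) `^ alpha by rewrite ra /kappa; ring.
  rewrite ler_wpM2l ?(ltW hc0)//; apply: ge0_ler_powR => //; first exact: ltW.
  by rewrite nnegrE mulr_ge0 ?(ltW r0) ?(ltW a0).
have bias x : `|wproj phi (2 `^ j) f x - f x| <= Cb * (2 `^ j) `^ (- s) by exact: hCb.
have Ec t i := expectation_cos mf f0 sf hX heps ind (hY i) t.
have Es t i := expectation_sin mf f0 sf hX heps ind (hY i) t.
apply: (le_trans (sup_risk cphi bphi D0 (ltW a0) n0 lawD perB sf bias indY Ec Es)).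
rewrite lee_fin -/u (powRV_r _ (ltW u0)) [leRHS]mulrDl; apply: lerD; last first.
  rewrite rE -powRrM mulrN (mulrC alpha^-1) (powRM _ (ltW hnu) (ltW u0)).
  by rewrite mulrA.
have -> : 2 `^ j * B * (8 * a * (\int[lebesgue_measure]_x `|phi x|) / (pi * D)) *
    (Num.sqrt n%:R)^-1 = K * (2 `^ j * expR (- (delta * u))).
  rewrite (sqrt_nat R n0) -/u /delta mulrBl opprB expRD /K /D.
  have -> : expR (kappa * u) = (expR (- (kappa * u)))^-1 by rewrite expRN invrK.
  have -> : 2^-1 * u = u / 2 by rewrite mulrC.
  have := expR_gt0 (- (kappa * u)); set e := expR (- (kappa * u)) => e0.
  move: (pi_gt0 R); generalize (@pi R) => q q0.
  by field; rewrite (gt_eqF hC) (gt_eqF q0) (gt_eqF e0).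
rewrite -(mulrA (K * _)) -(mulrA K) ler_wpM2l// rE (powRM _ (ltW hnu) (ltW u0)).
rewrite -(mulrA (nu `^ _)) ler_wpM2l ?powR_ge0//.
have -> : u `^ alpha^-1 = u `^ (- (s / alpha)) * u `^ p.
  rewrite -powRD; last by rewrite (gt_eqF u0) implybT.
  by congr (_ `^ _); rewrite /p; field; rewrite gt_eqF.
rewrite -(mulrA (u `^ _)) [leRHS]mulrC ler_wpM2l ?powR_ge0//.
exact: power_exp_le.
Qed.
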